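(* Let $M$ be a compact, connected, oriented Riemannian manifold and let $P:\mathscr{D}'(M)\to\mathscr{D}'(M)$ be a continuous linear operator that maps $\mathscr{C}^\infty(M)$ into itself. If the kernel of ${}^{\mathrm t}P:\mathscr{C}^\infty(M)\to\mathscr{C}^\infty(M)$ is dense in the kernel of ${}^{\mathrm t}P:\mathscr{D}'(M)\to\mathscr{D}'(M)$, then the following are equivalent: (1) $P$ is globally solvable in $\mathscr{C}^\infty$; (2) ${}^{\mathrm t}P$ is globally solvable in $\mathscr{D}'$; (3) $P$ is almost globally hypoelliptic (AGH) in $M$.
   Context: $\mathscr{D}'(M)$ is the space of distributions on $M$, i.e. the topological dual of $\mathscr{C}^\infty(M)$, endowed with the strong dual topology (density above refers to this topology); functions are identified with distributions through the Riemannian volume form. ${}^{\mathrm t}P$ denotes the transpose of $P$ for the duality between $\mathscr{C}^\infty(M)$ and $\mathscr{D}'(M)$; by reflexivity it is also a continuous operator on $\mathscr{D}'(M)$ mapping $\mathscr{C}^\infty(M)$ into itself. For an operator $Q$ of this kind: - $Q$ is globally solvable in $\mathscr{C}^\infty$ if for every $f\in\mathscr{C}^\infty(M)$ with $\langle v,f\rangle=0$ for every $v\in\mathscr{D}'(M)$ such that ${}^{\mathrm t}Qv=0$, there exists $u\in\mathscr{C}^\infty(M)$ with $Qu=f$; - $Q$ is globally solvable in $\mathscr{D}'$ if for every $f\in\mathscr{D}'(M)$ with $\langle f,v\rangle=0$ for every $v\in\mathscr{C}^\infty(M)$ such that ${}^{\mathrm t}Qv=0$, there exists $u\in\mathscr{D}'(M)$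 with $Qu=f$; - $Q$ is almost globally hypoelliptic (AGH) in $M$ if for every $u\in\mathscr{D}'(M)$ with $Qu\in\mathscr{C}^\infty(M)$ there exists $v\in\mathscr{C}^\infty(M)$ such that $Qv=Qu$. *)

(* Defs.v *)
From HB Require Import structures.
From mathcomp Require Import all_boot all_order all_algebra finmap.
From mathcomp Require Import complex ring lra.
From mathcomp Require Import all_classical all_reals all_analysis.

Set Implicit Arguments.
Unset Strict Implicit.
Unset Printing Implicit Defensive.

Import Order.TTheory GRing.Theory Num.Theory.
Import numFieldNormedType.Exports.

Local Open Scope classical_set_scope.
Local Open Scope ring_scope.
Local Open Scope complex_scope.

(* The topology of R[i] is the one it has as a numFieldType. *)
HB.instance Definition _ (R : realType) := NormedModule.copy R[i] R[i]^o.

Section euclidean.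
Variable R : realType.

Definition evec n (i : 'I_n) : 'rV[R]_n := delta_mx ord0 i.

(* [pderiv [:: i1; ...; ik] f] is d_{i1} ... d_{ik} f. *)
Definition pderiv n (s : seq 'I_n) (f : 'rV[R]_n -> R) : 'rV[R]_n -> R :=
  foldr (fun i g x => 'D_(evec i) g x) f s.

(* f is of class C^oo on the open set U: all its iterated partial derivatives
   exist and are continuous on U.  The values of f outside U are irrelevant. *)
Definition smooth_on n (U : set 'rV[R]_n) (f : 'rV[R]_n -> R) : Prop :=
  forall (s : seq 'I_n) (x : 'rV[R]_n), U x ->
    {for x, continuous (pderiv s f)} /\
    forall i, derivable (pderiv s f) x (evec i).

(* Integral over R^n, by iterated integration: by Tonelli this is the integral
   with respect to the n-dimensional Lebesgue measure for every nonnegative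
   Borel function f, the only ones it is used for. *)
Fixpoint integral_rV n : ('rV[R]_n -> \bar R) -> \bar R :=
  match n with
  | 0 => fun f => f 0
  | n'.+1 => fun f =>
     (\int[@lebesgue_measure R]_t
        @integral_rV n' (fun y => f (row_mx (t%:M : 'rV_1) y)))%E
  end.

End euclidean.

Section smooth_on_theory.
Variables (R : realType) (n : nat) (U : set 'rV[R]_n).
Hypothesis oU : open U.
Implicit Types f g : 'rV[R]_n -> R.

Lemma pderiv_lincomb f g (a b : R) : smooth_on U f -> smooth_on U g ->
  forall s x, U x -> pderiv s (fun y => a * f y + b * g y) x =
                     a * pderiv s f x + b * pderiv s g x.
Proof.
move=> sf sg; elim=> [//|i s IH] x Ux /=.
rewrite (@near_eq_derive _ _ _ _ ((a \*: pderiv s f) + (b \*: pderiv s g))).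
  have [_ /(_ i) df] := sf s x Ux; have [_ /(_ i) dg] := sg s x Ux.
  by rewrite deriveD ?deriveZ//; exact: derivableZ.
by near=> y; apply: IH; near: y; exact: open_nbhs_nbhs.
Unshelve. all: by end_near. Qed.

Lemma smooth_on_lincomb f g (a b : R) : smooth_on U f -> smooth_on U g ->
  smooth_on U (fun y => a * f y + b * g y).
Proof.
move=> sf sg s x Ux.
have [cf df] := sf s x Ux; have [cg dg] := sg s x Ux.
have e : {near x, (a \*: pderiv s f) + (b \*: pderiv s g) =1
                  pderiv s (fun y => a * f y + b * g y)}.
  near=> y; rewrite pderiv_lincomb//.
  by near: y; exact: open_nbhs_nbhs.
split=> [|i].
  rewrite /prop_for /continuous_at pderiv_lincomb//.
  apply: (cvg_trans (near_eq_cvg e)).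
  by apply: cvgD; apply: cvgZl_tmp.
apply: (near_eq_derivable e).
by apply: derivableD; apply: derivableZ.
Unshelve. all: by end_near. Qed.

Lemma pderiv0 (s : seq 'I_n) x : pderiv s (fun=> 0 : R) x = 0 :> R.
Proof.
elim: s x => [//|i s IH] x /=.
rewrite (_ : pderiv s _ = cst 0) ?derive_cst//.
by apply/funext => y; exact: IH.
Qed.

Lemma smooth_on0 : smooth_on U (fun=> 0 : R).
Proof.
move=> s x _; rewrite (_ : pderiv s _ = cst 0); last first.
  by apply/funext => y; exact: pderiv0.
split=> [|i]; first exact: (@cst_continuous _ _ (0 : R) x).
exact: derivable_cst.
Qed.

End smooth_on_theory.

(* Smooth manifolds of dimension n given by an oriented atlas.  The functions
   [chart_map i] and [chart_inv i] are meaningful only on [chart_dom i] and on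
   its image, respectively, where they are inverse homeomorphisms.
   Second countability is not required: it follows from compactness. *)
Record oriented_manifold (R : realType) (n : nat) := OrientedManifold {
  om_space :> ptopologicalType ;
  om_hausdorff : hausdorff_space om_space ;
  chart : choiceType ;
  chart_dom : chart -> set om_space ;
  chart_map : chart -> om_space -> 'rV[R]_n ;
  chart_inv : chart -> 'rV[R]_n -> om_space ;
  chart_dom_open : forall i, open (chart_dom i) ;
  chart_dom_cover : forall x, exists i, chart_dom i x ;
  chart_map_open : forall i, open (chart_map i @` chart_dom i) ;
  chart_mapK : forall i x, chart_dom i x -> chart_inv i (chart_map i x) = x ;
  chart_map_continuous : forall i, {within chart_dom i, continuous (chart_map i)} ;
  chart_inv_continuous : forall i,
    {within chart_map i @` chart_dom i, continuous (chart_inv i)} ;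
  transition_smooth : forall i j k,
    smooth_on (chart_map i @` (chart_dom i `&` chart_dom j))
              (fun y => chart_map j (chart_inv i y) ord0 k) ;
  transition_oriented : forall i j y,
    (chart_map i @` (chart_dom i `&` chart_dom j)) y ->
    0 < \det ('J (chart_map j \o chart_inv i) y)
}.

Definition chart_img (R : realType) (n : nat) (X : oriented_manifold R n)
  (i : chart X) : set 'rV[R]_n := chart_map i @` chart_dom i.

(* The value at y of the matrix of the metric in the chart i, for y in
   [chart_img i]; 'J is the transpose of the usual Jacobian matrix, so that
   the last field is the usual change of coordinates for the metric. *)
Record riemannian_metric (R : realType) (n : nat) (X : oriented_manifold R n) :=
  RiemannianMetric {
  metric_mx :> chart X -> 'rV[R]_n -> 'M[R]_n ;
  metric_smooth : forall i k l,
    smooth_on (chart_img i) (fun y => metric_mx i y k l) ;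
  metric_sym : forall i y, chart_img i y -> (metric_mx i y)^T = metric_mx i y ;
  metric_pos : forall i y (v : 'rV[R]_n), chart_img i y -> v != 0 ->
    0 < (v *m metric_mx i y *m v^T) ord0 ord0 ;
  metric_transition : forall i j y,
    (chart_map i @` (chart_dom i `&` chart_dom j)) y ->
    metric_mx i y = 'J (chart_map j \o chart_inv i) y
      *m metric_mx j (chart_map j (chart_inv i y))
      *m ('J (chart_map j \o chart_inv i) y)^T
}.

Definition borel_type (T : ptopologicalType) := g_sigma_algebraType (@open T).

(* The measure defined by the Riemannian volume form, which in a (positively
   oriented) chart is sqrt (det g) dy_1 ... dy_n.  As the charts cover X, at
   most one Borel measure satisfies this when X is compact. *)
Definition is_riemannian_volume (R : realType) (n : nat)
    (X : oriented_manifold R n) (g : riemannian_metric X)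
    (mu : {measure set (borel_type X) -> \bar R}) : Prop :=
  forall (i : chart X) (A : set (borel_type X)), measurable A -> A `<=` chart_dom i ->
    mu A = integral_rV (fun y =>
      if y \in chart_map i @` A then (Num.sqrt (\det (g i y)))%:E else 0%E).

(* Compact, connected, oriented Riemannian manifolds (nonempty, since the
   underlying space is pointed), with their volume measure. *)
Record compact_riemannian (R : realType) (n : nat) := CompactRiemannian {
  cr_manifold :> oriented_manifold R n ;
  cr_compact : compact [set: cr_manifold] ;
  cr_connected : connected [set: cr_manifold] ;
  cr_metric : riemannian_metric cr_manifold ;
  vol : {measure set (borel_type cr_manifold) -> \bar R} ;
  vol_riemannian : is_riemannian_volume cr_metric vol
}.

Section smooth_functions.
Variables (R : realType) (n : nat).

Definition cpderiv (s : seq 'I_n) (f : 'rV[R]_n -> R[i]) : 'rV[R]_n -> R[i] :=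
  fun y => pderiv s (fun z => complex.Re (f z)) y +i*
           pderiv s (fun z => complex.Im (f z)) y.

Variable X : oriented_manifold R n.

Definition is_smooth (f : X -> R[i]) : Prop := forall i : chart X,
  smooth_on (chart_img i) (fun y => complex.Re (f (chart_inv i y))) /\
  smooth_on (chart_img i) (fun y => complex.Im (f (chart_inv i y))).

Definition smooth_pred : {pred X -> R[i]} := [pred f | `[< is_smooth f >]].

Lemma smooth_submod_closed : submod_closed smooth_pred.
Proof.
split=> [|a f g]; rewrite !inE.
  by move=> i; split; exact: smooth_on0.
move=> sf sg i.
have oi : open (chart_img i) := @chart_map_open _ _ X i.
have [fr fi] := sf i; have [gr gi] := sg i.
split.
- have := smooth_on_lincomb oi 1 1
    (smooth_on_lincomb oi (complex.Re a) (- complex.Im a) fr fi) gr.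
  congr (smooth_on _ _); apply/funext => y.
  rewrite -[(a *: f + g) _]/(a * f _ + g _).
  by case: a (f _) (g _) => [ar ai] [? ?] [? ?] /=; ring.
- have := smooth_on_lincomb oi 1 1
    (smooth_on_lincomb oi (complex.Re a) (complex.Im a) fi fr) gi.
  congr (smooth_on _ _); apply/funext => y.
  rewrite -[(a *: f + g) _]/(a * f _ + g _).
  by case: a (f _) (g _) => [ar ai] [? ?] [? ?] /=; ring.
Qed.

HB.instance Definition _ :=
  GRing.isSubmodClosed.Build _ _ smooth_pred smooth_submod_closed.

Record smooth_fun := SmoothFun {
  smooth_val :> X -> R[i] ;
  smooth_valP : smooth_val \in smooth_pred }.

HB.instance Definition _ := [isSub for smooth_val].
HB.instance Definition _ := [Choice of smooth_fun by <:].
HB.instance Definition _ := [SubChoice_isSubLmodule of smooth_fun by <:].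

Definition chart_compact (i : chart X) : set (set 'rV[R]_n) :=
  [set K | compact K /\ K `<=` chart_img i].

(* The C^oo topology: f is mapped to the family of all its partial derivatives
   in all the charts, and each of these converges uniformly on the compact
   subsets of the image of the chart. *)
Definition jets (f : smooth_fun) :
    prod_topology (fun k : chart X * seq 'I_n =>
      {family chart_compact k.1, 'rV[R]_n -> R[i]}) :=
  fun k => cpderiv k.2 (fun y => f (chart_inv k.1 y)).

HB.instance Definition _ :=
  Uniform.copy smooth_fun (initial_topology jets).

(* Bounded sets in the sense of topological vector spaces: absorbed by every
   neighbourhood of 0. *)
Definition smooth_bounded : set (set smooth_fun) :=
  [set B | forall V : set smooth_fun, nbhs (0 : smooth_fun) V ->
     exists2 r : R, 0 < r & forall c : R[i], r%:C <= `|c| ->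
       B `<=` [set c *: f | f in V]].

Definition is_distribution (u : smooth_fun -> R[i]) : Prop :=
  linear u /\ continuous u.

Definition schwartz_dist_pred : {pred smooth_fun -> R[i]} :=
  [pred u | `[< is_distribution u >]].

Lemma schwartz_dist_submod_closed : submod_closed schwartz_dist_pred.
Proof.
split=> [|a u v].
  apply: asboolT; split=> [c f g|f]; last exact: (@cst_continuous _ _ (0 : R[i])).
  by rewrite -[LHS]/(0 : R[i]) -[RHS]/(c * 0 + 0 : R[i]) mulr0 addr0.
move=> /asboolP[lu cu] /asboolP[lv cv]; apply: asboolT; split=> [c f g|f].
  rewrite -[LHS]/(a * u (c *: f + g) + v (c *: f + g)).
  rewrite -[RHS]/(c * (a * u f + v f) + (a * u g + v g)) lu lv.
  rewrite -[c *: u f]/(c * u f) -[c *: v f]/(c * v f).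
  by ring.
have Ff : Filter (nbhs f) := nbhs_filter f.
apply: cvgD; last exact: cv.
by apply: cvgM; [exact: cvg_cst|exact: cu].
Qed.

HB.instance Definition _ :=
  GRing.isSubmodClosed.Build _ _ schwartz_dist_pred schwartz_dist_submod_closed.

(* D'(X), the topological dual of C^oo(X). *)
Record schwartz_dist := SchwartzDist {
  schwartz_dist_val :> smooth_fun -> R[i] ;
  schwartz_dist_valP : schwartz_dist_val \in schwartz_dist_pred }.

HB.instance Definition _ := [isSub for schwartz_dist_val].
HB.instance Definition _ := [Choice of schwartz_dist by <:].
HB.instance Definition _ := [SubChoice_isSubLmodule of schwartz_dist by <:].

Definition to_strong (u : schwartz_dist) :
  {family smooth_bounded, smooth_fun -> R[i]} := u.

(* The strong dual topology: uniform convergence on bounded sets. *)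
HB.instance Definition _ :=
  Uniform.copy schwartz_dist (initial_topology to_strong).

End smooth_functions.

Section integral_rV_theory.
Variable R : realType.

Lemma nnintegral_le d (T : measurableType d) (mu : {measure set T -> \bar R})
    (f g : T -> \bar R) : (forall x, 0 <= f x)%E -> (forall x, f x <= g x)%E ->
  (\int[mu]_x f x <= \int[mu]_x g x)%E.
Proof.
move=> f0 fg; rewrite !ge0_integralTE//; last first.
  by move=> x; exact: le_trans (fg x).
apply: ereal_sup_le => _ [h hf <-]; exists h => // x.
exact: le_trans (fg x).
Qed.

Lemma integral_rV_ge0 n (f : 'rV[R]_n -> \bar R) :
  (forall y, 0 <= f y)%E -> (0 <= integral_rV f)%E.
Proof.
elim: n f => [|n IH] f f0 //=.
by apply: integral_ge0 => t _; exact: IH.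
Qed.

Lemma integral_rV_le n (f g : 'rV[R]_n -> \bar R) :
  (forall y, 0 <= f y)%E -> (forall y, f y <= g y)%E ->
  (integral_rV f <= integral_rV g)%E.
Proof.
elim: n f g => [|n IH] f g f0 fg //=.
by apply: nnintegral_le => t; [exact: integral_rV_ge0|exact: IH].
Qed.

Lemma integral_rV0 n : integral_rV (fun _ : 'rV[R]_n => 0%E) = 0%E :> \bar R.
Proof.
elim: n => [|n IH] //=.
by under eq_integral do rewrite IH; exact: integral0.
Qed.

Lemma integral_rV_box n (p : 'rV[R]_n) (r C : R) : 0 < r -> 0 <= C ->
  (integral_rV (fun y => if `[< forall k, (`|y ord0 k - p ord0 k| <= r)%R >]
    then C%:E else 0) < +oo)%E.
Proof.
move=> r0 C0; elim: n p => [|n IH] p /=.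
  by case: ifP => _; exact: ltry.
pose q : 'rV[R]_n := rsubmx (p : 'M[R]_(1, 1 + n)).
pose V := integral_rV (fun y : 'rV[R]_n =>
  if `[< forall k, `|y ord0 k - q ord0 k| <= r >]
  then C%:E else 0%E).
have V0 : (0 <= V)%E by apply: integral_rV_ge0 => y; case: ifP.
have Vfin : V \is a fin_num by rewrite ge0_fin_numE//; exact: IH.
pose a := p ord0 ord0.
apply: (@le_lt_trans _ _ (\int[@lebesgue_measure R]_(t in `[(a - r)%R, (a + r)%R]) V)%E).
  rewrite [leRHS]integral_mkcond; apply: nnintegral_le => t.
    by apply: integral_rV_ge0 => y; case: ifP.
  rewrite patchE; case: ifPn => [_|].
    apply: integral_rV_le => y; first by case: ifP.
    case: asboolP => [h|_]; last by case: ifP.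
    rewrite asboolT// => k.
    have := h (rshift 1 k : 'I_(1 + n)).
    by rewrite (@row_mxEr _ 1 1 n t%:M y ord0 k) mxE.
  rewrite notin_setE/= => nt.
  rewrite (_ : (fun y => _) = fun=> 0%E) ?integral_rV0//.
  apply/funext => y; rewrite asboolF// => h; apply: nt.
  have := h (@lshift 1 n ord0 : 'I_(1 + n)).
  rewrite (@row_mxEl _ 1 1 n t%:M y ord0 ord0) mxE eqxx mulr1n.
  rewrite (_ : @lshift 1 n ord0 = ord0 :> 'I_(1 + n)) -/a; last exact: val_inj.
  by rewrite ler_norml in_itv/=; lra.
rewrite -(fineK Vfin) integral_cst//.
have /= L := lebesgue_measure_itv `[a - r, a + r].
rewrite [X in (_ * X < _)%E]L.
by case: ifP => _; rewrite -?EFinB -?EFinM ?mule0 ltry.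
Qed.

End integral_rV_theory.

Section charts.
Variables (R : realType) (n : nat) (X : oriented_manifold R n).
Implicit Types (i : chart X) (x : X).

Lemma open_chart_img i : open (chart_img i).
Proof. exact: chart_map_open. Qed.

Lemma chart_img_coord i x : chart_dom i x -> chart_img i (chart_map i x).
Proof. by move=> ix; exists x. Qed.

Lemma coord_continuous_at i x : chart_dom i x -> {for x, continuous (chart_map i)}.
Proof.
move=> ix; have := @chart_map_continuous _ _ X i.
by rewrite continuous_open_subspace; [apply; rewrite inE|exact: chart_dom_open].
Qed.

Lemma chart_near_open i x (r : R) : chart_dom i x -> 0 < r ->
  open_nbhs x (chart_dom i `&` chart_map i @^-1` ball (chart_map i x) r).
Proof.
move=> ix r0; split; last by split=> //; exact: ballxx.
rewrite openE => y [iy by_]; apply: filterI.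
  by apply: open_nbhs_nbhs; split => //; exact: chart_dom_open.
apply: (coord_continuous_at iy).
by apply: open_nbhs_nbhs; split => //; exact: ball_open.
Qed.

End charts.

Lemma sum_continuous_at (T : topologicalType) (R : realType) (I : Type)
    (s : seq I) (F : I -> T -> R) y :
  (forall k, {for y, continuous (F k)}) ->
  {for y, continuous (fun z => \sum_(k <- s) F k z)}.
Proof.
move=> cF; elim: s => [|k s IH].
  rewrite (_ : (fun z => _) = cst 0); last by apply/funext => z; rewrite big_nil.
  exact: (@cst_continuous _ _ (0 : R) y).
rewrite (_ : (fun z => _) = fun z => F k z + \sum_(k <- s) F k z); last first.
  by apply/funext => z; rewrite big_cons.
rewrite /prop_for /continuous_at.
by apply: cvgD; [exact: cF|exact: IH].
Qed.

Lemma prod_continuous_at (T : topologicalType) (R : realType) (I : Type)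
    (s : seq I) (F : I -> T -> R) y :
  (forall k, {for y, continuous (F k)}) ->
  {for y, continuous (fun z => \prod_(k <- s) F k z)}.
Proof.
move=> cF; elim: s => [|k s IH].
  rewrite (_ : (fun z => _) = cst 1); last by apply/funext => z; rewrite big_nil.
  exact: (@cst_continuous _ _ (1 : R) y).
rewrite (_ : (fun z => _) = fun z => F k z * \prod_(k <- s) F k z); last first.
  by apply/funext => z; rewrite big_cons.
rewrite /prop_for /continuous_at.
by apply: cvgM; [exact: cF|exact: IH].
Qed.

Lemma det_continuous_at (T : topologicalType) (R : realType) m
    (A : T -> 'M[R]_m) y :
  (forall k l, {for y, continuous (fun z => A z k l)}) ->
  {for y, continuous (fun z => \det (A z))}.
Proof.
move=> cA; apply: sum_continuous_at => s.
rewrite /prop_for /continuous_at; apply: cvgM; first exact: cvg_cst.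
by apply: prod_continuous_at => k; exact: cA.
Qed.

Section volume.
Variables (R : realType) (n : nat) (X : compact_riemannian R n).

Lemma open_measurable_borel (A : set (borel_type X)) : @open X A -> measurable A.
Proof. exact: sub_sigma_algebra. Qed.

Lemma vol_locally_finite (x : X) :
  exists A : set X, open_nbhs x A /\ (vol X A < +oo)%E.
Proof.
have [i ix] := @chart_dom_cover _ _ X x.
set p := chart_map i x.
pose h y := Num.sqrt (\det (cr_metric X i y)).
have ch : {for p, continuous h}.
  apply: (@continuous_comp _ _ _ (fun y => \det (cr_metric X i y)) Num.sqrt).
    apply: det_continuous_at => k l.
    by have [] := @metric_smooth _ _ _ (cr_metric X) i k l [::] p (chart_img_coord ix).
  exact: sqrt_continuous.
have : \forall y \near p, chart_img i y /\ h y < h p + 1.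
  apply: filterI.
    apply: open_nbhs_nbhs; split; first exact: open_chart_img.
    exact: chart_img_coord.
  have Fp : Filter (nbhs p) := nbhs_filter p.
  by apply: (@cvgr_lt _ _ (nbhs p) Fp h (h p)); [exact: ch|rewrite ltrDl].
move=> /nbhs_ballP[r /= r0 rp].
have oA := chart_near_open ix r0.
exists (chart_dom i `&` chart_map i @^-1` ball p r); split => //.
rewrite (@vol_riemannian _ _ X i); [|by apply: open_measurable_borel; case: oA|exact: subIsetl].
apply: le_lt_trans (integral_rV_box p r0 (_ : 0 <= h p + 1)); last first.
  by rewrite addr_ge0// sqrtr_ge0.
apply: integral_rV_le => y; first by case: ifP => // _; rewrite lee_fin sqrtr_ge0.
case: ifPn => [|_]; last by case: ifP => // _; rewrite lee_fin addr_ge0// sqrtr_ge0.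
rewrite inE => -[z [iz bz] <-].
rewrite asboolT; first by rewrite lee_fin ltW//; have [] := rp _ bz.
move=> k; have [_ /(_ ord0 k)] := bz.
by rewrite -ball_normE/= distrC => /ltW.
Qed.

Lemma vol_finite : (vol X [set: X] < +oo)%E.
Proof.
pose A x := projT1 (cid (vol_locally_finite x)).
have oA x : open (A x) by rewrite /A; case: cid => /= ? [[]].
have Ax x : A x x by rewrite /A; case: cid => /= ? [[]].
have fA x : (vol X (A x) < +oo)%E by rewrite /A; case: cid => /= ? [].
have := @cr_compact _ _ X; rewrite compact_cover.
move=> /(_ X setT A (fun x _ => oA x)) [|D' _ cov].
  by move=> x _; exists x.
suff H (s : seq X) : exists2 B : set (borel_type X), measurable B /\ (vol X B < +oo)%E &
    forall x, x \in s -> A x `<=` B.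
  have [B [mB fB] sB] := H (enum_fset D').
  apply: le_lt_trans fB; apply: le_measure; rewrite ?inE//.
  by move=> x /cov[y /= yD Ay]; exact: (sB y).
elim: s => [|x s [B [mB fB] sB]].
  by exists set0 => //; split => //; rewrite measure0 ltry.
have mA : measurable (A x : set (borel_type X)) by exact: open_measurable_borel.
exists (A x `|` B).
  split; first exact: measurableU.
  apply: (@le_lt_trans _ _ (vol X (A x) + vol X B)%E).
    exact: measureU2.
  by rewrite lte_add_pinfty.
move=> y; rewrite inE => /predU1P[->|ys]; first exact: subsetUl.
by move=> z /(sB _ ys); right.
Qed.

End volume.

Section smooth_fun_theory.
Variables (R : realType) (n : nat).

Lemma Re_le_norm (z : R[i]) : `|complex.Re z|%:C <= `|z|.
Proof.
case: z => a b; rewrite normc_def /= lecR -sqrtr_sqr ler_sqrt//.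
  by rewrite lerDl sqr_ge0.
by rewrite addr_ge0 ?sqr_ge0.
Qed.

Lemma Im_le_norm (z : R[i]) : `|complex.Im z|%:C <= `|z|.
Proof.
case: z => a b; rewrite normc_def /= lecR -sqrtr_sqr ler_sqrt//.
  by rewrite lerDr sqr_ge0.
by rewrite addr_ge0 ?sqr_ge0.
Qed.

Lemma norm_le_ReIm (a b : R) : `|a +i* b| <= (`|a| + `|b|)%:C.
Proof.
rewrite normc_def /= lecR -[leRHS]ger0_norm; last by rewrite addr_ge0.
rewrite -sqrtr_sqr ler_wsqrtr// sqrrD !real_normK ?num_real//.
by rewrite lerD2r lerDl mulrn_wge0// mulr_ge0.
Qed.

Variable X : oriented_manifold R n.

Lemma smooth_funP (f : smooth_fun X) : is_smooth f.
Proof. by apply/asboolP; exact: smooth_valP. Qed.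

Lemma near_coord (h : X -> R) (x : X) i : chart_dom i x ->
  {for chart_map i x, continuous (fun y => h (chart_inv i y))} ->
  {for x, continuous h}.
Proof.
move=> ix ch.
have : {for x, continuous ((fun y => h (chart_inv i y)) \o chart_map i)}.
  by apply: continuous_comp => //; exact: coord_continuous_at.
rewrite /prop_for /continuous_at /= chart_mapK// => hx.
apply: cvg_trans hx; apply: near_eq_cvg.
have [oA Ax] := chart_near_open ix ltr01.
near=> z; rewrite /= chart_mapK//.
by near: z; apply: filterS (open_nbhs_nbhs (conj oA Ax)) => z [].
Unshelve. all: by end_near. Qed.

Lemma smooth_Re_continuous (f : smooth_fun X) :
  continuous (fun x => complex.Re (f x)).
Proof.
move=> x; have [i ix] := chart_dom_cover x; apply: (near_coord ix).
have [/(_ [::] _ (chart_img_coord ix))[]] := smooth_funP f i.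
by [].
Qed.

Lemma smooth_Im_continuous (f : smooth_fun X) :
  continuous (fun x => complex.Im (f x)).
Proof.
move=> x; have [i ix] := chart_dom_cover x; apply: (near_coord ix).
have [_ /(_ [::] _ (chart_img_coord ix))[]] := smooth_funP f i.
by [].
Qed.

Lemma jet_continuous (k : chart X * seq 'I_n) :
  continuous (fun g : smooth_fun X =>
    (jets g k : {family chart_compact k.1, 'rV[R]_n -> R[i]})).
Proof.
move=> g.
have cj : {for g, continuous (@jets R n X)} by exact: initial_continuous.
have cp := @proj_continuous _ (fun k : chart X * seq 'I_n =>
  {family chart_compact k.1, 'rV[R]_n -> R[i]}) k (jets g).
exact: (continuous_comp cj cp).
Qed.

Lemma smooth_near_sup (f : smooth_fun X) (e : R) : compact [set: X] -> 0 < e ->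
  \forall g \near f, forall x : X, `|f x - (g : smooth_fun X) x| < e%:C.
Proof.
move=> cX e0.
have /compact_near_coveringP/(_ _ (nbhs f) (fun (g : smooth_fun X) x => `|f x - g x| < e%:C)) := cX.
move=> /(_ (nbhs_filter f)) H.
have {}H : \forall g \near f,
    [set: X] `<=` (fun x => `|f x - (g : smooth_fun X) x| < e%:C).
  apply: H => x _; have [i ix] := chart_dom_cover x.
  have /nbhs_closedballP[r rp] : nbhs (chart_map i x) (chart_img i).
    apply: open_nbhs_nbhs; split; first exact: open_chart_img.
    exact: chart_img_coord.
  have cK : chart_compact i (closed_ball (chart_map i x) r%:num).
    split=> //; apply: bounded_closed_compact; last exact: closed_ball_closed.
    exists (`|chart_map i x| + r%:num); split; first exact: num_real.
    move=> M hM y; rewrite closed_ballE// => /= hy.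
    apply: le_trans (ltW hM); rewrite -lerBlDl.
    by apply: le_trans hy; rewrite distrC; exact: lerB_dist.
  exists ((chart_dom i `&` chart_map i @^-1` ball (chart_map i x) r%:num),
    [set g : smooth_fun X | forall y, closed_ball (chart_map i x) r%:num y ->
       `|f (chart_inv i y) - g (chart_inv i y)| < e%:C]).
    split; first by apply: open_nbhs_nbhs; exact: chart_near_open.
    pose k : chart X * seq 'I_n := (i, [::]).
    have e0C : 0 < e%:C :> R[i] by rewrite ltcR.
    have Eb : entourage [set ab : R[i] * R[i] | ball ab.1 e%:C ab.2].
      exact: (entourage_ball _ (PosNum e0C)).
    have Nf := @jet_continuous k f _ (fam_nbhs _ Eb cK).
    apply: (@filterS _ (nbhs f) (nbhs_filter f) _ _ _ Nf) => g hg y Ky.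
    have := hg y Ky.
    rewrite /= -ball_normE/= /jets/= /cpderiv/=.
    by case: (f _) (g _) => [? ?] [? ?].
  move=> [z g] /= [[iz bz] hg].
  have := hg (chart_map i z); rewrite chart_mapK//; apply.
  exact: subset_closed_ball.
by apply: filterS H => g hg x; exact: hg.
Qed.

End smooth_fun_theory.

Section pairing.
Variables (R : realType) (n : nat) (X : compact_riemannian R n).

Definition cintegral (h : X -> R[i]) : R[i] :=
  (\int[vol X]_x complex.Re (h x)) +i* (\int[vol X]_x complex.Im (h x)).

Definition pairing (f g : smooth_fun X) : R[i] :=
  cintegral (fun x => f x * g x).

Lemma continuous_vol_integrable (h : X -> R) : continuous h ->
  (vol X).-integrable [set: X] (EFin \o h).
Proof.
move=> ch; apply: measurable_bounded_integrable => //.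
- exact: vol_finite.
- apply: (measurability _ (measurable_realfun.RGenOpens.measurableE R)) => _ [_ [a [b ->]] <-].
  rewrite setTI; apply: open_measurable_borel.
  by have /continuousP := ch; apply; exact: interval_open.
- have /compact_bounded[M [Mr hM]] : compact (h @` [set: X]).
    apply: continuous_compact; last exact: cr_compact.
    exact: continuous_subspaceT.
  exists M; split => // x Mx y _; apply: hM => //; exists y.
Qed.

Lemma cintegral_lin (h1 h2 : X -> R[i]) (a : R[i]) :
  continuous (fun x => complex.Re (h1 x)) ->
  continuous (fun x => complex.Im (h1 x)) ->
  continuous (fun x => complex.Re (h2 x)) ->
  continuous (fun x => complex.Im (h2 x)) ->
  cintegral (fun x => a * h1 x + h2 x) = a * cintegral h1 + cintegral h2.
Proof.
move=> r1 i1 r2 i2; case: a => a b.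
have Ir1 := continuous_vol_integrable r1.
have Ii1 := continuous_vol_integrable i1.
have Ir2 := continuous_vol_integrable r2.
have Ii2 := continuous_vol_integrable i2.
have IZ (c : R) (h : X -> R) : continuous h ->
    (vol X).-integrable [set: X] (EFin \o (fun x => c * h x)).
  move=> ch; apply: continuous_vol_integrable => x.
  by apply: cvgM; [exact: cvg_cst|exact: ch].
have ID (c d : R) (h k : X -> R) : continuous h -> continuous k ->
    (vol X).-integrable [set: X] (EFin \o (fun x => c * h x + d * k x)).
  move=> ch ck; apply: continuous_vol_integrable => x.
  by apply: cvgD; apply: cvgM; [exact: cvg_cst|exact: ch|exact: cvg_cst|exact: ck].
have L (c d : R) (h k l : X -> R) : continuous h -> continuous k -> continuous l ->
    \int[vol X]_x (c * h x + d * k x + l x) =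
    c * \int[vol X]_x h x + d * \int[vol X]_x k x + \int[vol X]_x l x.
  move=> ch ck cl.
  rewrite RintegralD//; [|exact: ID|exact: continuous_vol_integrable].
  rewrite RintegralD//; [|exact: IZ|exact: IZ].
  by rewrite !RintegralZl//; exact: continuous_vol_integrable.
rewrite /cintegral.
have -> : (fun x => complex.Re ((a +i* b) * h1 x + h2 x)) =
   (fun x => a * complex.Re (h1 x) + (- b) * complex.Im (h1 x) + complex.Re (h2 x)).
  by apply/funext => x; case: (h1 x) (h2 x) => [? ?] [? ?] /=; ring.
have -> : (fun x => complex.Im ((a +i* b) * h1 x + h2 x)) =
   (fun x => a * complex.Im (h1 x) + b * complex.Re (h1 x) + complex.Im (h2 x)).
  by apply/funext => x; case: (h1 x) (h2 x) => [? ?] [? ?] /=; ring.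
rewrite !L//; apply/eqP; rewrite eq_complex /=.
by apply/andP; split; apply/eqP; ring.
Qed.

Let Re_mul (z w : R[i]) : complex.Re (z * w) =
  complex.Re z * complex.Re w - complex.Im z * complex.Im w.
Proof. by case: z w => [? ?] [? ?]. Qed.

Let Im_mul (z w : R[i]) : complex.Im (z * w) =
  complex.Re z * complex.Im w + complex.Im z * complex.Re w.
Proof. by case: z w => [? ?] [? ?]. Qed.

Lemma smooth_mul_Re_continuous (f g : smooth_fun X) :
  continuous (fun x => complex.Re (f x * g x)).
Proof.
move=> x; rewrite (_ : (fun x => _) = (fun x => complex.Re (f x) * complex.Re (g x)
  - complex.Im (f x) * complex.Im (g x))); last by apply/funext => y; rewrite Re_mul.
by apply: cvgB; apply: cvgM;
  [exact: smooth_Re_continuous|exact: smooth_Re_continuous|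
   exact: smooth_Im_continuous|exact: smooth_Im_continuous].
Qed.

Lemma smooth_mul_Im_continuous (f g : smooth_fun X) :
  continuous (fun x => complex.Im (f x * g x)).
Proof.
move=> x; rewrite (_ : (fun x => _) = (fun x => complex.Re (f x) * complex.Im (g x)
  + complex.Im (f x) * complex.Re (g x))); last by apply/funext => y; rewrite Im_mul.
by apply: cvgD; apply: cvgM;
  [exact: smooth_Re_continuous|exact: smooth_Im_continuous|
   exact: smooth_Im_continuous|exact: smooth_Re_continuous].
Qed.

Lemma pairing_linear (f : smooth_fun X) : linear (pairing f).
Proof.
move=> a g h; rewrite -[a *: pairing f g]/(a * pairing f g) /pairing -cintegral_lin; last 4 first.
- exact: smooth_mul_Re_continuous.
- exact: smooth_mul_Im_continuous.
- exact: smooth_mul_Re_continuous.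
- exact: smooth_mul_Im_continuous.
congr cintegral; apply/funext => x.
by rewrite -[(a *: g + h) x]/(a * g x + h x) mulrDr mulrCA.
Qed.

Lemma continuous_norm_bounded (h : X -> R) : continuous h ->
  exists2 M, 0 < M & forall x, `|h x| <= M.
Proof.
move=> ch.
have /compact_bounded[M [Mr hM]] : compact (h @` [set: X]).
  apply: continuous_compact; last exact: cr_compact.
  exact: continuous_subspaceT.
exists (`|M| + 1) => [|x]; first by rewrite ltr_wpDl.
by apply: hM; [rewrite (le_lt_trans (ler_norm _))// ltrDl|exists x].
Qed.

Lemma normr_Rintegral_bound (h : X -> R) (M : R) : continuous h ->
  (forall x, `|h x| <= M) ->
  `|\int[vol X]_x h x| <= M * fine (vol X [set: X]).
Proof.
move=> ch hM.
have Ih := continuous_vol_integrable ch.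
apply: le_trans (le_normr_Rintegral _ Ih) _ => //.
rewrite -Rintegral_cst//; apply: le_Rintegral => //.
- by apply: continuous_vol_integrable => x; apply: cvg_norm; exact: ch.
- by apply: continuous_vol_integrable => x; exact: cvg_cst.
Qed.

Lemma pairing_distribution (f : smooth_fun X) : is_distribution (pairing f).
Proof.
split=> [|g]; first exact: pairing_linear.
have [Mr Mr0 hr] := continuous_norm_bounded (@smooth_Re_continuous _ _ _ f).
have [Mi Mi0 hi] := continuous_norm_bounded (@smooth_Im_continuous _ _ _ f).
pose V := fine (vol X [set: X]).
have V0 : 0 <= V by exact: fine_ge0.
have Fg : Filter (nbhs g) := nbhs_filter g.
apply/cvgrPdist_lt => -[e e'] /=; rewrite ltcE/= => /andP[/eqP ei e0]; subst e'.
pose d := e / (2 * (Mr + Mi) * (V + 1)).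
have V1 : 0 < V + 1 by rewrite ltr_wpDl.
have M0 : 0 < Mr + Mi by rewrite addr_gt0.
have D0 : 0 < 2 * (Mr + Mi) * (V + 1) by rewrite !mulr_gt0.
have d0 : 0 < d by rewrite divr_gt0.
have := smooth_near_sup g (@cr_compact _ _ X) d0.
apply: filterS => h hd.
have -> : pairing f g - pairing f h = pairing f (g - h).
  rewrite (_ : g - h = -1 *: h + g); last by rewrite scaleN1r addrC.
  by rewrite pairing_linear -[_ *: _]/(-1 * pairing f h) mulN1r addrC.
have bd x : `|complex.Re ((g - h) x)| <= d /\ `|complex.Im ((g - h) x)| <= d.
  have gh : `|(g - h) x| < d%:C := hd x.
  by split; rewrite -lecR; apply: le_trans (ltW gh);
    [exact: Re_le_norm|exact: Im_le_norm].
apply: le_lt_trans (norm_le_ReIm _ _) _; rewrite ltcR.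
have B1 : `|\int[vol X]_x complex.Re (f x * (g - h) x)| <= (Mr + Mi) * d * V.
  apply: normr_Rintegral_bound; first exact: smooth_mul_Re_continuous.
  move=> x; rewrite Re_mul (le_trans (ler_normB _ _))// !normrM mulrDl.
  by have [? ?] := bd x; rewrite lerD// ler_pM.
have B2 : `|\int[vol X]_x complex.Im (f x * (g - h) x)| <= (Mr + Mi) * d * V.
  apply: normr_Rintegral_bound; first exact: smooth_mul_Im_continuous.
  move=> x; rewrite Im_mul (le_trans (ler_normD _ _))// !normrM mulrDl.
  by have [? ?] := bd x; rewrite lerD// ler_pM.
apply: le_lt_trans (lerD B1 B2) _.
have E : (Mr + Mi) * d * (V + 1) + (Mr + Mi) * d * (V + 1) = e.
  by rewrite /d; field; rewrite !lt0r_neq0.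
rewrite -[ltRHS]E; have Md : 0 < (Mr + Mi) * d by rewrite mulr_gt0.
by rewrite ltrD// ltr_pM2l// ltrDl.
Qed.

End pairing.

Section operators.
Variables (R : realType) (n : nat) (X : compact_riemannian R n).

Lemma pairing_in (f : smooth_fun X) : pairing f \in @schwartz_dist_pred R n X.
Proof. by apply: asboolT; exact: pairing_distribution. Qed.

(* The identification of C^oo(X) with a subspace of D'(X). *)
Definition dist_of (f : smooth_fun X) : schwartz_dist X :=
  SchwartzDist (pairing_in f).

Implicit Types P Q : schwartz_dist X -> schwartz_dist X.

Definition preserves_smooth P : Prop :=
  forall f : smooth_fun X, exists g : smooth_fun X, P (dist_of f) = dist_of g.

(* The operator induced on C^oo(X) by an operator that preserves it. *)
Definition smooth_restr P (f : smooth_fun X) : smooth_fun X :=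
  xget 0 [set g | P (dist_of f) = dist_of g].

(* The schwartz_dist tP u such that <tP u, f> = <u, P f> for all f in C^oo(X);
   it exists because a continuous linear operator on D'(X) that preserves
   C^oo(X) is continuous on C^oo(X), by the closed graph theorem.  On C^oo(X),
   this operator is the transpose of P : D'(X) -> D'(X). *)
Definition transpose P (u : schwartz_dist X) : schwartz_dist X :=
  xget 0 [set v : schwartz_dist X | forall f, v f = u (smooth_restr P f)].

Definition smooth_solvable Q : Prop :=
  forall f : smooth_fun X,
    (forall v : schwartz_dist X, transpose Q v = 0 -> v f = 0) ->
    exists u : smooth_fun X, Q (dist_of u) = dist_of f.

Definition dist_solvable Q : Prop :=
  forall f : schwartz_dist X,
    (forall v : smooth_fun X, transpose Q (dist_of v) = 0 -> f v = 0) ->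
    exists u : schwartz_dist X, Q u = f.

Definition almost_globally_hypoelliptic Q : Prop :=
  forall u : schwartz_dist X,
    (exists f : smooth_fun X, Q u = dist_of f) ->
    exists v : smooth_fun X, Q (dist_of v) = Q u.

End operators.

(* Main.v *)
Require Import Defs.
From HB Require Import structures.
From mathcomp Require Import all_boot all_order all_algebra finmap.
From mathcomp Require Import complex ring lra.
From mathcomp Require Import all_classical all_reals all_analysis.

(** Let E be the space of smooth functions on M, and D its dual, the space of
    distributions. On the compact manifold M, finitely many balls in charts
    define an increasing sequence of norms on E, for which E is complete and in
    which a bound for one norm makes the preceding one precompact, by the mean
    value theorem. These norms define the topology of uniform convergence of
    all derivatives on compact sets in all charts ([nbhs_norm_ball],
    [nbhs_smooth]), so E is a Frechet-Schwartz space and is reflexive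
    ([reflexivity]). Since P is continuous on D, the functional u |-> (P u)(g)
    is evaluation at some q g in E. Thus the restriction p of P to E has the
    formal transpose q for the pairing of functions, its transpose on D is
    u |-> u o p, and P itself is u |-> u o q. The pairing is nondegenerate
    because the Riemannian volume charges open sets. The theorem becomes a
    statement about p, q and the duality between E and D.

    If p is solvable, its range is the annihilator of the kernel of its
    transpose, hence closed. By the open mapping theorem, p x has a preimage
    whose norms are bounded by those of p x; a distribution u that vanishes on
    the kernel of p takes the same value at this preimage as at x, therefore
    u x is bounded by a norm of p x, and the Hahn-Banach theorem gives w with
    u = w o p ([solvable_dual_solvable]).

    Conversely, if the transpose is solvable, then the functionals that vanish
    on the kernel of p and are bounded by a given norm are uniformly bounded by
    a norm of p x ([dual_solvable_bound]). They compute the distance from x to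
    the kernel of p, so small values of p have small preimages. By the
    Hahn-Banach theorem, a right-hand side orthogonal to the kernel of the
    transpose is a limit of values of p, and successive approximation solves
    the equation exactly ([dual_solvable_solvable]).

    The hypothesis on the kernels serves for the implication from solvability
    to hypoellipticity: if P u = f is smooth, then f is orthogonal to the smooth
    elements of the kernel of the transpose, by density to the whole kernel, and
    so f = p v with v smooth ([solvable_hypoelliptic]).

    The implication from hypoellipticity to solvability rests on an a priori
    estimate of the pairing of p x with g by a norm of p x and a norm of q g
    ([hypoelliptic_bound]). It follows from hypoellipticity by an argument of
    uniform boundedness on series of values of p, combined with the compactness
    in E. The estimate extends to the closure of the range of p, that is, to
    all admissible right-hand sides f. The Hahn-Banach theorem then gives a
    distribution u with P u = f, and hypoellipticity a smooth solution
    ([hypoelliptic_solvable]).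

    All principles of uniform boundedness come from one statement on infinite
    matrices of numbers, [gliding_hump], rather than from the theorem of Baire:
    this form applies as well to series of functionals that vanish on a kernel,
    and to series of values of p, which need not form a complete space. *)

Set Implicit Arguments.
Unset Strict Implicit.
Unset Printing Implicit Defensive.

Import Order.TTheory GRing.Theory Num.Theory.
Import numFieldNormedType.Exports.

Local Open Scope classical_set_scope.
Local Open Scope ring_scope.
Local Open Scope complex_scope.
Import ComplexField.Normc.

(** * The modulus of complex numbers *)

Section modulus.
Variable R : realType.
Implicit Types z w : R[i].

Lemma normc_normr z : `|z| = (normc z)%:C.
Proof. by []. Qed.

Lemma normc_ge0 z : 0 <= normc z.
Proof. by case: z => a b; exact: sqrtr_ge0. Qed.

Lemma normc_le0 z : normc z <= 0 -> z = 0.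
Proof. by move=> h; apply: eq0_normc; apply/le_anti; rewrite h normc_ge0. Qed.

Lemma ler_normcD z w : normc (z + w) <= normc z + normc w.
Proof. exact: le_normcD. Qed.

Lemma normc_opp z : normc (- z) = normc z.
Proof. exact: normcN. Qed.

Lemma normc_distC z w : normc (z - w) = normc (w - z).
Proof. by rewrite -normc_opp opprB. Qed.

Lemma ler_normcB z w : normc (z - w) <= normc z + normc w.
Proof. by rewrite -(normc_opp w); exact: ler_normcD. Qed.

Lemma normc_real (x : R) : normc x%:C = `|x|.
Proof. by rewrite /= expr0n/= addr0 sqrtr_sqr. Qed.

Lemma normc_ge0_real (x : R) : 0 <= x -> normc x%:C = x.
Proof. by move=> x0; rewrite normc_real ger0_norm. Qed.

Lemma Re_le_normc z : `|complex.Re z| <= normc z.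
Proof. by rewrite -lecR; exact: normc_ge_Re. Qed.

Lemma Im_le_normc z : `|complex.Im z| <= normc z.
Proof. by rewrite -lecR; exact: Im_le_norm. Qed.

Lemma normc_sub_ge z w : normc z - normc w <= normc (z - w).
Proof. by rewrite lerBlDr -{1}(subrK w z) ler_normcD. Qed.

Lemma ler_normc_sum (I : Type) (s : seq I) (F : I -> R[i]) :
  normc (\sum_(i <- s) F i) <= \sum_(i <- s) normc (F i).
Proof.
elim/big_rec2: _ => [|i y x _ h]; first by rewrite normc0.
by rewrite (le_trans (ler_normcD _ _))// lerD2l.
Qed.

Lemma real_complexD (x y : R) : (x + y)%:C = x%:C + y%:C :> R[i].
Proof. exact: rmorphD. Qed.

Lemma real_complexM (x y : R) : (x * y)%:C = x%:C * y%:C :> R[i].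
Proof. exact: rmorphM. Qed.

End modulus.

(** * The Hahn-Banach theorem *)

Section sublinear.
Variables (R : realType) (E : lmodType R[i]).
Implicit Types (q s : E -> R) (x y v : E).

Definition sublinear q := (forall x y, q (x + y) <= q x + q y) /\
  (forall (r : R) x, 0 <= r -> q (r%:C *: x) <= r * q x).

Definition seminorm s := (forall x y, s (x + y) <= s x + s y) /\
  (forall c x, s (c *: x) = normc c * s x).

Definition functional (w : E -> R[i]) :=
  forall c x y, w (c *: x + y) = c * w x + w y.

Lemma seminorm_sublinear s : seminorm s -> sublinear s.
Proof. by move=> [sD sZ]; split=> // r x r0; rewrite sZ normc_ge0_real. Qed.

Lemma sublinear0 q : sublinear q -> q 0 = 0.
Proof.
move=> [qD qZ]; apply/le_anti/andP; split.
  by have := qZ 0 0 (lexx _); rewrite scaler0 mul0r.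
by have := qD 0 0; rewrite addr0; lra.
Qed.

Lemma sublinearZ q r x : sublinear q -> 0 <= r -> q (r%:C *: x) = r * q x.
Proof.
move=> sq; rewrite le_eqVlt => /predU1P[<-|r0].
  by rewrite scale0r mul0r sublinear0.
have [_ qZ] := sq; apply/le_anti; rewrite qZ ?(ltW r0)//=.
have := qZ r^-1 (r%:C *: x); rewrite scalerA -real_complexM mulVf ?gt_eqF//.
rewrite scale1r invr_ge0 (ltW r0) => /(_ isT).
by rewrite ler_pdivlMl.
Qed.

Lemma sublinear_geN q x : sublinear q -> - q (- x) <= q x.
Proof.
move=> sq; have [qD _] := sq; have := qD x (- x).
by rewrite subrr sublinear0//; lra.
Qed.

(** The largest sublinear functional below [q] whose value at [- y] is at most
    [- q y]: a linear functional below it agrees with [q] at [y]. *)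
Definition shift_sublinear q y x : R :=
  inf [set q (x + t%:C *: y) - t * q y | t in [set t : R | 0 <= t]].

Section shift.
Variables (q : E -> R) (y : E).
Hypothesis sq : sublinear q.

Let lb x (t : R) : 0 <= t -> - q (- x) <= q (x + t%:C *: y) - t * q y.
Proof.
move=> t0; have [qD _] := sq; have := qD (x + t%:C *: y) (- x).
by rewrite addrC addKr sublinearZ//; lra.
Qed.

Let has_lb x :
  has_inf [set q (x + t%:C *: y) - t * q y | t in [set t : R | 0 <= t]].
Proof.
split; first by exists (q (x + 0%:C *: y) - 0 * q y), 0 => //=.
by exists (- q (- x)) => _ [t t0 <-]; exact: lb.
Qed.

Lemma shift_sublinear_le x (t : R) : 0 <= t ->
  shift_sublinear q y x <= q (x + t%:C *: y) - t * q y.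
Proof. by move=> t0; apply: ge_inf; [have [] := has_lb x|exists t]. Qed.

Lemma shift_sublinear_leq x : shift_sublinear q y x <= q x.
Proof.
have := @shift_sublinear_le x 0 (lexx _).
by rewrite scale0r addr0 mul0r subr0.
Qed.

Lemma shift_sublinearN : shift_sublinear q y (- y) <= - q y.
Proof.
have := @shift_sublinear_le (- y) 1 ler01.
by rewrite scale1r addNr mul1r sublinear0// sub0r.
Qed.

Lemma shift_sublinearP : sublinear (shift_sublinear q y).
Proof.
have [qD qZ] := sq; split=> [a b|r x].
  apply/ler_addgt0Pr => e e0; have e2 : 0 < e / 2 by rewrite divr_gt0.
  have [_ [t /= t0 <-] ta] := inf_adherent e2 (has_lb a).
  have [_ [u /= u0 <-] ub] := inf_adherent e2 (has_lb b).
  have := @shift_sublinear_le (a + b) (t + u) (addr_ge0 t0 u0).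
  have := qD (a + t%:C *: y) (b + u%:C *: y).
  rewrite addrACA -scalerDl -real_complexD => h1 h2.
  rewrite -/(shift_sublinear q y a) -/(shift_sublinear q y b) in ta ub.
  by lra.
rewrite le_eqVlt => /predU1P[<-|r0].
  by rewrite scale0r mul0r (le_trans (shift_sublinear_leq _))// sublinear0.
apply/ler_addgt0Pr => e e0; have e2 : 0 < e / r by rewrite divr_gt0.
have [_ [t /= t0 <-] ta] := inf_adherent e2 (has_lb x).
have := @shift_sublinear_le (r%:C *: x) (r * t) (mulr_ge0 (ltW r0) t0).
rewrite real_complexM -scalerA -scalerDr (sublinearZ _ sq) ?(ltW r0)// => h.
rewrite -/(shift_sublinear q y x) in ta.
have : r * (q (x + t%:C *: y) - t * q y) < r * (shift_sublinear q y x + e / r).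
  by rewrite ltr_pM2l.
rewrite [in ltRHS]mulrDr [r * (e / r)]mulrC divfK ?gt_eqF//.
by lra.
Qed.

End shift.

(** A minimal sublinear functional is linear, because it is not larger than
    any of its shifts. *)
Lemma exists_minimal_sublinear s : sublinear s ->
  exists w, [/\ forall x y, w (x + y) = w x + w y,
    forall (r : R) x, w (r%:C *: x) = r * w x & forall x, w x <= s x].
Proof.
move=> ss.
pose T := {q | sublinear q /\ forall x, q x <= s x}.
pose le (a b : T) := `[< forall x, sval b x <= sval a x >].
have [|||[w [sw ws]] wmin] := @ZL_preorder T (exist _ s (conj ss (fun=> lexx _))) le.
- by move=> a; apply/asboolP.
- move=> a b c /asboolP ab /asboolP bc; apply/asboolP => x.
  exact: le_trans (bc x) (ab x).
- move=> A Atot; have [[a0 Aa0]|A0] := pselect (exists a, A a); last first.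
    by exists (exist _ s (conj ss (fun=> lexx _))) => a Aa; case: A0; exists a.
  pose V x := [set sval a x | a in A].
  have lbV x : has_inf (V x).
    split; first by exists (sval a0 x), a0.
    exists (- s (- x)) => _ [[a [sa sas]] _ <-] /=.
    by apply: le_trans (sublinear_geN x sa); rewrite lerN2.
  have leV x a : A a -> inf (V x) <= sval a x.
    by move=> Aa; apply: ge_inf; [have [] := lbV x|exists a].
  have sV : sublinear (fun x => inf (V x)).
    split=> [x y|r x].
      apply/ler_addgt0Pr => e e0; have e2 : 0 < e / 2 by rewrite divr_gt0.
      have [_ [a Aa <-] xa] := inf_adherent e2 (lbV x).
      have [_ [b Ab <-] yb] := inf_adherent e2 (lbV y).
      have [/asboolP ab|/asboolP ba] := Atot _ _ Aa Ab.
        have := leV (x + y) b Ab; have [[bD _] _] := svalP b.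
        by have := bD x y; have := ab x; lra.
      have := leV (x + y) a Aa; have [[aD _] _] := svalP a.
      by have := aD x y; have := ba y; lra.
    rewrite le_eqVlt => /predU1P[<-|r0].
      rewrite scale0r mul0r (le_trans (leV 0 a0 Aa0))//.
      by rewrite sublinear0//; have [] := svalP a0.
    rewrite -ler_pdivrMl//; apply: lb_le_inf; first by have [] := lbV x.
    move=> _ [a Aa <-]; rewrite ler_pdivrMl//; apply: le_trans (leV _ _ Aa) _.
    by have [[_ aZ] _] := svalP a; exact/aZ/ltW.
  have Vs x : inf (V x) <= s x.
    by apply: le_trans (leV x a0 Aa0) _; have [_] := svalP a0.
  pose PT q := sublinear q /\ forall x, q x <= s x.
  exists (exist PT (fun x => inf (V x)) (conj sV Vs)) => a Aa; apply/asboolP => x /=.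
  exact: leV.
- have wge y x : w x <= shift_sublinear w y x.
    have sh := @shift_sublinearP w y sw.
    have shs z : shift_sublinear w y z <= s z.
      by apply: le_trans (ws z); exact: shift_sublinear_leq.
    pose PT q := sublinear q /\ forall x, q x <= s x.
    have /asboolP h := wmin (exist PT (shift_sublinear w y) (conj sh shs))
      (asboolT (shift_sublinear_leq y sw)).
    exact: h.
  have wD x y : w (x + y) = w x + w y.
    apply/le_anti; have [wD _] := sw; rewrite wD /=.
    have := @shift_sublinear_le w y sw x 1 ler01.
    by rewrite scale1r mul1r; have := wge y x; lra.
  have wN x : w (- x) = - w x.
    have := wD x (- x); rewrite subrr sublinear0//; lra.
  exists w; split=> // r x; have [r0|r0] := leP 0 r.
    by rewrite sublinearZ.
  have r0' : 0 <= - r by rewrite oppr_ge0 ltW.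
  have := sublinearZ x sw r0'.
  by rewrite rmorphN/= scaleNr wN mulNr => /oppr_inj.
Qed.

(** A minimal real-linear functional [w] below the shift of [s] at [v] is the
    real part of the complex functional [w x - i w (i x)]; rotating [x] so that
    the value is real carries the bound [s] over from [w]. *)
Lemma functional_le_seminorm s v : seminorm s ->
  exists w, [/\ functional w, forall x, normc (w x) <= s x & w v = (s v)%:C].
Proof.
move=> ss; have sl := seminorm_sublinear ss.
have [w [wD wZ ws]] := exists_minimal_sublinear (shift_sublinearP v sl).
have wN x : w (- x) = - w x.
  have := wZ (-1) x; rewrite mulN1r => <-; congr w.
  by rewrite rmorphN1 scaleN1r.
have wv : w v = s v.
  have h1 := le_trans (ws (- v)) (shift_sublinearN v sl).
  have h2 := le_trans (ws v) (shift_sublinear_leq v sl v).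
  by apply/le_anti; rewrite h2 -lerN2 -wN h1.
have {}ws x : w x <= s x by apply: le_trans (ws x) (shift_sublinear_leq v sl x).
pose W x : R[i] := w x +i* - w ('i *: x).
have WD x y : W (x + y) = W x + W y.
  by rewrite /W scalerDr !wD opprD.
have Wi x : W ('i *: x) = 'i * W x.
  rewrite /W scalerA -expr2 sqr_i scaleN1r wN opprK.
  by apply/eqP; rewrite eq_complex/= !(mul0r, mul1r, sub0r, add0r, opprK) !eqxx.
have WZ c x : W (c *: x) = c * W x.
  have WR (r : R) z : W (r%:C *: z) = r%:C * W z.
    rewrite /W scalerA mulrC -scalerA !wZ.
    by apply/eqP; rewrite eq_complex/= !(mul0r, mulrN, oppr0, subr0, addr0) !eqxx.
  rewrite [c]complexE scalerDl WD WR mulrDl; congr (_ + _).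
  by rewrite -scalerA Wi WR mulrA.
have Ws x : normc (W x) <= s x.
  have [Wx0|Wx0] := eqVneq (W x) 0.
    rewrite Wx0 normc0; have [_ sZ] := ss; have [sD _] := ss.
    have := sD x (- x); rewrite subrr -scaleN1r sZ normc_opp normc1 mul1r.
    by rewrite sublinear0//; lra.
  have n0 : normc (W x) != 0 by apply: contra Wx0 => /eqP /eq0_normc ->.
  pose t := (normc (W x))%:C / W x.
  have Wt : W (t *: x) = (normc (W x))%:C by rewrite WZ divfK.
  have := ws (t *: x); have [_ ->] := ss.
  rewrite normcM normcV normc_ge0_real ?normc_ge0// divff// mul1r.
  by have := congr1 (@complex.Re R) Wt => /= ->.
exists W; split=> //; first by move=> c x y; rewrite WD WZ.
have := Ws v; rewrite /W wv /= => h.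
(* The real part of [W v] is already [s v], so its imaginary part vanishes. *)
have : `|w ('i *: v)| ^+ 2 <= 0.
  rewrite real_normK ?num_real//.
  have s0 : 0 <= s v by apply: le_trans h; exact: sqrtr_ge0.
  move: h; rewrite -{2}(ger0_norm s0) -sqrtr_sqr ler_sqrt ?sqr_ge0//.
  by rewrite sqrrN; lra.
rewrite real_normK ?num_real// => /(conj (sqr_ge0 (w ('i *: v)))) /andP /le_anti.
by move/esym/eqP; rewrite sqrf_eq0 => /eqP ->; rewrite oppr0.
Qed.

End sublinear.

Section epigraph.
Variables (R : realType) (V : lmodType R[i]).
Implicit Types (D : V -> R -> Prop) (s : V -> R).

(** [D v t] reads as an upper bound [t] for the seminorm at [v] defined as the
    infimum of all such [t]: distances to subspaces and infimal convolutions
    both have this form. *)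
Definition seminorm_bounds D := [/\ forall v, exists t, D v t,
  forall v t, D v t -> 0 <= t,
  forall v t v' t', D v t -> D v' t' -> D (v + v') (t + t') &
  forall c v t, D v t -> D (c *: v) (normc c * t)].

Lemma functional_le_bounds D v0 : seminorm_bounds D ->
  exists w d, [/\ functional w, forall v t, D v t -> normc (w v) <= t,
    w v0 = d%:C & forall e, 0 < e -> exists2 t, D v0 t & t < d + e].
Proof.
move=> [De D0 DD DZ]; pose s v := inf [set t | D v t].
have hinf v : has_inf [set t | D v t].
  split; first by have [t] := De v; exists t.
  by exists 0 => t; exact: D0.
have sle v t : D v t -> s v <= t.
  by move=> Dvt; apply: ge_inf => //; have [] := hinf v.
have sZle c v : s (c *: v) <= normc c * s v.
  have [->|c0] := eqVneq c 0.
    rewrite normc0 mul0r scale0r; have [t] := De 0.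
    by move=> /(DZ 0); rewrite scaler0 normc0 mul0r; exact: sle.
  have n0 : 0 < normc c.
    by rewrite lt_neqAle normc_ge0 andbT eq_sym; apply: contra c0 => /eqP /eq0_normc ->.
  rewrite -ler_pdivrMl//; apply: lb_le_inf; first by have [] := hinf v.
  by move=> t /(DZ c) /sle; rewrite ler_pdivrMl.
have ss : seminorm s.
  split=> [x y|c v].
    apply/ler_addgt0Pr => e e0; have e2 : 0 < e / 2 by rewrite divr_gt0.
    have [t Dt xt] := inf_adherent e2 (hinf x).
    have [u Du yu] := inf_adherent e2 (hinf y).
    have := sle _ _ (DD _ _ _ _ Dt Du).
    by rewrite -/(s x) -/(s y) in xt yu; lra.
  apply/le_anti; rewrite sZle /=.
  have [->|c0] := eqVneq c 0.
    rewrite normc0 mul0r; apply: lb_le_inf; first by have [] := hinf (0 *: v).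
    by move=> t; exact: D0.
  have n0 : normc c != 0 by apply: contra c0 => /eqP /eq0_normc ->.
  have := sZle c^-1 (c *: v); rewrite scalerA mulVf// scale1r normcV => h.
  rewrite -ler_pdivlMl// lt_neqAle normc_ge0 andbT eq_sym//.
have [w [lw ws wv]] := functional_le_seminorm v0 ss.
exists w, (s v0); split=> // [v t Dvt|e e0].
  exact: le_trans (ws v) (sle _ _ Dvt).
exact: inf_adherent e0 (hinf v0).
Qed.

End epigraph.

Section functional_theory.
Variables (R : realType) (E : lmodType R[i]).
Implicit Types (w : E -> R[i]).

Lemma functional0 w : functional w -> w 0 = 0.
Proof.
move=> lw; have := lw 1 0 0; rewrite scaler0 addr0 mul1r => /eqP.
by rewrite -subr_eq0 opprD addrA subrr sub0r oppr_eq0 => /eqP.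
Qed.

Lemma functionalZ w c x : functional w -> w (c *: x) = c * w x.
Proof. by move=> lw; rewrite -[c *: x]addr0 lw functional0// addr0. Qed.

Lemma functionalD w x y : functional w -> w (x + y) = w x + w y.
Proof. by move=> lw; rewrite -[x in LHS]scale1r lw mul1r. Qed.

Lemma functionalN w x : functional w -> w (- x) = - w x.
Proof. by move=> lw; rewrite -scaleN1r functionalZ// mulN1r. Qed.

Lemma functionalB w x y : functional w -> w (x - y) = w x - w y.
Proof. by move=> lw; rewrite functionalD// functionalN. Qed.

Lemma functional_sum w (I : Type) (r : seq I) (F : I -> E) : functional w ->
  w (\sum_(i <- r) F i) = \sum_(i <- r) w (F i).
Proof.
move=> lw; elim: r => [|i r IH]; first by rewrite !big_nil functional0.
by rewrite !big_cons functionalD// IH.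
Qed.

End functional_theory.

(** The Hahn-Banach theorem for a functional given on the range of a linear
    map: it suffices to find a functional that separates one point of the range
    from the image of the kernel of [l]. *)
Lemma functional_extension (R : realType) (V W : lmodType R[i]) (A : V -> W)
    (l : V -> R[i]) (s : W -> R) :
  (forall c x y, A (c *: x + y) = c *: A x + A y) -> functional l ->
  seminorm s -> (forall v, normc (l v) <= s (A v)) ->
  exists w, [/\ functional w, forall x, normc (w x) <= s x &
    forall v, w (A v) = l v].
Proof.
move=> lA ll [sD sZ] ls.
have AZ c x : A (c *: x) = c *: A x.
  have A0 : A 0 = 0 by have := lA (-1) 0 0; rewrite scaler0 addr0 scaleN1r addNr.
  by rewrite -[c *: x]addr0 lA A0 addr0.
have AD x y : A (x + y) = A x + A y by rewrite -[x in LHS]scale1r lA scale1r.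
have s0 x : 0 <= s x.
  have := sD x (- x); rewrite -scaleN1r sZ normc_opp normc1 mul1r.
  have := sZ 0 0; rewrite scaler0 normc0 mul0r scaleN1r subrr => ->; lra.
have [[v1 lv1]|l0] := pselect (exists v, l v != 0); last first.
  exists (fun=> 0); split=> [c x y|x|v]; first by rewrite mulr0 addr0.
    by rewrite normc0.
  by apply/esym/eqP; apply: contra_notT l0 => ?; exists v.
pose v0 := (l v1)^-1 *: v1.
have lv0 : l v0 = 1 by rewrite functionalZ// mulVf.
(* The distance to the image of the kernel of [l] is at least 1 at [A v0]. *)
pose D (x : W) (t : R) := exists2 v, l v = 0 & s (x - A v) <= t.
have [|w [d [lw wD wv0 dD]]] := @functional_le_bounds R W D (A v0).
  split=> [x|x t [v _]|x t x' t' [v lv xt] [v' lv' xt']|c x t [v lv xt]].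
  - by exists (s (x - A 0)), 0 => //; exact: functional0.
  - exact: le_trans.
  - exists (v + v'); first by rewrite functionalD// lv lv' addr0.
    by rewrite AD opprD addrACA (le_trans (sD _ _))// lerD.
  - exists (c *: v); first by rewrite functionalZ// lv mulr0.
    by rewrite AZ -scalerBr sZ ler_wpM2l// normc_ge0.
have d1 : 1 <= d.
  apply/ler_addgt0Pr => e /dD [t [v lv vt]] /ltW; apply: le_trans.
  apply: le_trans vt.
  rewrite (_ : A v0 - A v = A (v0 - v)).
    apply: le_trans (ls _).
    by rewrite functionalB// lv lv0 subr0 normc1.
  by rewrite AD; congr (_ + _); rewrite -[- v]scaleN1r AZ scaleN1r.
have d0 : d%:C != 0.
  by apply/eqP => /(congr1 (@complex.Re R)) /= e; move: d1; rewrite e ler10.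
have wker v : l v = 0 -> w (A v) = 0.
  move=> lv; apply: normc_le0; apply: (wD (A v)); exists v => //.
  by rewrite subrr -(scale0r 0) sZ normc0 mul0r.
exists (fun x => d%:C^-1 * w x); split=> [c x y|x|v].
- by rewrite lw mulrDr mulrCA.
- rewrite normcM normcV normc_ge0_real; last by lra.
  rewrite ler_pdivrMl; last by lra.
  apply: (@le_trans _ _ (s x)); last by rewrite ler_peMl.
  apply: wD; exists 0; first exact: functional0.
  by rewrite -(scale0r 0) AZ scale0r subr0.
- have : w (A (v - l v *: v0)) = 0.
    by apply: wker; rewrite functionalB// functionalZ// lv0 mulr1 subrr.
  rewrite AD -scaleNr (AZ (- l v) v0) functionalD// functionalZ// mulNr.
  move/eqP; rewrite subr_eq0 => /eqP ->.
  by rewrite wv0 mulrC mulfK.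
Qed.

(** * Uniform boundedness *)

Lemma sum_quarter_powers (R : realFieldType) (k d : nat) :
  \sum_(k.+1 <= l < k.+1 + d) (4^-1 : R) ^+ l <= 4^-1 ^+ k / 3.
Proof.
suff -> : \sum_(k.+1 <= l < k.+1 + d) (4^-1 : R) ^+ l =
    4^-1 ^+ k * (1 - 4^-1 ^+ d) / 3.
  have q0 m : 0 <= (4^-1 : R) ^+ m by rewrite exprn_ge0// invr_ge0.
  by rewrite ler_pM2r ?invr_gt0// ler_piMr// gerBl.
elim: d => [|d IH]; first by rewrite addn0 big_geq// subrr mulr0 mul0r.
rewrite addnS big_nat_recr ?leq_addr//= IH exprD !exprS.
by field.
Qed.

(** The gliding hump: if the entries [T i j] were unbounded, one could choose
    [sg] and columns [j k] such that the [k]-th term of the series dominates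
    in the column [j k] both the earlier terms, which are bounded over all
    columns, and the later ones, as [sg k] nearly maximizes the entries of
    that column. *)
Lemma gliding_hump (R : realType) (I J : Type) (T : I -> J -> R[i]) :
  (forall i, exists M, forall j, normc (T i j) <= M) ->
  (forall j, exists M, forall i, normc (T i j) <= M) ->
  (forall sg : nat -> I, exists M, forall j, exists n0, forall n, (n0 <= n)%N ->
    normc (\sum_(0 <= k < n) (4^-1 ^+ k)%:C * T (sg k) j) <= M) ->
  exists M, forall i j, normc (T i j) <= M.
Proof.
move=> h1 h2 h3.
apply: contrapT => nb.
have H (M : R) : exists i j, M < normc (T i j).
  apply: contrapT => h; apply: nb; exists M => i j; rewrite leNgt.
  by apply/negP => Mij; apply: h; exists i, j.
have [M HM] := choice h1.
have M0 i : 0 <= M i.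
  by have [_ [j _]] := H 0; apply: le_trans (HM i j); exact: normc_ge0.
have step (p : R * nat) : exists q : I * J, 0 <= p.1 -> exists N,
    [/\ forall i, normc (T i q.2) <= N, N <= 2 * normc (T q.1 q.2) &
        6 * 4 ^+ p.2 * (p.1 + p.2%:R) <= N].
  have [i0 [j hj]] := H (6 * 4 ^+ p.2 * (p.1 + p.2%:R)).
  have [B hB] := h2 j.
  pose A := [set normc (T i j) | i in [set: I]].
  have sA : has_sup A.
    split; first by exists (normc (T i0 j)), i0.
    by exists B => _ [i _ <-].
  have [/= p0|p0] := leP 0 p.1; last first.
    by exists (i0, j).
  have N0 : 0 < sup A.
    apply: (@lt_le_trans _ _ (normc (T i0 j))).
      apply: le_lt_trans hj; rewrite mulr_ge0// ?mulr_ge0 ?exprn_ge0//.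
      by rewrite addr_ge0.
    by apply: ub_le_sup; [case: sA|exists i0].
  have N2 : 0 < sup A / 2 by rewrite divr_gt0.
  have [_ [i _ <-] hi] := sup_adherent N2 sA.
  exists (i, j) => _; exists (sup A); split=> /=.
  - by move=> i'; apply: ub_le_sup; [case: sA|exists i'].
  - by lra.
  - by apply: le_trans (ltW hj) _; apply: ub_le_sup; [case: sA|exists i0].
have [g Hg] := choice step.
(* [S k] bounds the sum of the first [k] terms in every column. *)
pose S := fix S k := if k is k'.+1 then S k' + M (g (S k', k')).1 else 0.
pose sg k := (g (S k, k)).1.
have S0 k : 0 <= S k by elim: k => //= k IH; rewrite addr_ge0.
have SE k : \sum_(0 <= l < k) M (sg l) = S k.
  by elim: k => [|k IH]; [rewrite big_geq|rewrite big_nat_recr//= IH].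
have [B HB] := h3 sg.
pose k := (Num.truncn `|B|).+1.
have Bk : B < k%:R.
  by apply: le_lt_trans (ler_norm _) _; exact: truncnS_gt.
have [N []] := Hg (S k, k) (S0 k); set j := (g (S k, k)).2; rewrite -/(sg k) /=.
move=> N1 N2 N3.
have [n0 /(_ (k.+1 + n0)%N (leq_addl _ _))] := HB j.
have q0 l : 0 <= (4^-1 : R) ^+ l by rewrite exprn_ge0// invr_ge0.
rewrite (big_cat_nat (n := k)) ?leq0n//=; last by rewrite addSn leqW// leq_addr.
rewrite (big_cat_nat (m := k) (n := k.+1)) ?leqnSn ?leq_addr//= big_nat1.
set a := \sum_(0 <= _ < k) _; set b := _ * T (sg k) j; set c := \sum_(k.+1 <= _ < _) _.
have ha : normc a <= S k.
  rewrite -SE; apply: le_trans (ler_normc_sum _ _) _.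
  apply: ler_sum => l _; rewrite normcM normc_ge0_real//.
  apply: le_trans (HM _ j); rewrite ler_piMl ?normc_ge0//.
  by rewrite exprn_ile1// invf_le1// ler1n.
have N0 : 0 <= N by apply: le_trans (N1 (sg k)); exact: normc_ge0.
have hc : normc c <= 4^-1 ^+ k / 3 * N.
  apply: le_trans (ler_normc_sum _ _) _.
  apply: le_trans (_ : \sum_(k.+1 <= l < k.+1 + n0) 4^-1 ^+ l * N <= _).
    apply: ler_sum => l _; rewrite normcM normc_ge0_real//.
    by rewrite ler_wpM2l.
  by rewrite -mulr_suml ler_wpM2r// sum_quarter_powers.
have hb : 4^-1 ^+ k * N <= 2 * normc b.
  by rewrite /b normcM normc_ge0_real// mulrCA ler_wpM2l.
have hN : 6 * (S k + k%:R) <= 4^-1 ^+ k * N.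
  rewrite exprVn ler_pdivlMl ?exprn_gt0//.
  by rewrite mulrA [4 ^+ k * 6]mulrC.
have := normc_sub_ge b (- (a + c)); rewrite opprK normc_opp.
have := ler_normcD a c.
rewrite (_ : b + (a + c) = a + (b + c)); last by rewrite addrCA.
by lra.
Qed.

(** * Frechet spaces *)

Section seminorm_theory.
Variables (R : realType) (E : lmodType R[i]) (s : E -> R).
Hypothesis ss : seminorm s.

Lemma seminormD x y : s (x + y) <= s x + s y.
Proof. by have [] := ss. Qed.

Lemma seminormZ c x : s (c *: x) = normc c * s x.
Proof. by have [] := ss. Qed.

Lemma seminorm0 : s 0 = 0.
Proof. by rewrite -(scale0r 0) seminormZ normc0 mul0r. Qed.

Lemma seminormN x : s (- x) = s x.
Proof. by rewrite -scaleN1r seminormZ normc_opp normc1 mul1r. Qed.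

Lemma seminormB x y : s (x - y) <= s x + s y.
Proof. by rewrite -(seminormN y) seminormD. Qed.

Lemma seminorm_distC x y : s (x - y) = s (y - x).
Proof. by rewrite -seminormN opprB. Qed.

Lemma seminorm_ge0 x : 0 <= s x.
Proof. by have := seminormB x x; rewrite subrr seminorm0; lra. Qed.

Lemma seminorm_sum (I : Type) (r : seq I) (P : pred I) (F : I -> E) :
  s (\sum_(i <- r | P i) F i) <= \sum_(i <- r | P i) s (F i).
Proof.
elim/big_rec2: _ => [|i y x _ h]; first by rewrite seminorm0.
by rewrite (le_trans (seminormD _ _))// lerD2l.
Qed.

End seminorm_theory.

Lemma half_power_small (R : realType) (M e : R) : 0 < e ->
  exists K, forall i, (K <= i)%N -> M * 2^-1 ^+ i <= e.
Proof.
move=> e0; pose K := (Num.truncn (`|M| / e)).+1.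
have K1 : `|M| / e < K%:R by exact: truncnS_gt.
exists K => i Ki.
apply: le_trans (_ : `|M| * 2^-1 ^+ i <= _).
  by rewrite ler_wpM2r ?ler_norm// exprn_ge0// invr_ge0.
rewrite exprVn ler_pdivrMr ?exprn_gt0// mulrC -ler_pdivrMr//.
apply: le_trans (ltW K1) _; rewrite -natrX ler_nat.
by apply: leq_trans Ki _; exact/ltnW/ltn_expl.
Qed.

Lemma sum_half_powers (R : realFieldType) (k n : nat) : (k <= n)%N ->
  \sum_(k <= i < n) (2^-1 : R) ^+ i <= 2 * 2^-1 ^+ k.
Proof.
move=> /subnKC <-; suff -> : forall d, \sum_(k <= i < k + d) (2^-1 : R) ^+ i =
    2 * 2^-1 ^+ k * (1 - 2^-1 ^+ d).
  have q0 m : 0 <= (2^-1 : R) ^+ m by rewrite exprn_ge0// invr_ge0.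
  by rewrite ler_piMr ?mulr_ge0// gerBl.
elim=> [|d IH]; first by rewrite addn0 big_geq// subrr mulr0.
by rewrite addnS big_nat_recr ?leq_addr//= IH exprD exprS; field.
Qed.

Section frechet.
Variables (R : realType) (E : lmodType R[i]) (N : nat -> E -> R).
Implicit Types (x y f : E) (w : E -> R[i]).

Definition converges (u : nat -> E) x := forall m e, 0 < e ->
  exists K, forall i, (K <= i)%N -> N m (u i - x) <= e.

Record frechet : Prop := Frechet {
  frechet_seminorm : forall m, seminorm (N m) ;
  frechet_le : forall m n x, (m <= n)%N -> N m x <= N n x ;
  frechet_complete : forall u : nat -> E,
    (forall m e, 0 < e -> exists K, forall i j, (K <= i)%N -> (K <= j)%N ->
       N m (u i - u j) <= e) ->
    exists x, converges u x }.

Definition bounded_functional w :=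
  functional w /\ exists m c, forall x, normc (w x) <= c * N m x.

Hypothesis FN : frechet.
Let sN m : seminorm (N m) := frechet_seminorm FN m.
Let N0 m x : 0 <= N m x := seminorm_ge0 (sN m) x.

Lemma bounded_functionalP w : bounded_functional w ->
  functional w /\ exists m c, 0 < c /\ forall x, normc (w x) <= c * N m x.
Proof.
move=> [lw [m [c h]]]; split=> //; exists m, (`|c| + 1); split=> [|x].
  by rewrite ltr_wpDl.
apply: le_trans (h x) _; rewrite ler_wpM2r//.
by apply: le_trans (ler_norm c) _; rewrite lerDl.
Qed.

Lemma bounded_functional_cvg w u x : bounded_functional w -> converges u x ->
  forall e, 0 < e -> exists K, forall i, (K <= i)%N -> normc (w (u i) - w x) <= e.
Proof.
move=> /bounded_functionalP[lw [m [c [c0 wc]]]] ux e e0.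
have [|K hK] := ux m (e / c); first by rewrite divr_gt0.
exists K => i /hK h; rewrite -functionalB//; apply: le_trans (wc _) _.
by rewrite mulrC -ler_pdivlMr.
Qed.

Lemma eventually_bounded (a : nat -> R) (k : nat) (B : R) :
  (forall i, (k <= i)%N -> a i <= B) -> exists M, forall i, a i <= M.
Proof.
move=> h; exists (`|B| + \sum_(i < k) `|a i|) => i.
have [ki|ik] := leqP k i.
  apply: le_trans (h i ki) _; apply: le_trans (ler_norm B) _.
  by rewrite lerDl sumr_ge0.
rewrite (bigD1 (Ordinal ik))//= addrCA; apply: le_trans (ler_norm (a i)) _.
by rewrite lerDl addr_ge0// sumr_ge0.
Qed.

Lemma frechet_series (y : nat -> E) :
  (forall m, exists M, forall i, N m (y i) <= M * 2^-1 ^+ i) ->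
  exists x, converges (fun n => \sum_(0 <= k < n) y k) x.
Proof.
move=> hy; apply: (frechet_complete FN) => m e e0.
have [M HM] := hy m.
have M0 : 0 <= M by have := le_trans (N0 m (y 0%N)) (HM 0%N); rewrite expr0 mulr1.
have [K hK] := half_power_small (2 * M) e0.
suff H i j : (K <= i)%N -> (i <= j)%N ->
    N m (\sum_(0 <= k < i) y k - \sum_(0 <= k < j) y k) <= e.
  exists K => i j Ki Kj; have [ij|ji] := leqP i j; first exact: H.
  by rewrite seminorm_distC// H// ltnW.
move=> Ki ij; rewrite seminorm_distC// (big_cat_nat (n := i))//= addrAC subrr add0r.
apply: le_trans (seminorm_sum (sN m) _ _ _) _.
apply: le_trans (_ : \sum_(i <= k < j) M * 2^-1 ^+ k <= _).
  exact: ler_sum.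
rewrite -mulr_sumr; apply: le_trans (hK i Ki).
by rewrite (mulrC 2 M) -mulrA ler_wpM2l// sum_half_powers.
Qed.

Lemma frechet_bounded_series (g : nat -> E) (sg : nat -> nat) :
  (forall m, exists M, forall i, N m (g i) <= M) ->
  exists x, converges (fun n => \sum_(0 <= k < n) (4^-1 ^+ k)%:C *: g (sg k)) x.
Proof.
move=> hg; apply: frechet_series => m; have [M HM] := hg m.
have q0 l : 0 <= (4^-1 : R) ^+ l by rewrite exprn_ge0// invr_ge0.
exists M => i; rewrite seminormZ// normc_ge0_real//.
apply: le_trans (_ : 4^-1 ^+ i * M <= _); first by rewrite ler_wpM2l.
rewrite mulrC ler_wpM2l//; first exact: le_trans (N0 m (g 0%N)) (HM 0%N).
by rewrite lerXn2r ?nnegrE ?invr_ge0// lef_pV2 ?posrE// ler_nat.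
Qed.

(** The Banach-Steinhaus theorem on a closed subspace [F], by the gliding hump
    rather than by Baire's theorem. *)
Lemma uniform_boundedness (F : E -> Prop) (J : Type) (w : J -> E -> R[i]) :
  F 0 -> (forall x y, F x -> F y -> F (x + y)) -> (forall c x, F x -> F (c *: x)) ->
  (forall u x, converges u x -> (forall n, F (u n)) -> F x) ->
  (forall j, bounded_functional (w j)) ->
  (forall f, F f -> exists M, forall j, normc (w j f) <= M) ->
  exists k c, forall j f, F f -> normc (w j f) <= c * N k f.
Proof.
move=> F0 FD FZ Fcl bw wF; apply: contrapT => nb.
(* Otherwise there are [g k] in [F], bounded in each norm, at which some
   functional is as large as [k.+1]. *)
have H (k : nat) : exists fj : E * J, F fj.1 /\
    k.+1%:R * N k fj.1 < normc (w fj.2 fj.1).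
  apply: contrapT => h; apply: nb; exists k, k.+1%:R => j f Ff.
  by rewrite leNgt; apply/negP => hlt; apply: h; exists (f, j).
have {H}[fj Hfj] := choice H.
pose a k := normc (w (fj k).2 (fj k).1).
have a0 k : 0 < a k.
  by have [_] := Hfj k; apply: le_lt_trans; rewrite mulr_ge0.
pose g k := (k.+1%:R / a k)%:C *: (fj k).1.
have Fg k : F (g k) by apply: FZ; have [] := Hfj k.
have wg k : normc (w (fj k).2 (g k)) = k.+1%:R.
  have [lw _] := bw (fj k).2.
  rewrite functionalZ// normcM normc_ge0_real ?divr_ge0 ?(ltW (a0 k))//.
  by rewrite -/(a k) divfK// gt_eqF.
have Ng k : N k (g k) <= 1.
  have [_ h] := Hfj k.
  rewrite seminormZ// normc_ge0_real ?divr_ge0 ?(ltW (a0 k))//.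
  by rewrite mulrAC ler_pdivrMr// mul1r ltW.
have bg k : exists M, forall i, N k (g i) <= M.
  apply: (@eventually_bounded _ k 1) => i ki.
  by apply: le_trans (Ng i); exact: (frechet_le FN).
have [|||M HM] := @gliding_hump R nat J (fun i j => w j (g i)).
- by move=> i; exact: wF.
- move=> j; have [_ [k [c [c0 wc]]]] := bounded_functionalP (bw j).
  have [M HM] := bg k; exists (c * M) => i.
  by apply: le_trans (wc _) _; rewrite ler_wpM2l// ltW.
- move=> sg; have [x cx] := frechet_bounded_series sg bg.
  have Fx : F x.
    apply: Fcl cx _ => n; elim: n => [|n IH]; first by rewrite big_geq.
    by rewrite big_nat_recr//=; apply: FD => //; exact: FZ.
  have [M HM] := wF x Fx; exists (M + 1) => j.
  have [L hL] := bounded_functional_cvg (bw j) cx ltr01.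
  exists L => n /hL h; have [lw _] := bw j.
  have <- : w j (\sum_(0 <= k < n) (4^-1 ^+ k)%:C *: g (sg k)) =
      \sum_(0 <= k < n) (4^-1 ^+ k)%:C * w j (g (sg k)).
    by rewrite functional_sum//; apply: eq_bigr => k _; rewrite functionalZ.
  have := ler_normcD (w j (\sum_(0 <= k < n) (4^-1 ^+ k)%:C *: g (sg k)) - w j x) (w j x).
  by rewrite subrK; have := HM j; lra.
pose k := Num.truncn `|M|.
have := HM k (fj k).2; rewrite wg leNgt => /negP; apply.
by apply: le_lt_trans (ler_norm M) _; exact: truncnS_gt.
Qed.

(** * Closed linear relations: the open mapping and closed graph theorems *)

Record closed_relation (G : E -> E -> Prop) : Prop := ClosedRelation {
  relation0 : G 0 0 ;
  relationD : forall x y x' y', G x y -> G x' y' -> G (x + x') (y + y') ;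
  relationZ : forall c x y, G x y -> G (c *: x) (c *: y) ;
  relation_closed : forall u v x y, converges u x -> converges v y ->
    (forall n, G (u n) (v n)) -> G x y }.

Variable G : E -> E -> Prop.
Hypothesis cG : closed_relation G.

Lemma relation_sum (a b : nat -> E) n : (forall k, G (a k) (b k)) ->
  G (\sum_(0 <= k < n) a k) (\sum_(0 <= k < n) b k).
Proof.
move=> h; elim: n => [|n IH]; first by rewrite !big_geq//; exact: relation0.
by rewrite !big_nat_recr//=; exact: relationD.
Qed.

(** Successive approximation: the error left by an approximate solution is
    solved again approximately, in finer and finer seminorms, and the
    corrections sum up by completeness. *)
Lemma lift_approximations (F : E -> Prop) :
  (forall f x y, F f -> G x y -> F (f - x)) ->
  (forall m, exists k c, forall f, F f -> forall k' e, 0 < e ->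
    exists x y, [/\ G x y, N m y <= c * N k f + e & N k' (f - x) <= e]) ->
  forall m, exists k c, forall f, F f -> forall e, 0 < e ->
    exists2 y, G f y & N m y <= c * N k f + e.
Proof.
move=> FG H m.
have {}H i : exists kc : nat * R, 0 <= kc.2 /\ forall f, F f ->
    forall k' e, 0 < e -> exists x y,
    [/\ G x y, N i y <= kc.2 * N kc.1 f + e & N k' (f - x) <= e].
  have [k [c h]] := H i; exists (k, `|c|); split=> //= f Ff k' e e0.
  have [x [y [Gxy yc xe]]] := h f Ff k' e e0; exists x, y; split=> //.
  by apply: le_trans yc _; rewrite lerD2r ler_wpM2r// ler_norm.
have {H}[KC HKC] := choice H; pose K i := (KC i).1; pose C i := (KC i).2.
have C0 i : 0 <= C i by have [] := HKC i.
exists (K m), (C m) => f0 Ff0 e e0.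
pose d := e / 8.
have d0 : 0 < d by rewrite divr_gt0.
(* [eta i] is the tolerance of the [i]-th step; the next step multiplies it by
   the constant of the norm of index [m + i.+1], whence the division. *)
pose eta i := d * 2^-1 ^+ i / (C (m + i.+1)%N + 1).
have q0 l : 0 < (2^-1 : R) ^+ l by rewrite exprn_gt0// invr_gt0.
have eta0 i : 0 < eta i by rewrite divr_gt0// ?mulr_gt0// ltr_wpDl.
have eta_le i : eta i <= d * 2^-1 ^+ i.
  rewrite ler_pdivrMr ?ltr_wpDl// ler_peMr//; first by rewrite mulr_ge0// ltW.
  by rewrite lerDr.
have Ceta i : C (m + i.+1)%N * eta i <= d * 2^-1 ^+ i.
  rewrite /eta mulrA ler_pdivrMr ?ltr_wpDl// mulrC ler_wpM2l ?lerDl//.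
  by rewrite mulr_ge0// ltW.
pose k' i := maxn i (K (m + i.+1)%N).
have step (p : E * nat) : exists q : E * E, F p.1 -> [/\ G q.1 q.2,
    N (m + p.2)%N q.2 <= C (m + p.2)%N * N (K (m + p.2)%N) p.1 + eta p.2 &
    N (k' p.2) (p.1 - q.1) <= eta p.2].
  have [Fp|nFp] := pselect (F p.1); last by exists (0, 0).
  have [_ /(_ _ Fp (k' p.2) _ (eta0 p.2))[x [y hxy]]] := HKC (m + p.2)%N.
  by exists (x, y).
have [g Hg] := choice step.
pose f := fix f i := if i is i'.+1 then f i' - (g (f i', i')).1 else f0.
pose x i := (g (f i, i)).1; pose y i := (g (f i, i)).2.
have Ff i : F (f i).
  elim: i => //= i IH; have [Gi _ _] := Hg (f i, i) IH.
  exact: FG Gi.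
have Gxy i : G (x i) (y i) by have [] := Hg (f i, i) (Ff i).
have fS i : N (k' i) (f i.+1) <= eta i by have [] := Hg (f i, i) (Ff i).
have y0 : N m (y 0%N) <= C m * N (K m) f0 + d.
  have [_ + _] := Hg (f 0%N, 0%N) (Ff 0%N); rewrite /= addn0 => h.
  by apply: le_trans h _; rewrite lerD2l; have := eta_le 0%N; rewrite expr0 mulr1.
have yS i : N (m + i.+1)%N (y i.+1) <= 4 * d * 2^-1 ^+ i.+1.
  have [_ + _] := Hg (f i.+1, i.+1) (Ff i.+1); rewrite -/(y i.+1) [_.1]/= [_.2]/= => h.
  have h1 : C (m + i.+1)%N * N (K (m + i.+1)%N) (f i.+1) <= d * 2^-1 ^+ i.
    apply: le_trans (Ceta i); rewrite ler_wpM2l//.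
    by apply: le_trans (fS i); apply: (frechet_le FN); exact: leq_maxr.
  have h2 := eta_le i.+1.
  have h3 : 2^-1 ^+ i.+1 = 2^-1 * 2^-1 ^+ i :> R by rewrite exprS.
  have h4 : 0 <= d * 2^-1 ^+ i by rewrite mulr_ge0// ltW.
  move: h h2; rewrite h3; lra.
have sumx n : \sum_(0 <= k < n) x k = f0 - f n.
  elim: n => [|n IH]; first by rewrite big_geq// subrr.
  by rewrite big_nat_recr//= IH opprB addrA addrAC.
have cx : converges (fun n => \sum_(0 <= k < n) x k) f0.
  move=> q r r0; have [L hL] := half_power_small d r0.
  exists (maxn q L).+1 => -[//|i]; rewrite ltnS geq_max => /andP[qi Li].
  rewrite sumx addrAC subrr sub0r seminormN//.
  apply: le_trans (hL i Li); apply: le_trans (eta_le i); apply: le_trans (fS i).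
  by apply: (frechet_le FN); apply: leq_trans qi (leq_maxl _ _).
have [|z cz] := @frechet_series y.
  move=> q; have [|M HM] := @eventually_bounded (fun i => N q (y i) / 2^-1 ^+ i) q.+1 (4 * d).
    move=> [//|i]; rewrite ltnS => qi; rewrite ler_pdivrMr//.
    apply: le_trans (yS i); apply: (frechet_le FN).
    by rewrite (leq_trans qi)// (leq_trans (leqnSn i))// leq_addl.
  by exists M => i; rewrite -ler_pdivrMr.
exists z; first exact: relation_closed cG _ _ _ _ cx cz (fun n => relation_sum n Gxy).
have [L hL] := cz m _ d0.
have := hL (maxn L 1) (leq_maxl _ _).
set n := maxn L 1; have n1 : (0 < n)%N by rewrite leq_max orbT.
rewrite seminorm_distC// big_ltn// => h.
have h1 : N m (\sum_(1 <= k < n) y k) <= 4 * d.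
  apply: le_trans (seminorm_sum (sN m) _ _ _) _.
  apply: le_trans (_ : \sum_(1 <= k < n) 4 * d * 2^-1 ^+ k <= _).
    rewrite big_nat_cond [leRHS]big_nat_cond; apply: ler_sum => -[//|k] _.
    by apply: le_trans (yS k); apply: (frechet_le FN); exact: leq_addr.
  rewrite -mulr_sumr; have := @sum_half_powers R 1 n n1.
  by rewrite expr1 divff// => hs; rewrite ler_piMr// mulr_ge0// ltW.
have := seminormD (sN m) (y 0%N) (\sum_(1 <= k < n) y k).
have := seminormD (sN m) (z - (y 0%N + \sum_(1 <= k < n) y k)) (y 0%N + \sum_(1 <= k < n) y k).
rewrite subrK /d in h h1 y0 *; lra.
Qed.

(** Banach and Steinhaus on the domain of the relation: at each of its points
    [f] the functionals [w] are bounded by [N m y] for any [y] related to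
    [f]. *)
Lemma relation_functionals_bounded (m : nat) :
  (forall u x, converges u x -> (forall n, exists y, G (u n) y) ->
    exists y, G x y) ->
  exists k c, forall f y w, G f y -> bounded_functional w ->
    (forall x y', G x y' -> normc (w x) <= N m y') ->
    normc (w f) <= c * N k f.
Proof.
move=> dc.
pose PW w := bounded_functional w /\ forall x y, G x y -> normc (w x) <= N m y.
have [||||||k [c H]] := @uniform_boundedness (fun f => exists y, G f y) {w | PW w} sval.
- by exists 0; exact: relation0.
- by move=> x x' [y Gx] [y' Gx']; exists (y + y'); exact: relationD.
- by move=> c x [y Gx]; exists (c *: y); exact: relationZ.
- exact: dc.
- by move=> [w []].
- by move=> f [y Gf]; exists (N m y) => -[w [bw wG]] /=; exact: wG.
exists k, c => f y w Gf bw wG.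
by apply: (H (exist PW w (conj bw wG))); exists y.
Qed.

(** By the Hahn-Banach theorem, a bound for all functionals bounded by [N m] on
    the relation is attained approximately by pairs in the relation. *)
Lemma relation_approximation (m k' : nat) (f : E) (r e : R) : 0 < e ->
  (forall w, bounded_functional w ->
    (forall x y, G x y -> normc (w x) <= N m y) -> normc (w f) <= r) ->
  exists x y, [/\ G x y, N m y <= r + e & N k' (f - x) <= e].
Proof.
move=> e0 H.
pose l := (`|r| + e) / e.
have l0 : 0 < l by rewrite divr_gt0// ltr_wpDl.
pose D g t := exists x y, G x y /\ N m y + l * N k' (g - x) <= t.
have [|w [d [lw wD wf dD]]] := @functional_le_bounds R E D f.
  split=> [g|g t [x [y [_]]]|g t g' t' [x [y [Gx ht]]] [x' [y' [Gx' ht']]]|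
           c g t [x [y [Gx ht]]]].
  - by exists (N m 0 + l * N k' (g - 0)), 0, 0; split=> //; exact: relation0.
  - by apply: le_trans; rewrite addr_ge0// mulr_ge0// ltW.
  - exists (x + x'), (y + y'); split; first exact: relationD.
    have := seminormD (sN m) y y'; have := seminormD (sN k') (g - x) (g' - x').
    rewrite addrACA -opprD -(ler_pM2l l0); lra.
  - exists (c *: x), (c *: y); split; first exact: relationZ.
    rewrite -scalerBr !seminormZ// mulrCA -mulrDr ler_wpM2l//.
    exact: normc_ge0.
have wb : bounded_functional w.
  split=> //; exists k', l => x; apply: wD; exists 0, 0.
  by rewrite subr0 seminorm0// add0r; split=> //; exact: relation0.
have wG x y : G x y -> normc (w x) <= N m y.
  move=> Gxy; apply: wD; exists x, y; split=> //.
  by rewrite subrr seminorm0// mulr0 addr0.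
have dr : d <= r.
  have := H w wb wG; rewrite wf normc_real; exact: le_trans (ler_norm d).
have [t [x [y [Gx ht]]] td] := dD e e0.
exists x, y; split=> //.
  have : 0 <= l * N k' (f - x) by rewrite mulr_ge0// ltW.
  by lra.
have : l * N k' (f - x) <= `|r| + e.
  by have := ler_norm r; have := N0 m y; lra.
rewrite /l mulrAC ler_pdivrMr//  ler_pM2l// ltr_wpDl//.
Qed.

(** The graph of an operator and its converse are closed relations; they give
    the closed graph theorem and the open mapping theorem, respectively. *)
Theorem relation_open :
  (forall u x, converges u x -> (forall n, exists y, G (u n) y) ->
    exists y, G x y) ->
  forall m, exists k c, forall f, (exists y, G f y) -> forall e, 0 < e ->
    exists2 y, G f y & N m y <= c * N k f + e.
Proof.
move=> dc; apply: lift_approximations.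
  move=> f x y [y0 Gf] Gx; exists (y0 - y).
  by rewrite -(scaleN1r x) -(scaleN1r y); apply: relationD => //; exact: relationZ.
move=> m; have [k [c H]] := relation_functionals_bounded m dc.
exists k, c => f [y0 Gf] k' e e0; apply: relation_approximation => // w bw wG.
exact: H Gf bw wG.
Qed.

End frechet.

(** * Duality for Frechet-Schwartz spaces *)

Lemma inverse_nat_small (R : realType) (a e : R) : 0 < e ->
  exists K, forall i, (K <= i)%N -> a / i.+1%:R <= e.
Proof.
move=> e0; exists (Num.truncn (`|a| / e)) => i Ki.
rewrite ler_pdivrMr// mulrC -ler_pdivrMr//.
apply: (@le_trans _ _ (`|a| / e)); first by rewrite ler_pM2r ?invr_gt0// ler_norm.
by apply: le_trans (ltW (truncnS_gt _)) _; rewrite ler_nat ltnS.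
Qed.

Section real_limits.
Variable R : realType.

Definition tends_to (a : nat -> R) l := forall e, 0 < e ->
  exists K, forall j, (K <= j)%N -> `|a j - l| <= e.

Lemma tends_to_le (a : nat -> R) l M K : tends_to a l ->
  (forall j, (K <= j)%N -> `|a j| <= M) -> `|l| <= M.
Proof.
move=> al aM; apply/ler_addgt0Pr => e e0; have [L hL] := al e e0.
have := aM (maxn K L) (leq_maxl _ _); have := hL (maxn K L) (leq_maxr _ _).
by have := ler_normB (a (maxn K L)) (a (maxn K L) - l); rewrite subKr; lra.
Qed.

Lemma tends_to_sub (a b : nat -> R) l l' : tends_to a l -> tends_to b l' ->
  tends_to (fun j => a j - b j) (l - l').
Proof.
move=> al bl e e0; have e2 : 0 < e / 2 by rewrite divr_gt0.
have [K hK] := al _ e2; have [L hL] := bl _ e2.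
exists (maxn K L) => j; rewrite geq_max => /andP[/hK h1 /hL h2].
have := ler_normB (a j - l) (b j - l').
rewrite (_ : a j - l - (b j - l') = a j - b j - (l - l')); last by ring.
by lra.
Qed.

Lemma tends_to_cst (l : R) : tends_to (fun=> l) l.
Proof. by move=> e e0; exists 0%N => j _; rewrite subrr normr0 ltW. Qed.

Lemma tends_to_unique (a : nat -> R) l l' : tends_to a l -> tends_to a l' -> l = l'.
Proof.
move=> al al'; apply/eqP; rewrite -subr_eq0 -normr_le0.
apply: (@tends_to_le _ _ 0 0%N (tends_to_sub al al')) => j _.
by rewrite subrr normr0.
Qed.

Lemma real_complete (a : nat -> R) : (forall e, 0 < e -> exists K, forall i j,
    (K <= i)%N -> (K <= j)%N -> `|a i - a j| <= e) -> exists l, tends_to a l.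
Proof.
move=> ha; have /cauchy_cvgP ca : cauchy (a @ \oo).
  apply: cauchy_exP => e e0; have e2 : 0 < e / 2 by rewrite divr_gt0.
  have [K hK] := ha _ e2; exists (a K), K => // i /= Ki.
  by rewrite -ball_normE /=; apply: le_lt_trans (hK K i (leqnn K) Ki) _; lra.
exists (lim (a @ \oo)) => e e0.
have /cvgrPdist_le/(_ e e0)[K _ hK] := ca.
by exists K => i /hK; rewrite /= distrC.
Qed.

End real_limits.

Lemma normc_eq0_small (R : realType) (z : R[i]) :
  (forall e, 0 < e -> normc z <= e) -> z = 0.
Proof.
move=> h; apply: normc_le0; apply/ler_addgt0Pr => e e0.
by rewrite add0r; exact: h.
Qed.

Lemma complex_complete (R : realType) (u : nat -> R[i]) :
  (forall e, 0 < e -> exists K, forall i j, (K <= i)%N -> (K <= j)%N ->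
    normc (u i - u j) <= e) ->
  exists l, forall e, 0 < e -> exists K, forall i, (K <= i)%N ->
    normc (u i - l) <= e.
Proof.
move=> hu.
have hRI e : 0 < e -> exists K, forall i j, (K <= i)%N -> (K <= j)%N ->
    `|complex.Re (u i) - complex.Re (u j)| <= e /\
    `|complex.Im (u i) - complex.Im (u j)| <= e.
  move=> e0; have [K hK] := hu e e0; exists K => i j Ki Kj.
  have := hK i j Ki Kj; case: (u i) (u j) => [a b] [c d] /= h.
  by split; apply: le_trans h; rewrite -sqrtr_sqr ler_wsqrtr// ?lerDl ?lerDr sqr_ge0.
have [a ha] := @real_complete R (fun i => complex.Re (u i)) (fun e e0 =>
  let: ex_intro K h := hRI e e0 in ex_intro _ K (fun i j Ki Kj => (h i j Ki Kj).1)).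
have [b hb] := @real_complete R (fun i => complex.Im (u i)) (fun e e0 =>
  let: ex_intro K h := hRI e e0 in ex_intro _ K (fun i j Ki Kj => (h i j Ki Kj).2)).
exists (a +i* b) => e e0; have e2 : 0 < e / 2 by rewrite divr_gt0.
have [K hK] := ha _ e2; have [L hL] := hb _ e2.
exists (maxn K L) => i; rewrite geq_max => /andP[/hK h1 /hL h2].
rewrite -lecR -normc_normr; move: h1 h2; case: (u i) => [c d] /= h1 h2.
apply: le_trans (norm_le_ReIm (c - a) (d - b)) _; rewrite lecR; lra.
Qed.

Lemma sum_le_size (R : realType) (T : eqType) (s : seq T) (F : T -> R) (c : R) :
  (forall v, v \in s -> F v <= c) -> \sum_(v <- s) F v <= (size s)%:R * c.
Proof.
elim: s => [|v s IH] h; first by rewrite big_nil mul0r.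
rewrite big_cons /= -addn1 natrD mulrDl mul1r addrC lerD ?h ?mem_head//.
by apply: IH => w ws; rewrite h// inE ws orbT.
Qed.

Lemma sum_mem_le (R : realType) (T : eqType) (r : seq T) (F : T -> R) t :
  (forall u, u \in r -> 0 <= F u) -> t \in r -> F t <= \sum_(u <- r) F u.
Proof.
elim: r => // u r IH F0; rewrite inE big_cons => /predU1P[->|tr].
  by rewrite lerDl big_seq sumr_ge0// => v vr; rewrite F0// inE vr orbT.
apply: le_trans (IH _ tr) _; first by move=> v vr; rewrite F0// inE vr orbT.
by rewrite lerDr F0// mem_head.
Qed.

Section duality.
Variables (R : realType) (E D : lmodType R[i]) (N : nat -> E -> R).
Variable ev : D -> E -> R[i].

(** The compactness of the inclusions between the local Banach spaces of [E],
    which defines Schwartz spaces, is expressed on the dual side: on the unit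
    ball of [N m'], smallness of finitely many functionals implies smallness of
    [N m]. *)
Record schwartz_duality : Prop := SchwartzDuality {
  duality_frechet : frechet N ;
  evD : forall c u v f, ev (c *: u + v) f = c * ev u f + ev v f ;
  ev_bounded : forall u, bounded_functional N (ev u) ;
  ev_surj : forall w, bounded_functional N w -> exists u, ev u =1 w ;
  ev_inj : forall u v, ev u =1 ev v -> u = v ;
  compact_inclusion : forall m, exists m', forall e, 0 < e ->
    exists2 us : seq D, forall u, u \in us -> forall f, normc (ev u f) <= N m f &
      forall f, N m f <= e * N m' f + \sum_(u <- us) normc (ev u f)
}.

Hypothesis DE : schwartz_duality.
Let FN : frechet N := duality_frechet DE.
Let sN m : seminorm (N m) := frechet_seminorm FN m.
Let N0 m x : 0 <= N m x := seminorm_ge0 (sN m) x.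
Let lev u : functional (ev u) := (ev_bounded DE u).1.

Definition bounded_set (B : E -> Prop) :=
  forall k, exists M, forall b, B b -> N k b <= M.

Section reflexivity.
Variables (phi : D -> R[i]) (B : E -> Prop).
Hypothesis lphi : functional phi.
Hypothesis bB : bounded_set B.
Hypothesis phiB : forall u, (forall b, B b -> normc (ev u b) <= 1) ->
  normc (phi u) <= 1.

(** Helly's theorem: on finitely many functionals [phi] is approximated by
    points of a fixed bounded set, because of the Hahn-Banach theorem in the
    finite-dimensional space of values. *)
Lemma finite_approximation : exists M : nat -> R, forall (us : seq D) (e : R), 0 < e ->
  exists b, (forall k, N k b <= M k) /\
    forall u, u \in us -> normc (phi u - ev u b) <= e.
Proof.
have [M0 HM0] := choice bB; pose M k := `|M0 k|.
have HM k b : B b -> N k b <= M k.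
  by move=> /HM0 h; apply: le_trans (h k) (ler_norm _).
exists (fun k => 2 * M k) => us e e0.
pose n := size us; pose U (i : 'I_n) := us`_i.
pose l := 2 / e.
have l0 : 0 < l by rewrite divr_gt0.
pose dist (z : 'rV[R[i]]_n) b := \sum_(i < n) normc (z ord0 i - ev (U i) b).
have dist0 z b : 0 <= dist z b by rewrite sumr_ge0// => i _; exact: normc_ge0.
(* The infimal convolution of the gauge of the bounded set with a large
   multiple of the distance between values; it is at most 1 at [z0]. *)
pose Z z t := exists r b, [/\ 0 <= r, forall k, N k b <= r * M k & r + l * dist z b <= t].
pose z0 : 'rV[R[i]]_n := \row_i phi (U i).
have [|w [d [lw wZ wz dZ]]] := @functional_le_bounds R _ Z z0.
  split=> [z|z t [r [b [r0 _]]]|z t z' t' [r [b [r0 hb ht]]] [r' [b' [r0' hb' ht']]]|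
           c z t [r [b [r0 hb ht]]]].
  - exists (0 + l * dist z 0), 0, 0; split=> // k.
    by rewrite mul0r seminorm0.
  - by apply: le_trans; rewrite addr_ge0// mulr_ge0// ltW.
  - exists (r + r'), (b + b'); split; first exact: addr_ge0.
      by move=> k; rewrite mulrDl (le_trans (seminormD (sN k) _ _))// lerD.
    have : dist (z + z') (b + b') <= dist z b + dist z' b'.
      rewrite -big_split; apply: ler_sum => i _.
      by rewrite mxE functionalD// opprD addrACA ler_normcD.
    by rewrite -(ler_pM2l l0); lra.
  - exists (normc c * r), (c *: b); split; first by rewrite mulr_ge0// normc_ge0.
      by move=> k; rewrite seminormZ// -mulrA ler_wpM2l// normc_ge0.
    have -> : dist (c *: z) (c *: b) = normc c * dist z b.
      rewrite mulr_sumr; apply: eq_bigr => i _.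
      by rewrite mxE functionalZ// -mulrBr normcM.
    by rewrite mulrCA -mulrDr ler_wpM2l// normc_ge0.
have wE (z : 'rV[R[i]]_n) : w z = \sum_i z ord0 i * w (delta_mx ord0 i).
  rewrite {1}(row_sum_delta z) functional_sum//.
  by apply: eq_bigr => i _; rewrite functionalZ.
pose u := \sum_i w (delta_mx ord0 i) *: U i.
have evu b : ev u b = w (\row_i ev (U i) b).
  have fev : functional (fun v => ev v b) by move=> c v v'; exact: evD.
  rewrite wE /u (functional_sum _ _ fev); apply: eq_bigr => i _.
  by rewrite (functionalZ _ _ fev) mxE mulrC.
have phiu : phi u = w z0.
  rewrite wE /u functional_sum//; apply: eq_bigr => i _.
  by rewrite functionalZ// mxE mulrC.
have d1 : d <= 1.
  have /phiB : forall b, B b -> normc (ev u b) <= 1.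
    move=> b Bb; rewrite evu; apply: wZ; exists 1, b; split=> //.
      by move=> k; rewrite mul1r; exact: HM.
    rewrite (_ : dist _ _ = 0) ?mulr0 ?addr0// /dist big1// => i _.
    by rewrite mxE subrr normc0.
  by rewrite phiu wz normc_real; exact: le_trans (ler_norm d).
have [t [r [b [r0 hb ht]]] td] := dZ 1 ltr01.
have r2 : r <= 2.
  have : 0 <= l * dist z0 b by rewrite mulr_ge0// ltW.
  by lra.
exists b; split=> [k|v vus].
  by apply: le_trans (hb k) _; apply: ler_wpM2r => //; exact: normr_ge0.
have [i ni <-] := nthP (0 : D) vus.
have : l * dist z0 b <= 2 by lra.
rewrite /l mulrAC ler_pdivrMr// ler_pM2l// /dist (bigD1 (Ordinal ni))//= mxE.
apply: le_trans; rewrite lerDl sumr_ge0// => k _; exact: normc_ge0.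
Qed.

(** The compact inclusions turn approximation on the countably many functionals
    in the [us mj] into convergence in [E], and a point of [E] is determined by
    their values. Adding one more functional [u] to the list yields a limit
    that represents [phi] at [u] too, hence the limit does not depend on
    [u]. *)
Theorem reflexivity : exists h, forall u, phi u = ev u h.
Proof.
have [M HM] := finite_approximation.
have [m' Hm'] := choice (compact_inclusion DE).
have invS_gt0 (j : nat) : 0 < j.+1%:R^-1 :> R by rewrite invr_gt0.
have [us Hus] : exists us : nat * nat -> seq D, forall mj f,
    N mj.1 f <= mj.2.+1%:R^-1 * N (m' mj.1) f + \sum_(u <- us mj) normc (ev u f).
  suff h mj : exists us, forall f, N mj.1 f <=
      mj.2.+1%:R^-1 * N (m' mj.1) f + \sum_(u <- us) normc (ev u f).
    by have [us Hus] := choice h; exists us.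
  by have [us _ h] := Hm' mj.1 _ (invS_gt0 mj.2); exists us.
pose L u n := u :: flatten [seq us (m, j) | m <- iota 0 n, j <- iota 0 n].
have inL u v n m j : (m < n)%N -> (j < n)%N -> v \in us (m, j) -> v \in L u n.
  move=> mn jn vus; rewrite inE; apply/orP; right; apply/flattenP.
  exists (us (m, j)) => //; apply/allpairsP; exists (m, j) => /=.
  by rewrite !mem_iota.
have lim u : exists h, phi u = ev u h /\
    forall m j v, v \in us (m, j) -> phi v = ev v h.
  have [b Hb] := choice (fun n => HM (L u n) _ (invS_gt0 n)).
  have [h bh] : exists h, converges N b h.
    apply: (frechet_complete FN) => m e e0.
    have e2 : 0 < e / 2 by rewrite divr_gt0.
    have [j hj] := inverse_nat_small (2 * M (m' m)) e2.
    have [K hK] := inverse_nat_small ((size (us (m, j)))%:R * 2) e2.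
    exists (maxn (maxn m j).+1 K) => i l.
    rewrite !(geq_max, gtn_max) => /andP[/andP[mi ji] Ki] /andP[/andP[ml jl] Kl].
    apply: le_trans (Hus (m, j) _) _ => /=.
    have h1 : j.+1%:R^-1 * N (m' m) (b i - b l) <= e / 2.
      apply: le_trans (hj j (leqnn j)); rewrite mulrC ler_pM2r//.
      apply: le_trans (seminormB (sN _) _ _) _.
      by have [/(_ (m' m)) ? _] := Hb i; have [/(_ (m' m)) ? _] := Hb l; lra.
    have h2 : \sum_(v <- us (m, j)) normc (ev v (b i - b l)) <=
        (size (us (m, j)))%:R * (2 * K.+1%:R^-1).
      apply: sum_le_size => v vus.
      have hi : normc (phi v - ev v (b i)) <= K.+1%:R^-1.
        apply: le_trans ((Hb i).2 v (inL u v i m j mi ji vus)) _.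
        by rewrite lef_pV2 ?posrE// ler_nat.
      have hl : normc (phi v - ev v (b l)) <= K.+1%:R^-1.
        apply: le_trans ((Hb l).2 v (inL u v l m j ml jl vus)) _.
        by rewrite lef_pV2 ?posrE// ler_nat.
      rewrite functionalB//.
      have := ler_normcB (phi v - ev v (b l)) (phi v - ev v (b i)).
      rewrite (_ : _ - _ - _ = ev v (b i) - ev v (b l)); last first.
        by rewrite opprB addrC addrA subrK.
      move=> h; apply: le_trans h _; rewrite mulr_natl mulr2n.
      by rewrite addrC lerD.
    rewrite [leRHS]splitr; apply: lerD h1 _; apply: le_trans h2 _.
    by rewrite mulrA; exact: hK.
  have phih v n0 : (forall n, (n0 <= n)%N -> v \in L u n) -> phi v = ev v h.
    move=> vL; apply/eqP; rewrite -subr_eq0; apply/eqP.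
    apply: normc_eq0_small => e e0; have e2 : 0 < e / 2 by rewrite divr_gt0.
    have [K hK] := inverse_nat_small 1 e2.
    have [K' hK'] := bounded_functional_cvg FN (ev_bounded DE v) bh e2.
    pose n := maxn n0 (maxn K K').
    have h1 := (Hb n).2 v (vL n (leq_maxl _ _)).
    have h2 := hK' n (leq_trans (leq_maxr _ _) (leq_maxr _ _)).
    have h3 := hK n (leq_trans (leq_maxl _ _) (leq_maxr _ _)).
    have := ler_normcD (phi v - ev v (b n)) (ev v (b n) - ev v h).
    rewrite addrA subrK => h4; apply: le_trans h4 _.
    by rewrite [leRHS]splitr lerD// (le_trans h1)// -[leLHS]mul1r.
  exists h; split; first by apply: (phih u 0%N) => n _; exact: mem_head.
  move=> m j v vus; apply: (phih v (maxn m j).+1) => n.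
  by rewrite gtn_max => /andP[mn jn]; exact: inL vus.
have [h0 [_ H0]] := lim 0.
exists h0 => u; have [h [-> H]] := lim u.
have hh0 m : N m (h - h0) = 0.
  apply/le_anti; rewrite N0 andbT; apply/ler_addgt0Pr => e e0; rewrite add0r.
  have [j hj] := inverse_nat_small (N (m' m) (h - h0)) e0.
  apply: le_trans (Hus (m, j) _) _ => /=.
  rewrite big_seq big1 ?addr0 => [|v vus]; first by rewrite mulrC hj.
  by rewrite functionalB// -(H m j)// -(H0 m j)// subrr normc0.
have [_ [m [c hc]]] := ev_bounded DE u.
apply/eqP; rewrite -subr_eq0 -functionalB//; apply/eqP/normc_le0.
by apply: le_trans (hc _) _; rewrite hh0 mulr0.
Qed.

End reflexivity.
End duality.

(** The complex numbers, with all norms equal, so that series of scalars are an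
    instance of series in Frechet spaces. *)
Lemma normc_frechet (R : realType) :
  frechet (fun _ : nat => (fun z => normc z) : R[i]^o -> R).
Proof.
split=> // [_|u hu]; first by split=> [x y|c x]; [exact: ler_normcD|exact: normcM].
have [|l hl] := @complex_complete R u; first by move=> e e0; exact: hu 0%N e e0.
by exists l => m e e0; exact: hl.
Qed.

(** Total boundedness of bounded sets of tuples: the real and imaginary parts
    are rounded to a grid. *)
Lemma finite_classes (R : realType) (I : eqType) (s : seq I) (a : I -> nat -> R[i]) (e : R) :
  0 < e -> (forall v, v \in s -> exists M, forall j, normc (a v j) <= M) ->
  exists (T : finType) (code : nat -> T), forall i j, code i = code j ->
    \sum_(v <- s) normc (a v i - a v j) <= e.
Proof.
move=> e0; have real_code (b : nat -> R) (r M : R) : 0 < r -> (forall j, `|b j| <= M) ->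
    exists (T : finType) (code : nat -> T), forall i j, code i = code j -> `|b i - b j| <= r.
  move=> r0 bM; pose c j := Num.truncn ((b j + M) / r).
  have bM0 j : 0 <= (b j + M) / r.
    by rewrite divr_ge0 ?(ltW r0)//; have := bM j; rewrite ler_norml; lra.
  have cK j : (c j < (Num.truncn (2 * M / r)).+1)%N.
    rewrite ltnS; apply: le_truncn; rewrite ler_pM2r ?invr_gt0//.
    by have := bM j; rewrite ler_norml; lra.
  exists 'I_((Num.truncn (2 * M / r)).+1), (fun j => Ordinal (cK j)) => i j [cij].
  have /andP[] := truncn_itv (bM0 i); have /andP[] := truncn_itv (bM0 j).
  rewrite -/(c i) -/(c j) cij.
  rewrite !ler_pdivlMr// !ltr_pdivrMr// -!natr1 !mulrDl => h1 h2 h3 h4.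
  by rewrite ler_norml; lra.
elim: s e e0 => [|v s IH] e e0 hs.
  by exists unit, (fun=> tt) => i j _; rewrite big_nil ltW.
have e2 : 0 < e / 2 by rewrite divr_gt0.
have e4 : 0 < e / 4 by rewrite divr_gt0.
have [|T [code hT]] := IH _ e2; first by move=> w ws; apply: hs; rewrite inE ws orbT.
have [M HM] := hs v (mem_head _ _).
have [|T1 [c1 h1]] := real_code (fun j => complex.Re (a v j)) _ M e4.
  by move=> j; apply: le_trans (HM j); exact: Re_le_normc.
have [|T2 [c2 h2]] := real_code (fun j => complex.Im (a v j)) _ M e4.
  by move=> j; apply: le_trans (HM j); rewrite -lecR; exact: Im_le_norm.
exists (T * (T1 * T2))%type, (fun j => (code j, (c1 j, c2 j))) => i j [ci c1i c2i].
rewrite big_cons [leRHS]splitr lerD ?hT//.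
have := h1 _ _ c1i; have := h2 _ _ c2i.
case: (a v i) (a v j) => [x y] [x' y'] /= h3 h4.
rewrite -lecR; apply: le_trans (norm_le_ReIm (x - x') (y - y')) _.
by rewrite lecR; lra.
Qed.

Lemma finite_representatives (T : finType) (code : nat -> T) :
  exists s : seq nat, forall j, exists2 i, i \in s & code j = code i.
Proof.
have h (t : T) : exists i, (exists j, code j = t) -> code i = t.
  by have [[j jt]|] := pselect (exists j, code j = t); [exists j|exists 0%N].
have [r hr] := choice h.
exists [seq r t | t <- enum T] => j; exists (r (code j)); last first.
  by rewrite hr//; exists j.
by apply: map_f; rewrite mem_enum.
Qed.

Lemma quarter_sum_le (R : realType) (z : nat -> R[i]) (M : R) n :
  (forall k, normc (z k) <= M) ->
  normc (\sum_(0 <= k < n) (4^-1 ^+ k)%:C * z k) <= 2 * M.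
Proof.
move=> zM; have M0 : 0 <= M by apply: le_trans (zM 0%N); exact: normc_ge0.
apply: le_trans (ler_normc_sum _ _) _.
apply: le_trans (_ : \sum_(0 <= k < n) 2^-1 ^+ k * M <= _).
  apply: ler_sum => k _; rewrite normcM normc_ge0_real; last first.
    by rewrite exprn_ge0// invr_ge0.
  rewrite ler_pM ?normc_ge0// ?exprn_ge0 ?invr_ge0//.
  by rewrite lerXn2r ?nnegrE ?invr_ge0// lef_pV2 ?posrE// ler_nat.
rewrite -mulr_suml ler_wpM2r//; apply: le_trans (@sum_half_powers R 0 n _) _ => //.
by rewrite expr0 mulr1.
Qed.

Section solvability.
Variables (R : realType) (E D : lmodType R[i]) (N : nat -> E -> R).
Variable ev : D -> E -> R[i].
Hypothesis DE : schwartz_duality N ev.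
Let FN : frechet N := duality_frechet DE.
Let sN m : seminorm (N m) := frechet_seminorm FN m.
Let N0 m x : 0 <= N m x := seminorm_ge0 (sN m) x.
Let lev u : functional (ev u) := (ev_bounded DE u).1.

(** [iota] models the identification of functions with distributions. *)
Variables (iota : E -> D) (m0 : nat).
Hypothesis iotaC : forall f g, ev (iota f) g = ev (iota g) f.
Hypothesis iota_eq0 : forall f, (forall g, ev (iota f) g = 0) -> f = 0.
Hypothesis iota_bound : forall f, exists c, forall g, normc (ev (iota f) g) <= c * N m0 g.

Variables p q : E -> E.
Hypothesis pq : forall f g, ev (iota (p f)) g = ev (iota f) (q g).

Lemma iota_inj f g : (forall h, ev (iota f) h = ev (iota g) h) -> f = g.
Proof.
move=> h; apply/eqP; rewrite -subr_eq0; apply/eqP/iota_eq0 => k.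
by rewrite iotaC functionalB// !(iotaC k) h subrr.
Qed.

Lemma p_linear c x y : p (c *: x + y) = c *: p x + p y.
Proof.
apply: iota_inj => h; rewrite pq (iotaC (_ + y)) (iotaC (_ + p y)) !lev.
by rewrite !(iotaC (q h)) !(iotaC h) !pq.
Qed.

Lemma q_linear c x y : q (c *: x + y) = c *: q x + q y.
Proof.
apply: iota_inj => h; rewrite iotaC -pq (iotaC _ h) !lev.
by rewrite !pq !(iotaC h).
Qed.

Let p0 : p 0 = 0.
Proof. by have := p_linear (-1) 0 0; rewrite scaler0 addr0 scaleN1r addNr. Qed.

Let pZ c x : p (c *: x) = c *: p x.
Proof. by rewrite -[c *: x]addr0 p_linear p0 addr0. Qed.

Let pD x y : p (x + y) = p x + p y.
Proof. by rewrite -[x in LHS]scale1r p_linear scale1r. Qed.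

Let pB x y : p (x - y) = p x - p y.
Proof. by rewrite -scaleN1r pD pZ scaleN1r. Qed.

Let q0 : q 0 = 0.
Proof. by have := q_linear (-1) 0 0; rewrite scaler0 addr0 scaleN1r addNr. Qed.

Let qZ c x : q (c *: x) = c *: q x.
Proof. by rewrite -[c *: x]addr0 q_linear q0 addr0. Qed.

Let qB x y : q (x - y) = q x - q y.
Proof. by rewrite -[x]scale1r addrC -scaleN1r q_linear scaleN1r !scale1r addrC. Qed.

Lemma converges_unique v x y : converges N v x -> converges N v y -> x = y.
Proof.
move=> vx vy; apply: iota_inj => h; rewrite !(iotaC _ h).
apply/eqP; rewrite -subr_eq0; apply/eqP.
apply: normc_eq0_small => e e0; have e2 : 0 < e / 2 by rewrite divr_gt0.
have [K hK] := bounded_functional_cvg FN (ev_bounded DE (iota h)) vx e2.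
have [L hL] := bounded_functional_cvg FN (ev_bounded DE (iota h)) vy e2.
have := hK (maxn K L) (leq_maxl _ _); have := hL (maxn K L) (leq_maxr _ _).
set a := ev _ (v _); set b := ev _ y; set d := ev _ x => h1 h2.
have := ler_normcB (a - b) (a - d).
rewrite (_ : a - b - (a - d) = d - b); last first.
  by rewrite opprB addrC addrA subrK.
by lra.
Qed.

(** The closed graph theorem applies: if [x] tends to [0] and [p x] to [y],
    then the pairing of [p x] with [g], which is the pairing of [x] with
    [q g], tends to [0], and so [y = 0]. *)
Lemma p_bounded m : exists k c, forall f, N m (p f) <= c * N k f.
Proof.
pose G x y := y = p x.
have cG : closed_relation N G.
  split=> [|x y x' y' -> ->|c x y ->|u v x y ux vy uv]; rewrite /G ?p0 ?pD ?pZ//.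
  apply: iota_inj => h; apply/eqP; rewrite -subr_eq0; apply/eqP.
  apply: normc_eq0_small => e e0; have e2 : 0 < e / 2 by rewrite divr_gt0.
  have [K hK] := bounded_functional_cvg FN (ev_bounded DE (iota h)) vy e2.
  have [L hL] := bounded_functional_cvg FN (ev_bounded DE (iota (q h))) ux e2.
  pose n := maxn K L.
  have := hK n (leq_maxl _ _); have := hL n (leq_maxr _ _).
  rewrite uv !(iotaC (q h)) -!pq (iotaC h (p _)) (iotaC h y).
  set a := ev _ _; set b := ev _ _; set c := ev _ _ => h1 h2.
  have := ler_normcB (a - b) (a - c).
  rewrite (_ : a - b - (a - c) = c - b); last first.
    by rewrite opprB addrC addrA subrK.
  by lra.
have [k [c H]] := relation_open FN cG (fun _ x _ _ => ex_intro _ (p x) erefl) m.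
exists k, c => f; apply/ler_addgt0Pr => e e0.
by have [_ ->] := H f (ex_intro _ (p f) erefl) e e0.
Qed.

Lemma transpose_bounded u : bounded_functional N (fun x => ev u (p x)).
Proof.
split=> [c x y|]; first by rewrite p_linear lev.
have [_ [m [c [c0 hc]]]] := bounded_functionalP FN (ev_bounded DE u).
have [k [c' h]] := p_bounded m.
exists k, (c * c') => x; apply: le_trans (hc _) _.
by rewrite -mulrA ler_wpM2l// ltW.
Qed.

(** The three properties of [p], in terms of the pairing only: [u] composed
    with [p] is the transpose of [p] at [u], and [u] composed with [q] is the
    extension of [p] to [D] at [u]. *)
Definition solvable := forall f, (forall u, (forall x, ev u (p x) = 0) -> ev u f = 0) ->
  exists x, p x = f.

Definition dual_solvable := forall u, (forall x, p x = 0 -> ev u x = 0) ->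
  exists w, forall x, ev u x = ev w (p x).

Definition hypoelliptic := forall u f, (forall g, ev u (q g) = ev (iota f) g) ->
  exists x, p x = f.

Hypothesis dense_kernel : forall u, (forall x, ev u (p x) = 0) -> forall f e, 0 < e ->
  exists2 v, q v = 0 & normc (ev u f - ev (iota v) f) <= e.

(** If [u] solves the equation with the smooth right-hand side [f], then [f] is
    orthogonal to the kernel of [q] in [E], and by density to the kernel of the
    transpose of [p] in [D]. *)
Lemma solvable_hypoelliptic : solvable -> hypoelliptic.
Proof.
move=> sp u f uq; apply: sp => w wp; apply: normc_eq0_small => e e0.
have [v qv h] := dense_kernel wp f e0.
have : ev (iota v) f = 0 by rewrite iotaC -uq qv functional0.
by move=> vf; rewrite vf subr0 in h.
Qed.

(** By the Hahn-Banach theorem, solvability in [D] follows from an a priori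
    estimate. *)
Lemma factor_functional (T : E -> E) (l : E -> R[i]) k c :
  (forall a x y, T (a *: x + y) = a *: T x + T y) -> functional l ->
  (forall x, normc (l x) <= c * N k (T x)) -> exists w, forall x, l x = ev w (T x).
Proof.
move=> lT ll hl.
have sS : seminorm (fun x => `|c| * N k x).
  split=> [x y|a x]; first by rewrite -mulrDr ler_wpM2l// seminormD.
  by rewrite seminormZ// mulrCA.
have [|w [lw wb wT]] := functional_extension lT ll sS.
  by move=> x; apply: le_trans (hl x) _; rewrite ler_wpM2r// ler_norm.
have [|u hu] := ev_surj DE (w := w); first by split=> //; exists k, `|c|.
by exists u => x; rewrite hu wT.
Qed.

Lemma p_converges v y : converges N v y -> converges N (p \o v) (p y).
Proof.
move=> vy i e e0; have [k [c h]] := p_bounded i.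
have [|K hK] := vy k (e / (`|c| + 1)); first by rewrite divr_gt0// ltr_wpDl.
exists K => n /hK hn /=; rewrite -pB; apply: le_trans (h _) _.
apply: le_trans (_ : (`|c| + 1) * N k (v n - y) <= _).
  by rewrite ler_wpM2r// (le_trans (ler_norm _))// lerDl.
by rewrite mulrC -ler_pdivlMr// ltr_wpDl.
Qed.

Lemma range_closed_relation : closed_relation N (fun f y => f = p y).
Proof.
split=> [|x y x' y' -> ->|a x y ->|v w x y vx wy vw]; rewrite ?p0 ?pD ?pZ//.
apply: converges_unique vx _; have := p_converges wy.
by rewrite (_ : p \o w = v)//; apply/funext => n /=; rewrite vw.
Qed.

(** A solvable operator has a closed range, so it is open onto it: every value
    has a preimage of controlled size, at which [u] takes the same value as at
    any other preimage. *)
Lemma solvable_dual_solvable : solvable -> dual_solvable.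
Proof.
move=> sp u uker.
pose G f y := f = p y.
have [_ [m [c [c0 hc]]]] := bounded_functionalP FN (ev_bounded DE u).
have cG := range_closed_relation.
have dc v x : converges N v x -> (forall n, exists y, G (v n) y) -> exists y, G x y.
  move=> vx hv; have [|y <-] := sp x; last by exists y.
  move=> w wp; apply: normc_eq0_small => e e0.
  have [K hK] := bounded_functional_cvg FN (ev_bounded DE w) vx e0.
  have [y vK] := hv K.
  by have := hK K (leqnn K); rewrite vK wp sub0r normc_opp.
have [k [c' H]] := relation_open FN cG dc m.
apply: (@factor_functional p (ev u) k (c * c')) => //; first exact: p_linear.
move=> x; apply/ler_addgt0Pr => e e0.
have ec : 0 < e / c by rewrite divr_gt0.
have [y pxy hy] := H (p x) (ex_intro _ x erefl) _ ec.
have -> : ev u x = ev u y.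
  apply/eqP; rewrite -subr_eq0 -functionalB//; apply/eqP/uker.
  by rewrite pB pxy subrr.
apply: le_trans (hc y) _; rewrite -(ler_pM2l c0) in hy.
by apply: le_trans hy _; rewrite mulrDr mulrA [c * (e / c)]mulrC divfK ?gt_eqF.
Qed.

(** By the Hahn-Banach theorem, the distance to the range in the seminorm [N k]
    is attained by a functional that vanishes on the range. *)
Lemma annihilated_approximation f :
  (forall u, (forall x, ev u (p x) = 0) -> ev u f = 0) ->
  forall k e, 0 < e -> exists x, N k (f - p x) <= e.
Proof.
move=> hf k e e0; pose Z g t := exists x, N k (g - p x) <= t.
have [|w [d [lw wZ wf dZ]]] := @functional_le_bounds R E Z f.
  split=> [g|g t [x]|g t g' t' [x ht] [x' ht']|c g t [x ht]].
  - by exists (N k (g - p 0)), 0.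
  - exact: le_trans.
  - exists (x + x'); rewrite pD opprD addrACA.
    by apply: le_trans (seminormD (sN k) _ _) _; exact: lerD.
  - by exists (c *: x); rewrite pZ -scalerBr seminormZ// ler_wpM2l// normc_ge0.
have [|u hu] := ev_surj DE (w := w).
  split=> //; exists k, 1 => x; rewrite mul1r; apply: wZ; exists 0.
  by rewrite p0 subr0.
have d0 : d = 0.
  have : w f = 0.
    rewrite -hu; apply: hf => x; rewrite hu; apply: normc_le0; apply: wZ; exists x.
    by rewrite subrr seminorm0.
  by rewrite wf => -[].
have [t [x xt] te] := dZ e e0; exists x.
by apply: le_trans xt _; rewrite d0 add0r in te; exact: ltW.
Qed.


(** The gliding hump runs in the dual space here: a series of functionals that
    vanish on the kernel of [p] is again such a functional, hence factors
    through [p]. *)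
Lemma dual_solvable_bound m : dual_solvable -> exists k c, forall w y,
  functional w -> (forall x, normc (w x) <= N m x) ->
  (forall x, p x = 0 -> w x = 0) -> normc (w y) <= c * N k (p y).
Proof.
move=> dsp; apply: contrapT => nb.
pose PW w := [/\ functional w, forall x, normc (w x) <= N m x &
  forall x, p x = 0 -> w x = 0].
have H (j : nat) : exists wy : (E -> R[i]) * E, PW wy.1 /\
    j.+1%:R * N j (p wy.2) < normc (wy.1 wy.2).
  apply: contrapT => h; apply: nb; exists j, j.+1%:R => w y lw wb wk.
  by rewrite leNgt; apply/negP => hlt; apply: h; exists (w, y).
have {H}[wy Hwy] := choice H.
pose a j := normc ((wy j).1 (wy j).2).
have a0 j : 0 < a j.
  by have [_] := Hwy j; apply: le_lt_trans; rewrite mulr_ge0.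
pose g j := (j.+1%:R / a j)%:C *: (wy j).2.
have wg j : normc ((wy j).1 (g j)) = j.+1%:R.
  have [[lw _ _] _] := Hwy j.
  rewrite functionalZ// normcM normc_ge0_real ?divr_ge0 ?(ltW (a0 j))//.
  by rewrite -/(a j) divfK// gt_eqF.
have pg j : N j (p (g j)) <= 1.
  have [_ h] := Hwy j.
  rewrite pZ seminormZ// normc_ge0_real ?divr_ge0 ?(ltW (a0 j))//.
  by rewrite mulrAC ler_pdivrMr// mul1r ltW.
have bpg u : exists M, forall j, normc (ev u (p (g j))) <= M.
  have [_ [k [c [c0 hc]]]] := bounded_functionalP FN (ev_bounded DE u).
  have [|M HM] := @eventually_bounded R (fun j => N k (p (g j))) k 1.
    by move=> i ki; apply: le_trans (pg i); exact: (frechet_le FN).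
  by exists (c * M) => j; apply: le_trans (hc _) _; rewrite ler_wpM2l// ltW.
have bW w : PW w -> exists M, forall j, normc (w (g j)) <= M.
  move=> [lw wb wk]; have [|u hu] := ev_surj DE (w := w).
    by split=> //; exists m, 1 => x; rewrite mul1r.
  have [|v hv] := dsp u; first by move=> x px; rewrite hu wk.
  by have [M HM] := bpg v; exists M => j; rewrite -hu hv.
have [|||M HM] := @gliding_hump R {w | PW w} nat (fun v j => sval v (g j)).
- by move=> [w Pw] /=; exact: bW.
- by move=> j; exists (N m (g j)) => -[w [lw wb wk]] /=.
- move=> sg; pose S n x := \sum_(0 <= k < n) (4^-1 ^+ k)%:C * sval (sg k) x.
  have hlim x : exists l, forall e, 0 < e -> exists K, forall n, (K <= n)%N ->
      normc (S n x - l) <= e.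
    have [|l hl] := @frechet_bounded_series R R[i]^o _ (normc_frechet R) (fun k => sval (sg k) x) id.
      by move=> _; exists (N m x) => k; case: (sg k) => w [].
    by exists l => e e0; exact: hl 0%N e e0.
  have [w hw] := choice hlim.
  have lS n : functional (S n).
    move=> c x y; rewrite /S mulr_sumr -big_split; apply: eq_bigr => k _ /=.
    by case: (sg k) => v [lv _ _] /=; rewrite lv mulrDr mulrCA.
  have SN n x : normc (S n x) <= 2 * N m x.
    by apply: quarter_sum_le => k; case: (sg k) => v [].
  have wN x : normc (w x) <= 2 * N m x.
    apply/ler_addgt0Pr => e e0; have [K hK] := hw x e e0.
    have := ler_normcB (S K x) (S K x - w x).
    by rewrite subKr; have := hK K (leqnn K); have := SN K x; lra.
  have lw : functional w.
    move=> c x y; apply/eqP; rewrite -subr_eq0; apply/eqP.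
    apply: normc_eq0_small => e e0.
    pose r := e / (normc c + 2).
    have c2 : 0 < normc c + 2 by rewrite ltr_wpDl// normc_ge0.
    have r0 : 0 < r by rewrite divr_gt0.
    have [K1 h1] := hw (c *: x + y) r r0; have [K2 h2] := hw x r r0.
    have [K3 h3] := hw y r r0; pose n := maxn K1 (maxn K2 K3).
    have {}h1 := h1 n (leq_maxl _ _).
    have {}h2 := h2 n (leq_trans (leq_maxl _ _) (leq_maxr _ _)).
    have {}h3 := h3 n (leq_trans (leq_maxr _ _) (leq_maxr _ _)).
    rewrite (_ : w _ - _ = (c * (S n x - w x) + (S n y - w y)) -
        (S n (c *: x + y) - w (c *: x + y))); last by rewrite lS; ring.
    apply: le_trans (ler_normcB _ _) _; apply: le_trans (lerD (ler_normcD _ _) h1) _.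
    rewrite normcM; apply: le_trans (_ : normc c * r + r + r <= _).
      by rewrite !lerD// ler_wpM2l// normc_ge0.
    by rewrite -addrA -mulr2n -mulr_natl -mulrDl mulrC divfK// gt_eqF.
  have wker x : p x = 0 -> w x = 0.
    move=> px; apply: normc_eq0_small => e e0; have [K hK] := hw x e e0.
    have := hK K (leqnn K); rewrite {1}/S big1 ?sub0r ?normc_opp// => k _.
    by case: (sg k) => v [_ _ vk] /=; rewrite vk// mulr0.
  have [|u hu] := ev_surj DE (w := w); first by split=> //; exists m, 2.
  have [|v hv] := dsp u; first by move=> x px; rewrite hu wker.
  have [M HM] := bpg v; exists (M + 1) => j.
  have [K hK] := hw (g j) 1 ltr01; exists K => n /hK h.
  have := ler_normcD (S n (g j) - w (g j)) (w (g j)).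
  by rewrite subrK; have := HM j; rewrite -hv hu; lra.
pose j := Num.truncn `|M|.
have [Pw _] := Hwy j.
have := HM (exist PW _ Pw) j; rewrite /= wg leNgt => /negP; apply.
by apply: le_lt_trans (ler_norm M) _; exact: truncnS_gt.
Qed.

(** The functionals in the preceding bound compute the distance to the kernel
    of [p], so small values of [p] have small preimages. A right-hand side
    orthogonal to the kernel of the transpose is a limit of values of [p], and
    successive approximation makes it a value. *)
Lemma dual_solvable_solvable : dual_solvable -> solvable.
Proof.
move=> dsp f hf.
have bound m : exists k c, 0 <= c /\ forall y e, 0 < e ->
    exists y', p y' = p y /\ N m y' <= c * N k (p y) + e.
  have [k [c H]] := dual_solvable_bound m dsp.
  exists k, `|c|; split=> // y e e0.
  pose Z g t := exists y', p y' = p g /\ N m y' <= t.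
  have [|w [d [lw wZ wy dZ]]] := @functional_le_bounds R E Z y.
    split=> [g|g t [x [_]]|g t g' t' [x [px ht]] [x' [px' ht']]|a g t [x [px ht]]].
    - by exists (N m g), g.
    - exact: le_trans.
    - exists (x + x'); rewrite !pD px px'; split=> //.
      by apply: le_trans (seminormD (sN m) _ _) _; exact: lerD.
    - exists (a *: x); rewrite !pZ px; split=> //.
      by rewrite seminormZ// ler_wpM2l// normc_ge0.
  have hd : d <= `|c| * N k (p y).
    have := H w y lw; rewrite wy normc_real => h.
    apply: le_trans (ler_norm d) _; apply: le_trans (h _ _) _.
    - by move=> x; apply: wZ; exists x.
    - move=> x px; apply: normc_le0; apply: wZ; exists 0.
      by rewrite p0 px seminorm0.
    - by rewrite ler_wpM2r// ler_norm.
  have [t [y' [py' yt]] td] := dZ e e0; exists y'; split=> //.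
  by lra.
pose F f := forall u, (forall x, ev u (p x) = 0) -> ev u f = 0.
have [||k [c H]] := @lift_approximations R E N FN _ range_closed_relation F _ _ 0%N.
- by move=> g x y Fg -> u up; rewrite functionalB// Fg// up subr0.
- move=> m; have [k [c [c0 hb]]] := bound m; exists k, c => g Fg k' e e0.
  pose d := e / 2 / (c + 1).
  have c1 : 0 < c + 1 by rewrite ltr_wpDl.
  have d0 : 0 < d by rewrite !divr_gt0.
  have cd : (c + 1) * d = e / 2 by rewrite /d mulrC divfK// gt_eqF.
  have cd0 : 0 <= c * d by rewrite mulr_ge0// ltW.
  have [x hx] := annihilated_approximation Fg (maxn k k') d0.
  have hk : N k (g - p x) <= d by apply: le_trans hx; apply: (frechet_le FN); exact: leq_maxl.
  have hk' : N k' (g - p x) <= d by apply: le_trans hx; apply: (frechet_le FN); exact: leq_maxr.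
  have e2 : 0 < e / 2 by rewrite divr_gt0.
  have [y [py yb]] := hb x _ e2.
  exists (p y), y; split=> //; last by rewrite py; apply: le_trans hk' _; lra.
  have h1 : c * N k (p x) <= c * (N k g + d).
    rewrite ler_wpM2l//; have := seminormB (sN k) g (g - p x).
    by rewrite subKr; lra.
  by rewrite mulrDr in h1; lra.
- have [y -> _] := H f hf 1 ltr01; by exists y.
Qed.


Let scaled_bound (l : E -> R[i]) k c : functional l ->
  (forall g, N k (q g) <= 1 -> normc (l g) <= c) ->
  forall g, normc (l g) <= c * N k (q g).
Proof.
move=> ll hl g; apply/ler_addgt0Pr => e e0.
have c0 : 0 <= c.
  by apply: le_trans (hl 0 _); rewrite ?normc_ge0// q0 seminorm0.
have d0 : 0 < e / (c + 1) by rewrite divr_gt0// ltr_wpDl.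
pose r := N k (q g) + e / (c + 1).
have r0 : 0 < r by rewrite ltr_wpDl.
have := hl (r^-1%:C *: g); rewrite qZ seminormZ// functionalZ// normcM.
rewrite normc_ge0_real ?invr_ge0 ?(ltW r0)// ler_pdivrMl// mulr1 lerDl (ltW d0) => /(_ isT).
rewrite ler_pdivrMl// => h; apply: le_trans h _.
rewrite /r mulrDl [N k _ * c]mulrC lerD2l mulrAC ler_pdivrMr ?ltr_wpDl//.
by rewrite ler_wpM2l ?(ltW e0)// lerDl.
Qed.

(** Write [r m f] for the supremum of [normc (ev (iota f) g)] over all [g] with
    [N m (q g) <= 1]; the lemma bounds [r m] on the range of [p] by a norm. On
    this range, [r m0] is finite since [p] and [q] are transposes of each other.
    If the bound fails for [m = maxn m0 m1], there are [f j] in the range that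
    tend to [0] while [r m (f j) = 1]. The sum [z] of a series formed from them
    with coefficients in geometric progression has [r m z <= 2], therefore [z]
    solves the equation in [D] by the Hahn-Banach theorem, lies in the range of
    [p] by hypoellipticity, and has finite [r m0]; by the gliding hump, [r m0]
    is bounded on the [f j]. Now choose [g j] that almost realize [r m (f j)].
    As [N m0] is compact relatively to [N m], these [g j] are close to finitely
    many of them for [N m0 \o q], and on those finitely many the [f j] tend to
    [0], a contradiction. *)
Lemma hypoelliptic_bound : hypoelliptic -> exists m k c, forall x g,
  N m (q g) <= 1 -> normc (ev (iota (p x)) g) <= c * N k (p x).
Proof.
move=> hyp; have [m1 comp] := compact_inclusion DE m0.
pose m := maxn m0 m1.
have q1 g : N m0 (q g) <= N m (q g) by apply: (frechet_le FN); exact: leq_maxl.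
exists m; apply: contrapT => nb.
have iotap x : exists c, forall g, normc (ev (iota (p x)) g) <= c * N m0 (q g).
  by have [c hc] := iota_bound x; exists c => g; rewrite pq.
pose A x := [set normc (ev (iota (p x)) g) | g in [set g | N m (q g) <= 1]].
have A0 x : A x 0.
  by exists 0 => /=; rewrite ?q0 ?seminorm0// functional0// normc0.
have sA x : has_sup (A x).
  split; first by exists 0.
  have [c hc] := iotap x; exists `|c| => _ [g /= g1 <-].
  apply: le_trans (hc g) _; apply: le_trans (ler_norm _) _.
  rewrite normrM (ger0_norm (N0 _ _)) ler_piMr//; exact: le_trans (q1 g) g1.
have H (j : nat) : exists xg : E * E, [/\ N m (q xg.2) <= 1,
    2^-1 <= normc (ev (iota (p xg.1)) xg.2),
    forall g, N m (q g) <= 1 -> normc (ev (iota (p xg.1)) g) <= 1 &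
    j.+1%:R * N j (p xg.1) <= 1].
  have [x [g [g1 hg]]] : exists x g, N m (q g) <= 1 /\
      j.+1%:R * N j (p x) < normc (ev (iota (p x)) g).
    apply: contrapT => h; apply: nb; exists j, j.+1%:R => x g g1.
    by rewrite leNgt; apply/negP => hlt; apply: h; exists x, g.
  pose r := sup (A x).
  have gr : normc (ev (iota (p x)) g) <= r.
    by apply: ub_le_sup; [case: (sA x)|exists g].
  have r0 : 0 < r.
    by apply: lt_le_trans gr; apply: le_lt_trans hg; rewrite mulr_ge0.
  have r2 : 0 < r / 2 by rewrite divr_gt0.
  have [_ [g' /= g'1 <-] hg'] := sup_adherent r2 (sA x).
  have scale h : normc (ev (iota (p (r^-1%:C *: x))) h) =
      r^-1 * normc (ev (iota (p x)) h).
    rewrite pZ iotaC functionalZ// normcM normc_ge0_real ?invr_ge0 ?ltW//.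
    by rewrite iotaC.
  exists (r^-1%:C *: x, g'); split=> //=.
  - rewrite scale ler_pdivlMl//; move: hg'; rewrite -/r; lra.
  - move=> h h1; rewrite scale ler_pdivrMl// mulr1.
    by apply: ub_le_sup; [case: (sA x)|exists h].
  - rewrite pZ seminormZ// normc_ge0_real ?invr_ge0 ?ltW//.
    by rewrite mulrCA ltr_pdivrMl// mulr1 (lt_le_trans hg).
have {H}[xg Hxg] := choice H.
pose f j := p (xg j).1; pose g j := (xg j).2.
have fN j : N j (f j) <= j.+1%:R^-1.
  by have [_ _ _] := Hxg j; rewrite -/(f j) -ler_pdivlMl// mulr1.
have f1 j h : normc (ev (iota (f j)) h) <= N m (q h).
  rewrite -[leRHS]mul1r; apply: scaled_bound => // h' h'1.
  by have [_ _ + _] := Hxg j; apply.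
have bf k : exists M, forall j, N k (f j) <= M.
  apply: (@eventually_bounded _ _ k 1) => j kj.
  apply: le_trans (frechet_le FN (f j) kj) _; apply: le_trans (fN j) _.
  by rewrite invf_le1// ler1n.
have [|||M HM] := @gliding_hump R nat {h | N m0 (q h) <= 1}
    (fun j h => ev (iota (f j)) (sval h)).
- move=> j; have [c hc] := iotap (xg j).1; exists `|c| => -[h h1] /=.
  apply: le_trans (hc h) _; apply: le_trans (ler_norm _) _.
  by rewrite normrM (ger0_norm (N0 _ _)) ler_piMr.
- move=> [h h1] /=.
  have [_ [k [c [c0 hc]]]] := bounded_functionalP FN (ev_bounded DE (iota h)).
  have [M HM] := bf k; exists (c * M) => j.
  by rewrite iotaC; apply: le_trans (hc _) _; rewrite ler_wpM2l// ltW.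
- move=> sg; have [z cz] := frechet_bounded_series FN sg bf.
  have evz h : forall e, 0 < e -> exists K, forall n, (K <= n)%N ->
      normc (\sum_(0 <= k < n) (4^-1 ^+ k)%:C * ev (iota (f (sg k))) h - ev (iota z) h) <= e.
    move=> e e0; have [K hK] := bounded_functional_cvg FN (ev_bounded DE (iota h)) cz e0.
    exists K => n /hK; rewrite functional_sum// (iotaC h z).
    congr (normc (_ - _) <= _); apply: eq_bigr => k _.
    by rewrite functionalZ// iotaC.
  have zb h : normc (ev (iota z) h) <= 2 * N m (q h).
    apply/ler_addgt0Pr => e e0; have [K hK] := evz h e e0.
    have h1 := @quarter_sum_le R (fun k => ev (iota (f (sg k))) h) _ K
      (fun k => f1 (sg k) h).
    set a := \sum_(_ <= _ < _) _ in h1.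
    have := ler_normcB a (a - ev (iota z) h); rewrite subKr.
    by have := hK K (leqnn K); rewrite -/a; lra.
  have [u hu] := @factor_functional q (ev (iota z)) m 2 q_linear (lev _) zb.
  have [|x px] := hyp u z; first by move=> h; rewrite hu.
  have [c hc] := iotap x; exists (`|c| + 1) => -[h h1] /=.
  have [K hK] := evz h 1 ltr01; exists K => n /hK.
  set a := \sum_(_ <= _ < _) _ => h2.
  have := ler_normcD (a - ev (iota z) h) (ev (iota z) h); rewrite subrK.
  have : normc (ev (iota z) h) <= `|c|.
    rewrite -px; apply: le_trans (hc h) _; apply: le_trans (ler_norm _) _.
    by rewrite normrM (ger0_norm (N0 _ _)) ler_piMr.
  by lra.
have M0 : 0 <= M.
  have h0 : N m0 (q 0) <= 1 by rewrite q0 seminorm0.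
  by apply: le_trans (HM 0%N (exist _ 0 h0)); exact: normc_ge0.
have fM j h : normc (ev (iota (f j)) h) <= M * N m0 (q h).
  by apply: scaled_bound => // h' h'1; exact: HM j (exist _ h' h'1).
(* Chosen so that [M * (3 * e)] and the value [8^-1] below add up to less than
   the lower bound [2^-1] for the values of [f j] at [g j]. *)
pose e := (16 * (M + 1))^-1.
have M1 : 0 < M + 1 by rewrite ltr_wpDl.
have e0 : 0 < e by rewrite invr_gt0 mulr_gt0.
have [us usN hus] := comp e e0.
have gN j : N m (q (g j)) <= 1 by have [] := Hxg j.
have [|T [code hcode]] := @finite_classes R D us (fun u j => ev u (q (g j))) e e0.
  by move=> u us_u; exists 1 => j; apply: le_trans (usN u us_u _) (le_trans (q1 _) (gN j)).
have [s hs] := finite_representatives code.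
have small : exists j, forall i, i \in s -> normc (ev (iota (f j)) (g i)) <= 8^-1.
  suff [K hK] : exists K, forall i, i \in s -> forall j, (K <= j)%N ->
      normc (ev (iota (f j)) (g i)) <= 8^-1.
    by exists K => i si; exact: hK i si K (leqnn K).
  elim: s {hs} => [|i s [K hK]]; first by exists 0%N.
  have [_ [k [c [c0 hc]]]] := bounded_functionalP FN (ev_bounded DE (iota (g i))).
  have e8 : (0 : R) < 8^-1 by rewrite invr_gt0.
  have [L hL] := inverse_nat_small c e8.
  exists (maxn K (maxn k L)) => i'; rewrite inE => /predU1P[->|si'] j; rewrite !geq_max.
    move=> /and3P[_ kj Lj]; rewrite iotaC; apply: le_trans (hc _) _.
    apply: le_trans (hL j Lj); rewrite ler_wpM2l ?(ltW c0)//.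
    by apply: le_trans (fN j); exact: (frechet_le FN).
  by move=> /and3P[Kj _ _]; exact: hK.
have [j hj] := small; have [i si cij] := hs j.
have [_ gj _ _] := Hxg j; rewrite -/(f j) -/(g j) in gj.
have h1 := hcode _ _ cij.
have h2 : N m0 (q (g j - g i)) <= 3 * e.
  apply: le_trans (hus _) _; rewrite qB.
  have -> : \sum_(u <- us) normc (ev u (q (g j) - q (g i))) =
      \sum_(u <- us) normc (ev u (q (g j)) - ev u (q (g i))).
    by apply: eq_bigr => u _; rewrite functionalB.
  have h3 : N m1 (q (g j) - q (g i)) <= 2.
    apply: le_trans (seminormB (sN m1) _ _) _.
    have h4 l : N m1 (q (g l)) <= 1.
      by apply: le_trans (gN l); apply: (frechet_le FN); exact: leq_maxr.
    by have := h4 i; have := h4 j; lra.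
  have h5 : e * N m1 (q (g j) - q (g i)) <= e * 2 by rewrite ler_wpM2l// ltW.
  by lra.
have h3 : normc (ev (iota (f j)) (g j - g i)) <= 3 / 16.
  apply: le_trans (fM j _) _; apply: le_trans (_ : M * (3 * e) <= _).
    by rewrite ler_wpM2l.
  rewrite /e invfM mulrA mulrCA mulrA ler_pdivrMr//.
  by lra.
have := hj i si.
have := ler_normcD (ev (iota (f j)) (g j - g i)) (ev (iota (f j)) (g i)).
rewrite functionalB// subrK; rewrite functionalB// in h3.
by lra.
Qed.

(** The a priori estimate of the preceding lemma extends to the closure of the
    range of [p], where it yields a solution in [D]; hypoellipticity replaces
    it by a solution in [E]. *)
Lemma hypoelliptic_solvable : hypoelliptic -> solvable.
Proof.
move=> hyp f hf; have [m [k [c H]]] := hypoelliptic_bound hyp.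
have c0 : 0 <= `|c| * N k f by rewrite mulr_ge0.
have fb g : N m (q g) <= 1 -> normc (ev (iota f) g) <= `|c| * N k f.
  move=> g1; apply/ler_addgt0Pr => e e0.
  have [_ [l [d [d0 hd]]]] := bounded_functionalP FN (ev_bounded DE (iota g)).
  pose r := e / (`|c| + d).
  have cd : 0 < `|c| + d by rewrite ltr_wpDl.
  have r0 : 0 < r by rewrite divr_gt0.
  have [x hx] := annihilated_approximation hf (maxn k l) r0.
  have hk : N k (f - p x) <= r by apply: le_trans hx; apply: (frechet_le FN); exact: leq_maxl.
  have hl : N l (f - p x) <= r by apply: le_trans hx; apply: (frechet_le FN); exact: leq_maxr.
  have h1 : normc (ev (iota (p x)) g) <= `|c| * (N k f + r).
    apply: le_trans (H x g g1) _; apply: le_trans (_ : `|c| * N k (p x) <= _).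
      by rewrite ler_wpM2r// ler_norm.
    rewrite ler_wpM2l//; have := seminormB (sN k) f (f - p x).
    by rewrite subKr; lra.
  have h2 : normc (ev (iota g) (f - p x)) <= d * r.
    by apply: le_trans (hd _) _; rewrite ler_wpM2l// ltW.
  have h3 : `|c| * r + d * r = e by rewrite -mulrDl mulrC divfK// gt_eqF.
  have := ler_normcD (ev (iota g) (f - p x)) (ev (iota g) (p x)).
  rewrite -functionalD// subrK (iotaC g f) (iotaC g (p x)).
  by rewrite mulrDr in h1; lra.
have [u hu] := factor_functional q_linear (lev (iota f)) (scaled_bound (lev (iota f)) fb).
by apply: (hyp u) => g; rewrite hu.
Qed.

End solvability.

(** * Calculus in coordinates *)

Section partial_derivatives.
Variable R : realType.

Lemma derivable_eps n (f : 'rV[R]_n -> R) x v : derivable f x v ->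
  forall e, 0 < e -> exists2 d, 0 < d & forall t : R, `|t| < d ->
    `|f (x + t *: v) - f x - t * 'D_v f x| <= e * `|t|.
Proof.
move=> df e e0; have /cvgrPdist_le/(_ e e0) := df.
rewrite near_withinE => /nbhs_ballP[d /= d0 hd]; exists d => // t td.
have [->|t0] := eqVneq t 0.
  by rewrite scale0r addr0 subrr mul0r subrr !normr0 mulr0.
have : ball (0 : R) d t by rewrite -ball_normE /= sub0r normrN.
move=> /hd /(_ t0) /=; rewrite -/('D_v f x) (addrC (t *: v)).
rewrite -(ler_pM2r (x := `|t|)) ?normr_gt0// -normrM distrC mulrBl.
by rewrite [_ *: _ * t]mulrC -[t^-1 *: _]/(t^-1 * _) mulrA divff// mul1r [_ * t]mulrC.
Qed.

Lemma derive_eps n (f : 'rV[R]_n -> R) x v l :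
  (forall e, 0 < e -> exists2 d, 0 < d & forall t : R, `|t| < d ->
    `|f (x + t *: v) - f x - t * l| <= e * `|t|) ->
  derivable f x v /\ 'D_v f x = l.
Proof.
move=> h; suff H : (fun t : R => t^-1 *: ((f \o shift x) (t *: v) - f x)) @ 0^' --> l.
  by split; [apply/cvg_ex; exists l|exact: cvg_lim H].
apply/cvgrPdist_le => e e0; rewrite near_withinE.
have [d d0 hd] := h e e0; apply/nbhs_ballP; exists d => //= t.
rewrite -ball_normE /= sub0r normrN => td t0; have := hd t td.
rewrite (addrC x) distrC -ler_pdivrMr ?normr_gt0// -normfV -normrM mulrBl.
by rewrite mulrAC divff// mul1r mulrC.
Qed.

Lemma continuous_eps n (f : 'rV[R]_n -> R) x : {for x, continuous f} <->
  forall e, 0 < e -> exists2 d, 0 < d & forall y, `|y - x| < d -> `|f y - f x| <= e.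
Proof.
have Fx : Filter (nbhs x) := nbhs_filter x.
split=> [cf e e0|h].
  have /cvgrPdist_le/(_ e e0) H := cf.
  have /nbhs_ballP[d /= d0 hd] : nbhs x [set y | `|f x - f y| <= e] := H.
  exists d => // y yx; rewrite distrC; apply: hd.
  by rewrite -ball_normE /= distrC.
apply/cvgrPdist_le => e e0; have [d d0 hd] := h e e0.
suff H : nbhs x [set y | `|f x - f y| <= e] by exact: H.
apply/nbhs_ballP; exists d => //= y; rewrite -ball_normE /= distrC => yx.
by rewrite distrC; exact: hd.
Qed.

Lemma line_mvt n (f : 'rV[R]_n -> R) x v (t : R) :
  (forall c : R, 0 <= c <= 1 -> derivable f (x + (c * t) *: v) v) ->
  exists2 c : R, 0 <= c <= 1 & f (x + t *: v) - f x = t * 'D_v f (x + (c * t) *: v).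
Proof.
move=> df.
have [->|t0] := eqVneq t 0.
  by exists 0; rewrite ?lexx ?ler01// scale0r addr0 subrr mul0r.
pose h (c : R) := f (x + (c * t) *: v).
have dh (c : R) : 0 <= c <= 1 -> is_derive c (1 : R) h (t * 'D_v f (x + (c * t) *: v)).
  move=> /df dfc.
  suff H : (fun s : R => s^-1 *: ((h \o shift c) (s *: (1 : R)) - h c)) @ 0^' -->
      t * 'D_v f (x + (c * t) *: v).
    by apply: DeriveDef; [apply/cvg_ex; eexists; exact: H|exact: cvg_lim H].
  apply/cvgrPdist_le => e e0; rewrite near_withinE.
  have e1 : 0 < e / `|t| by rewrite divr_gt0// normr_gt0.
  have [d d0 hd] := derivable_eps dfc e1.
  apply/nbhs_ballP; exists (d / `|t|); first by rewrite /= divr_gt0// normr_gt0.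
  move=> s; rewrite -ball_normE /= sub0r normrN ltr_pdivlMr ?normr_gt0// -normrM => st s0.
  have E : e / `|t| * `|s * t| = e * `|s| by rewrite normrM; field; rewrite normr_eq0.
  have := hd _ st; rewrite E -(addrA x) -scalerDl -mulrDl.
  move=> H; rewrite -(@ler_pM2r _ `|s|) ?normr_gt0//; move: H.
  rewrite -normrM -[X in _ -> X <= _]normrN.
  rewrite /h /= [s%:A]mulr1 (addrC s) -[s^-1 *: _]/(s^-1 * _).
  move: (f _) (f _) ('D_v f _) => a b l; congr (`|_| <= _).
  by field.
have [||c + hc] := @MVT_segment R h (fun c => t * 'D_v f (x + (c * t) *: v)) 0 1 ler01.
- by move=> c /itvP c01; apply: dh; rewrite !c01.
- apply: derivable_within_continuous => c; rewrite inE /= => /itvP c01.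
  by apply: ex_derive; apply: dh; rewrite !c01.
rewrite in_itv /= => c01; exists c => //.
by move: hc; rewrite /h mul1r mul0r scale0r addr0 subr0 mulr1.
Qed.

Definition in_box n (y z x : 'rV[R]_n) := forall k, exists2 c : R, 0 <= c <= 1 &
  x ord0 k = y ord0 k + c * (z ord0 k - y ord0 k).

Lemma in_box_ball n (c y z x : 'rV[R]_n) (r : R) : in_box y z x ->
  `|y - c| <= r -> `|z - c| <= r -> `|x - c| <= r.
Proof.
move=> xyz yc zc; have r0 : 0 <= r by apply: le_trans yc.
have coord (u : 'rV[R]_n) k : `|u - c| <= r -> `|u ord0 k - c ord0 k| <= r.
  apply: le_trans; rewrite [leRHS]/Num.norm/= mx_normrE.
  apply: le_trans (le_bigmax _ _ (ord0, k)) => /=.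
  by rewrite !mxE.
rewrite [leLHS]/Num.norm/= mx_normrE; apply/bigmax_leP; split=> //= -[i k] _ /=.
rewrite !mxE (ord1 i); have [a /andP[a0 a1] ->] := xyz k.
have := coord y k yc; have := coord z k zc; rewrite !ler_norml.
move: (y _ _) (z _ _) (c _ _) => p q s /andP[h1 h2] /andP[h3 h4].
have h5 : a * (q - s) <= a * r by rewrite ler_wpM2l.
have h6 : a * (- r) <= a * (q - s) by rewrite ler_wpM2l.
have a1' : 0 <= 1 - a by rewrite subr_ge0.
have h7 : (1 - a) * (p - s) <= (1 - a) * r by rewrite ler_wpM2l.
have h8 : (1 - a) * (- r) <= (1 - a) * (p - s) by rewrite ler_wpM2l.
have E : p + a * (q - p) - s = a * (q - s) + (1 - a) * (p - s) by ring.
by rewrite E; apply/andP; split; nra.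
Qed.

(** The coordinates are changed one at a time, and the mean value theorem is
    applied on each of the [n] segments. *)
Lemma box_mvt n (f : 'rV[R]_n -> R) (y z : 'rV[R]_n) :
  (forall x, in_box y z x -> forall l, derivable f x (evec R l)) ->
  exists2 xi : 'I_n -> 'rV[R]_n, forall l, in_box y z (xi l) &
    f z - f y = \sum_l 'D_(evec R l) f (xi l) * (z ord0 l - y ord0 l).
Proof.
move=> df.
pose w k : 'rV[R]_n := \row_i (if (i < k)%N then z ord0 i else y ord0 i).
have wS (k : 'I_n) : w k.+1 = w k + (z ord0 k - y ord0 k) *: evec R k.
  apply/rowP => i; rewrite !mxE eqxx /= ltnS leq_eqVlt (inj_eq val_inj).
  have [->|ik] := eqVneq i k; first by rewrite ltnn /= mulr1 addrC subrK.
  by rewrite /= mulr0 addr0.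
have box_w (k : 'I_n) (c : R) : 0 <= c <= 1 ->
    in_box y z (w k + (c * (z ord0 k - y ord0 k)) *: evec R k).
  move=> c01 i; rewrite !mxE eqxx /=.
  have [->|ik] := eqVneq i k.
    by exists c => //; rewrite ltnn mulr1.
  rewrite mulr0 addr0; case: ifP => _.
    by exists 1; rewrite ?ler01 ?lexx// mul1r addrC subrK.
  by exists 0; rewrite ?ler01 ?lexx// mul0r addr0.
have H (k : 'I_n) : exists xi, in_box y z xi /\
    f (w k.+1) - f (w k) = 'D_(evec R k) f xi * (z ord0 k - y ord0 k).
  have [|c c01 hc] := @line_mvt n f (w k) (evec R k) (z ord0 k - y ord0 k).
    by move=> c c01; apply: df; exact: box_w.
  exists (w k + (c * (z ord0 k - y ord0 k)) *: evec R k); split; first exact: box_w.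
  by rewrite wS hc mulrC.
have [xi hxi] := choice H; exists xi => [l|]; first by have [] := hxi l.
have -> : f z - f y = f (w n) - f (w 0%N).
  by congr (f _ - f _); apply/rowP => i; rewrite mxE ?ltn_ord.
rewrite -(telescope_sumr (fun k => f (w k))) // big_mkord.
by apply: eq_bigr => k _; have [_ ->] := hxi k.
Qed.

End partial_derivatives.

Section row_norm.
Variables (R : realType) (n : nat).
Implicit Types x : 'rV[R]_n.

Lemma ler_coord_norm x k : `|x ord0 k| <= `|x|.
Proof.
rewrite [leRHS]/Num.norm/= mx_normrE.
exact: (le_bigmax _ (fun ij : 'I_1 * 'I_n => `|x ij.1 ij.2|) (ord0, k)).
Qed.

Lemma row_norm_le x r : 0 <= r -> (forall k, `|x ord0 k| <= r) -> `|x| <= r.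
Proof.
move=> r0 h; rewrite [leLHS]/Num.norm/= mx_normrE; apply/bigmax_leP; split=> //= -[i k] _ /=.
by rewrite (ord1 i).
Qed.

End row_norm.

Lemma finite_radius (R : realType) (m : nat) (P : 'I_m -> R -> Prop) :
  (forall l (a b : R), a <= b -> P l b -> P l a) ->
  (forall l, exists2 d, 0 < d & P l d) -> exists2 d, 0 < d & forall l, P l d.
Proof.
move=> Pdown h.
have {}h l : exists d, 0 < d /\ P l d by have [d] := h l; exists d.
have [d hd] := choice h; exists (\big[Num.min/1]_l d l).
  by apply: lt_bigmin => // l _; have [] := hd l.
move=> l; apply: (Pdown l _ (d l)); last by have [] := hd l.
by rewrite (bigD1 l)//= ge_min lexx.
Qed.

Section chain_rule.
Variables (R : realType) (n m : nat).
Variables (F : 'rV[R]_m -> R) (T : 'rV[R]_n -> 'rV[R]_m) (x v : 'rV[R]_n) (r : R).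
Hypothesis r0 : 0 < r.
Hypothesis dF : forall z, `|z - T x| <= r -> forall l, derivable F z (evec R l).
Hypothesis cF : forall l, {for T x, continuous ('D_(evec R l) F)}.
Hypothesis dT : forall l, derivable (fun y => T y ord0 l) x v.

(** The mean value theorem on the box between [T x] and [T (x + t *: v)] makes
    continuous partial derivatives of [F] sufficient for the chain rule. *)
Lemma derive_comp_partial : derivable (F \o T) x v /\
  'D_v (F \o T) x =
    \sum_l 'D_(evec R l) F (T x) * 'D_v (fun y => T y ord0 l) x.
Proof.
pose a l := 'D_(evec R l) F (T x); pose b l := 'D_v (fun y => T y ord0 l) x.
apply: derive_eps => e e0; rewrite -/a -/b.
pose S := 1 + \sum_l (`|b l| + 1); pose S' := 1 + \sum_l `|a l|.
have S0 : 0 < S by rewrite ltr_wpDr// sumr_ge0// => l _; rewrite addr_ge0.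
have S'0 : 0 < S' by rewrite ltr_wpDr// sumr_ge0.
have bS l : `|b l| + 1 <= S.
  by rewrite /S (bigD1 l)//= addrCA lerDl addr_ge0// sumr_ge0.
pose e1 := Num.min 1 (e / 2 / S'); pose e2 := e / 2 / S.
have e10 : 0 < e1 by rewrite lt_min ltr01/= !divr_gt0.
have e20 : 0 < e2 by rewrite !divr_gt0.
have [d1 d10 hd1] : exists2 d, 0 < d & forall l t, `|t| < d ->
    `|T (x + t *: v) ord0 l - T x ord0 l - t * b l| <= e1 * `|t|.
  apply: (@finite_radius R m (fun l d => forall t : R, `|t| < d -> _)) => [l c d cd h t tc|l].
    exact: h (lt_le_trans tc cd).
  by have [d d0 hd] := derivable_eps (@dT l) e10; exists d.
have [d2 d20 hd2] : exists2 d, 0 < d & forall l z, `|z - T x| < d ->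
    `|'D_(evec R l) F z - a l| <= e2.
  apply: (@finite_radius R m (fun l d => forall z, `|z - T x| < d -> _)) => [l c d cd h t tc|l].
    exact: h (lt_le_trans tc cd).
  by have /continuous_eps/(_ _ e20)[d d0 hd] := @cF l; exists d.
pose rho := Num.min r (d2 / 2).
have rho0 : 0 < rho by rewrite lt_min r0 divr_gt0.
exists (Num.min d1 (rho / S)); first by rewrite lt_min d10 divr_gt0.
move=> t; rewrite lt_min => /andP[td1 tS].
have D l : `|T (x + t *: v) ord0 l - T x ord0 l| <= (`|b l| + 1) * `|t|.
  have := hd1 l t td1; set u := _ - T x ord0 l => h.
  have e11 : e1 <= 1 by rewrite ge_min lexx.
  have := ler_normD (u - t * b l) (t * b l); rewrite subrK normrM => h2.
  have h3 : e1 * `|t| <= 1 * `|t| by rewrite ler_wpM2r.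
  by rewrite mulrDl; rewrite (mulrC `|t|) in h2; lra.
have Trho : `|T (x + t *: v) - T x| <= rho.
  apply: row_norm_le => [|l]; first exact: ltW.
  rewrite !mxE; apply: le_trans (D l) _; apply: le_trans (_ : S * `|t| <= _).
    by rewrite ler_wpM2r.
  by rewrite mulrC -ler_pdivlMr// ltW.
have box z : in_box (T x) (T (x + t *: v)) z -> `|z - T x| <= rho.
  move=> hz; apply: in_box_ball hz _ Trho.
  by rewrite subrr normr0 ltW.
have [z /box|xi hxi] := @box_mvt R m F (T x) (T (x + t *: v)).
  by move=> zr l; apply: dF; apply: le_trans zr _; rewrite ge_min lexx.
rewrite /= => ->; rewrite mulr_sumr -sumrB; apply: le_trans (ler_norm_sum _ _ _) _.
apply: le_trans (_ : \sum_l (e2 * ((`|b l| + 1) * `|t|) + `|a l| * (e1 * `|t|)) <= _).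
  apply: ler_sum => l _; set u := _ - T x ord0 l.
  rewrite (_ : _ - _ = ('D_(evec R l) F (xi l) - a l) * u + a l * (u - t * b l)); last first.
    by rewrite /a /b; ring.
  apply: le_trans (ler_normD _ _) _; rewrite !normrM lerD//.
    apply: ler_pM => //; last exact: D.
    apply: hd2; apply: le_lt_trans (box _ (hxi l)) _.
    by rewrite gt_min; apply/orP; right; lra.
  by rewrite ler_wpM2l//; exact: hd1.
rewrite big_split /= -mulr_sumr -!mulr_suml !mulrA -mulrDl ler_wpM2r//.
have h1 : e2 * (\sum_l (`|b l| + 1)) <= e / 2.
  rewrite /e2 mulrAC ler_pdivrMr// ler_pM2l ?divr_gt0//.
  by rewrite /S lerDr.
have h2 : (\sum_l `|a l|) * e1 <= e / 2.
  apply: le_trans (_ : (\sum_l `|a l|) * (e / 2 / S') <= _).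
    by rewrite ler_wpM2l ?sumr_ge0// ge_min lexx orbT.
  rewrite mulrC mulrAC ler_pdivrMr// ler_pM2l ?divr_gt0//.
  by rewrite /S' lerDr.
by lra.
Qed.

Lemma continuous_comp_coord : {for T x, continuous F} ->
  (forall l, {for x, continuous (fun y => T y ord0 l)}) ->
  {for x, continuous (F \o T)}.
Proof.
move=> /continuous_eps hF hT; apply/continuous_eps => e e0.
have [d d0 hd] := hF e e0; have d2 : 0 < d / 2 by rewrite divr_gt0.
have [d' d'0 hd'] : exists2 d', 0 < d' & forall l y, `|y - x| < d' ->
    `|T y ord0 l - T x ord0 l| <= d / 2.
  apply: (@finite_radius R m (fun l d' => forall y, `|y - x| < d' -> _)) => [l a b ab h t tc|l].
    exact: h (lt_le_trans tc ab).
  by have /continuous_eps/(_ _ d2)[d' d'0 hd'] := @hT l; exists d'.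
exists d' => // y yx; apply: hd; apply: (@le_lt_trans _ _ (d / 2)); last by lra.
by apply: row_norm_le => [|l]; [exact: ltW|rewrite !mxE; exact: hd'].
Qed.

End chain_rule.

Section smooth_comp.
Variables (R : realType) (n m : nat) (U : set 'rV[R]_n) (V : set 'rV[R]_m).
Hypotheses (oU : open U) (oV : open V).
Variable T : 'rV[R]_n -> 'rV[R]_m.
Hypothesis sT : forall l, smooth_on U (fun y => T y ord0 l).
Hypothesis TV : forall x, U x -> V (T x).

Lemma smooth_on_derive k (W : set 'rV[R]_k) f i : smooth_on W f ->
  smooth_on W ('D_(evec R i) f).
Proof.
move=> sf s x Wx; have := sf (rcons s i) x Wx.
by rewrite /pderiv foldr_rcons.
Qed.

(** An algebra that contains the composites and is closed under partial
    derivatives, by the chain rule; all of its elements are therefore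
    smooth. *)
Inductive comp_algebra : ('rV[R]_n -> R) -> Prop :=
| algebra_smooth f : smooth_on U f -> comp_algebra f
| algebra_comp F : smooth_on V F -> comp_algebra (F \o T)
| algebraD f g : comp_algebra f -> comp_algebra g -> comp_algebra (fun x => f x + g x)
| algebraM f g : comp_algebra f -> comp_algebra g -> comp_algebra (fun x => f x * g x)
| algebra_eq f g : (forall x, U x -> f x = g x) -> comp_algebra f -> comp_algebra g.

Lemma algebra_sum (I : Type) (s : seq I) (f : I -> 'rV[R]_n -> R) :
  (forall k, comp_algebra (f k)) -> comp_algebra (fun x => \sum_(k <- s) f k x).
Proof.
move=> h; elim: s => [|k s IH].
  apply: (@algebra_eq (fun=> 0)); first by move=> x _; rewrite big_nil.
  by apply: algebra_smooth; exact: smooth_on0.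
apply: (@algebra_eq (fun x => f k x + \sum_(j <- s) f j x)).
  by move=> x _; rewrite big_cons.
exact: algebraD.
Qed.

Lemma near_open_eq (f g : 'rV[R]_n -> R) : (forall x, U x -> f x = g x) ->
  forall x, U x -> {near x, f =1 g}.
Proof.
move=> fg x Ux; have : nbhs x U by apply: open_nbhs_nbhs.
by apply: filterS => y Uy; exact: fg.
Qed.

Lemma algebra_derive f : comp_algebra f ->
  (forall x, U x -> {for x, continuous f} /\ forall i, derivable f x (evec R i)) /\
  forall i, comp_algebra ('D_(evec R i) f).
Proof.
elim=> {f} [f sf|F sF|f g _ [hf df] _ [hg dg]|f g af [hf df] ag [hg dg]|f g fg _ [hf df]].
- split=> [x Ux|i]; last by apply: algebra_smooth; exact: smooth_on_derive.
  exact: (sf [::] x Ux).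
- have chain x i : U x -> derivable (F \o T) x (evec R i) /\
      'D_(evec R i) (F \o T) x = \sum_l 'D_(evec R l) F (T x) *
        'D_(evec R i) (fun y => T y ord0 l) x.
    move=> Ux.
    have /nbhs_ballP[r /= r0 hr] : nbhs (T x) V by apply: open_nbhs_nbhs; split=> //; exact: TV.
    apply: (@derive_comp_partial R n m F T x (evec R i) (r / 2)).
    + by rewrite divr_gt0.
    + move=> z zr l; have Vz : V z.
        by apply: hr; rewrite -ball_normE /= distrC; apply: le_lt_trans zr _; lra.
      by have [_] := sF [::] z Vz.
    + by move=> l; have [] := sF [:: l] (T x) (TV Ux).
    + by move=> l; have [_] := @sT l [::] x Ux.
  split=> [x Ux|i].
    split=> [|i]; last by have [] := chain x i Ux.
    apply: continuous_comp_coord.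
      by have [] := sF [::] (T x) (TV Ux).
    by move=> l; have [] := @sT l [::] x Ux.
  apply: (@algebra_eq (fun x => \sum_l 'D_(evec R l) F (T x) *
      'D_(evec R i) (fun y => T y ord0 l) x)).
    by move=> x Ux; have [_ ->] := chain x i Ux.
  apply: algebra_sum => l; apply: algebraM.
    by apply: (algebra_comp (F := 'D_(evec R l) F)); exact: smooth_on_derive.
  by apply: algebra_smooth; apply: smooth_on_derive.
- split=> [x Ux|i].
    have [cf ddf] := hf x Ux; have [cg ddg] := hg x Ux; split=> [|i].
      by apply: continuousD.
    by apply: derivableD.
  apply: (@algebra_eq (fun x => 'D_(evec R i) f x + 'D_(evec R i) g x)).
    move=> x Ux; have [_ ddf] := hf x Ux; have [_ ddg] := hg x Ux.
    by rewrite -deriveD.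
  exact: algebraD.
- split=> [x Ux|i].
    have [cf ddf] := hf x Ux; have [cg ddg] := hg x Ux; split=> [|i].
      by apply: continuousM.
    by apply: derivableM.
  apply: (@algebra_eq (fun x => f x * 'D_(evec R i) g x + g x * 'D_(evec R i) f x)).
    move=> x Ux; have [_ ddf] := hf x Ux; have [_ ddg] := hg x Ux.
    by rewrite [RHS](deriveM (ddf i) (ddg i)).
  by apply: algebraD; apply: algebraM.
- split=> [x Ux|i].
    have [cf ddf] := hf x Ux; have nfg := near_open_eq fg Ux; split=> [|i].
      rewrite /prop_for /continuous_at -(fg x Ux).
      exact: cvg_trans (near_eq_cvg nfg) cf.
    exact: near_eq_derivable nfg (ddf i).
  apply: (@algebra_eq ('D_(evec R i) f)) => // x Ux.
  by apply: near_eq_derive; exact: near_open_eq.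
Qed.

Lemma smooth_on_comp F : smooth_on V F -> smooth_on U (F \o T).
Proof.
move=> sF; have H s : comp_algebra (pderiv s (F \o T)).
  elim: s => [|i s IH] /=; first exact: algebra_comp.
  by have [_] := algebra_derive IH; apply.
by move=> s x Ux; have [h _] := algebra_derive (H s); exact: h.
Qed.

End smooth_comp.

Section uniform_limits.
Variable R : realType.

Variables (n : nat) (U : set 'rV[R]_n) (f : nat -> 'rV[R]_n -> R) (g : 'rV[R]_n -> R).
Hypotheses (oU : open U) (sf : forall j, smooth_on U (f j)).
Hypothesis fg : forall x, U x -> tends_to (fun j => f j x) (g x).
Hypothesis local_cauchy : forall s x, U x -> exists2 r, 0 < r & forall e, 0 < e ->
  exists K, forall i j, (K <= i)%N -> (K <= j)%N -> forall y, `|y - x| < r ->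
    `|pderiv s (f i) y - pderiv s (f j) y| <= e.

(** By the mean value theorem applied to [pderiv s (f j) - pderiv s (f K)], the
    difference quotients converge uniformly, so the limit of the derivatives is
    the derivative of the limit. *)
Lemma smooth_limit : smooth_on U g /\
  forall s x, U x -> tends_to (fun j => pderiv s (f j) x) (pderiv s g x).
Proof.
have lim s x : exists l, U x -> tends_to (fun j => pderiv s (f j) x) l.
  have [Ux|nUx] := pselect (U x); last by exists 0.
  have [r r0 hr] := local_cauchy s Ux.
  have [|l hl] := @real_complete R (fun j => pderiv s (f j) x); last by exists l.
  move=> e e0; have [K hK] := hr e e0; exists K => i j Ki Kj.
  by apply: hK => //; rewrite subrr normr0.
have [G hG] := choice (fun sx : seq 'I_n * 'rV[R]_n => lim sx.1 sx.2).
have {}hG s x : U x -> tends_to (fun j => pderiv s (f j) x) (G (s, x)) := hG (s, x).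
have unif s x : U x -> exists2 r, 0 < r & (forall y, `|y - x| < r -> U y) /\
    forall e, 0 < e -> exists K, forall i, (K <= i)%N -> forall y, `|y - x| < r ->
      `|pderiv s (f i) y - G (s, y)| <= e.
  move=> Ux; have [r r0 hr] := local_cauchy s Ux.
  have /nbhs_ballP[r' /= r'0 hr'] : nbhs x U by exact: open_nbhs_nbhs.
  have rU y : `|y - x| < Num.min r r' -> U y.
    by rewrite lt_min => /andP[_ h]; apply: hr'; rewrite -ball_normE /= distrC.
  exists (Num.min r r'); first by rewrite lt_min r0.
  split=> // e e0; have [K hK] := hr e e0; exists K => i Ki y yx.
  have := tends_to_sub (tends_to_cst (pderiv s (f i) y)) (hG s y (rU y yx)).
  move/tends_to_le => /(_ e K); apply=> j Kj.
  by apply: hK => //; move: yx; rewrite lt_min => /andP[].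
have Gder s x i : U x -> derivable (fun y => G (s, y)) x (evec R i) /\
    'D_(evec R i) (fun y => G (s, y)) x = G (i :: s, x).
  move=> Ux; apply: derive_eps => e e0; have e3 : 0 < e / 3 by rewrite divr_gt0.
  have [r r0 hr] := local_cauchy (i :: s) Ux; have [K hK] := hr _ e3.
  have [r' r'0 [r'U _]] := unif s x Ux.
  have [_ /(_ i) dK] := sf K s Ux.
  have [d d0 hd] := derivable_eps dK e3.
  exists (Num.min d (Num.min r r')); first by rewrite !lt_min d0 r0.
  move=> t; rewrite !lt_min => /andP[td /andP[tr tr']].
  have near_x c : 0 <= c <= 1 -> `|x + (c * t) *: evec R i - x| <= `|t|.
    move=> /andP[c0 c1]; rewrite addrAC subrr add0r.
    apply: row_norm_le => // k; rewrite !mxE eqxx /= !normrM.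
    have [_|_] := eqVneq k i; last by rewrite normr0 mulr0.
    by rewrite normr1 mulr1 ger0_norm// ler_piMl.
  have Uc c : 0 <= c <= 1 -> U (x + (c * t) *: evec R i).
    by move=> /near_x h; apply: r'U; exact: le_lt_trans h tr'.
  have Ut : U (x + t *: evec R i) by have := Uc 1; rewrite mul1r; apply; rewrite ler01 lexx.
  have diff j : (K <= j)%N -> `|(pderiv s (f j) (x + t *: evec R i) - pderiv s (f j) x)
      - (pderiv s (f K) (x + t *: evec R i) - pderiv s (f K) x)| <= e / 3 * `|t|.
    move=> Kj; pose h := pderiv s (f j) - pderiv s (f K).
    have dh c : 0 <= c <= 1 -> derivable h (x + (c * t) *: evec R i) (evec R i).
      move=> /Uc Uz; apply: derivableB.
        by have [_] := sf j s Uz; apply.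
      by have [_] := sf K s Uz; apply.
    have [c c01 hc] := line_mvt dh.
    rewrite (_ : _ - _ - (_ - _) = h (x + t *: evec R i) - h x); last first.
      by rewrite /h -![(_ - _) _]/(_ - _); ring.
    rewrite hc normrM mulrC ler_wpM2r//.
    have Uz := Uc c c01; have [_ /(_ i) dj] := sf j s Uz; have [_ /(_ i) dk] := sf K s Uz.
    rewrite (deriveB dj dk); apply: hK => //.
    exact: le_lt_trans (near_x c c01) tr.
  have lim1 := tends_to_sub (tends_to_sub (hG s _ Ut) (hG s _ Ux))
    (tends_to_cst (pderiv s (f K) (x + t *: evec R i) - pderiv s (f K) x)).
  have {lim1 diff}h1 := tends_to_le lim1 diff.
  have h2 : `|G (i :: s, x) - pderiv (i :: s) (f K) x| <= e / 3.
    have := tends_to_sub (hG (i :: s) x Ux) (tends_to_cst (pderiv (i :: s) (f K) x)).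
    move/tends_to_le => /(_ (e / 3) K); apply=> j Kj.
    by apply: hK => //; rewrite subrr normr0.
  have h3 := hd t td.
  have h4 : `|t * (G (i :: s, x) - pderiv (i :: s) (f K) x)| <= `|t| * (e / 3).
    by rewrite normrM ler_wpM2l.
  move: h1 h3 h4; rewrite [pderiv (i :: s) _ _]/=.
  set a := G _; set b := G _; set c := pderiv _ _ _; set c' := pderiv _ _ _.
  set q := G _; set q' := 'D_ _ _ _ => h1 h3 h4.
  rewrite (_ : a - b - t * q = (a - b - (c - c')) + (c - c' - t * q') - t * (q - q')); last by ring.
  apply: le_trans (ler_normB _ _) _; apply: le_trans (lerD (ler_normD _ _) (lexx _)) _.
  by rewrite (mulrC `|t|) in h4; lra.
have Gcont s x : U x -> {for x, continuous (fun y => G (s, y))}.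
  move=> Ux; apply/continuous_eps => e e0; have e3 : 0 < e / 3 by rewrite divr_gt0.
  have [r r0 [rU hr]] := unif s x Ux; have [K hK] := hr _ e3.
  have [cK _] := sf K s Ux; have /continuous_eps/(_ _ e3)[d d0 hd] := cK.
  exists (Num.min d r); first by rewrite lt_min d0.
  move=> y; rewrite lt_min => /andP[yd yr].
  have h1 := hK K (leqnn K) y yr.
  have h2 : `|pderiv s (f K) x - G (s, x)| <= e / 3.
    by apply: hK => //; rewrite subrr normr0.
  have h3 := hd y yd; rewrite distrC in h1.
  rewrite (_ : G (s, y) - G (s, x) = (G (s, y) - pderiv s (f K) y) +
    (pderiv s (f K) y - pderiv s (f K) x) + (pderiv s (f K) x - G (s, x))); last by ring.
  apply: le_trans (ler_normD _ _) _; apply: le_trans (lerD (ler_normD _ _) (lexx _)) _.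
  by lra.
have gG s x : U x -> pderiv s g x = G (s, x).
  elim: s x => [|i s IH] x Ux; first exact: tends_to_unique (fg Ux) (hG [::] x Ux).
  have [_ <-] := Gder s x i Ux; rewrite /=.
  by apply: near_eq_derive; apply: (near_open_eq oU _ Ux) => y Uy; exact: IH.
split=> [s x Ux|s x Ux]; last by rewrite gG//; exact: hG.
have nG : {near x, (fun y => G (s, y)) =1 pderiv s g}.
  by apply: (near_open_eq oU _ Ux) => y Uy; rewrite gG.
split=> [|i].
  rewrite /prop_for /continuous_at gG//; exact: cvg_trans (near_eq_cvg nG) (Gcont s x Ux).
by apply: near_eq_derivable nG _; have [] := Gder s x i Ux.
Qed.

End uniform_limits.

Section lipschitz.
Variables (R : realType) (n : nat).

Lemma lipschitz_ball (f : 'rV[R]_n -> R) (c : 'rV[R]_n) (r M : R) :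
  (forall x, `|x - c| <= r -> forall l, derivable f x (evec R l)) ->
  (forall x, `|x - c| <= r -> forall l, `|'D_(evec R l) f x| <= M) ->
  forall y z, `|y - c| <= r -> `|z - c| <= r ->
  `|f z - f y| <= n%:R * M * `|z - y|.
Proof.
move=> df dM y z yc zc.
have [x hx l|xi hxi ->] := @box_mvt R n f y z; first exact/df/in_box_ball/zc.
apply: le_trans (ler_norm_sum _ _ _) _.
apply: le_trans (_ : \sum_(l < n) M * `|z - y| <= _).
  apply: ler_sum => l _; rewrite normrM ler_pM//.
    by apply: dM; exact: in_box_ball (hxi l) yc zc.
  by have := ler_coord_norm (z - y) l; rewrite !mxE.
by rewrite sumr_const card_ord -mulrA mulr_natl.
Qed.

Lemma closed_ball_compact (c : 'rV[R]_n) (r : R) : 0 < r ->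
  compact [set x | `|x - c| <= r].
Proof.
move=> r0; have -> : [set x | `|x - c| <= r] = closed_ball c r.
  by rewrite closed_ballE//; apply/seteqP; split=> x; rewrite /closed_ball_ /= distrC.
apply: bounded_closed_compact; last exact: closed_ball_closed.
exists (`|c| + r); split; first exact: num_real.
move=> M hM y; rewrite closed_ballE// => /= hy.
apply: le_trans (ltW hM); rewrite -lerBlDl.
by apply: le_trans hy; rewrite distrC; exact: lerB_dist.
Qed.

Lemma finite_net (c : 'rV[R]_n) (r e : R) : 0 < r -> 0 < e ->
  exists s : seq 'rV[R]_n, (forall y, y \in s -> `|y - c| <= r) /\
    forall x, `|x - c| <= r -> exists2 y, y \in s & `|x - y| < e.
Proof.
move=> r0 e0; have := @closed_ball_compact c r r0; rewrite compact_cover.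
move=> /(_ 'rV[R]_n [set x | `|x - c| <= r] (fun y => ball y e)) [||D' D'K cov].
- by move=> y _; exact: ball_open.
- by move=> x hx; exists x => //; exact: ballxx.
exists (enum_fset D'); split=> [y yD|x /cov[y /= yD yx]].
  by have := D'K y yD; rewrite inE.
by exists y => //; rewrite -ball_normE /= distrC in yx.
Qed.

End lipschitz.

(** * The Frechet space of smooth functions on a compact manifold *)

Lemma bounded_on_compact (R : realType) (n : nat) (h : 'rV[R]_n -> R) (K : set 'rV[R]_n) :
  compact K -> (forall y, K y -> {for y, continuous h}) ->
  exists M, forall y, K y -> `|h y| <= M.
Proof.
move=> cK ch.
have /compact_bounded[M [Mr hM]] : compact (h @` K).
  apply: continuous_compact => //.
  by apply: continuous_in_subspaceT => y; rewrite inE; exact: ch.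
exists (`|M| + 1) => y Ky; apply: hM; last by exists y.
by apply: le_lt_trans (ler_norm M) _; rewrite ltrDl.
Qed.

Lemma smooth_on_eq (R : realType) (n : nat) (U : set 'rV[R]_n) (f g : 'rV[R]_n -> R) :
  open U -> (forall x, U x -> f x = g x) -> smooth_on U f -> smooth_on U g.
Proof.
move=> oU fg sf.
have eqd s : forall x, U x -> pderiv s f x = pderiv s g x.
  elim: s => [|i s IH] x Ux /=; first exact: fg.
  by apply: near_eq_derive; exact: (near_open_eq oU IH Ux).
move=> s x Ux; have [cf df] := sf s x Ux.
have nfg := near_open_eq oU (eqd s) Ux; split=> [|i].
  rewrite /prop_for /continuous_at -(eqd s x Ux).
  exact: cvg_trans (near_eq_cvg nfg) cf.
exact: near_eq_derivable nfg (df i).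
Qed.

Section jets.
Variables (R : realType) (n : nat) (X : oriented_manifold R n).
Implicit Types (i : chart X) (f g : smooth_fun X) (s : seq 'I_n).

Definition jet i s (f : X -> R[i]) (y : 'rV[R]_n) : R[i] :=
  cpderiv s (fun z => f (chart_inv i z)) y.

Lemma jet_linear i s (a : R[i]) f g y : chart_img i y ->
  jet i s (a *: f + g) y = a * jet i s f y + jet i s g y.
Proof.
move=> iy; have oi := @open_chart_img _ _ X i.
have [fr fi] := smooth_funP f i; have [gr gi] := smooth_funP g i.
rewrite /jet /cpderiv.
have -> : (fun z => complex.Re ((a *: f + g) (chart_inv i z))) = fun z =>
    1 * (complex.Re a * complex.Re (f (chart_inv i z)) +
    - complex.Im a * complex.Im (f (chart_inv i z))) +
    1 * complex.Re (g (chart_inv i z)).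
  apply/funext => z; rewrite -[(a *: f + g) _]/(a * f _ + g _).
  by case: a (f _) (g _) => [? ?] [? ?] [? ?] /=; ring.
have -> : (fun z => complex.Im ((a *: f + g) (chart_inv i z))) = fun z =>
    1 * (complex.Re a * complex.Im (f (chart_inv i z)) +
    complex.Im a * complex.Re (f (chart_inv i z))) +
    1 * complex.Im (g (chart_inv i z)).
  apply/funext => z; rewrite -[(a *: f + g) _]/(a * f _ + g _).
  by case: a (f _) (g _) => [? ?] [? ?] [? ?] /=; ring.
have lin u v w (b c : R) : smooth_on (chart_img i) u -> smooth_on (chart_img i) v ->
    smooth_on (chart_img i) w ->
    pderiv s (fun z => 1 * (b * u z + c * v z) + 1 * w z) y =
    1 * (b * pderiv s u y + c * pderiv s v y) + 1 * pderiv s w y.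
  move=> su sv sw.
  rewrite (pderiv_lincomb oi 1 1 (smooth_on_lincomb oi b c su sv) sw s iy).
  by rewrite (pderiv_lincomb oi b c su sv s iy).
rewrite (lin _ _ _ _ _ fr fi gr) (lin _ _ _ _ _ fi fr gi).
by case: a => ? ?; apply/eqP; rewrite eq_complex /=; apply/andP; split; apply/eqP; ring.
Qed.

Lemma jetZ i s (a : R[i]) f y : chart_img i y -> jet i s (a *: f) y = a * jet i s f y.
Proof.
move=> iy; have j0 : jet i s (0 : smooth_fun X) y = 0.
  have := jet_linear s 1 (0 : smooth_fun X) 0 iy.
  rewrite scaler0 addr0 mul1r => /eqP; rewrite -subr_eq0 opprD addrA subrr sub0r oppr_eq0.
  by move/eqP.
by rewrite -[a *: f]addr0 jet_linear// j0 addr0.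
Qed.

Lemma jetD i s f g y : chart_img i y -> jet i s (f + g) y = jet i s f y + jet i s g y.
Proof. by move=> iy; rewrite -[f in LHS]scale1r jet_linear// mul1r. Qed.

Lemma jetB i s f g y : chart_img i y -> jet i s (f - g) y = jet i s f y - jet i s g y.
Proof. by move=> iy; rewrite jetD// -scaleN1r jetZ// mulN1r. Qed.

Lemma jet_bounded_compact i s f (K : set 'rV[R]_n) : chart_compact i K ->
  exists M, forall y, K y -> normc (jet i s f y) <= M.
Proof.
move=> [cK Ki]; have [fr fi] := smooth_funP f i.
have [y Ky|M hM] := bounded_on_compact cK (h := pderiv s (fun z => complex.Re (f (chart_inv i z)))).
  by have [] := fr s y (Ki y Ky).
have [y Ky|M' hM'] := bounded_on_compact cK (h := pderiv s (fun z => complex.Im (f (chart_inv i z)))).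
  by have [] := fi s y (Ki y Ky).
exists (M + M') => y Ky; rewrite -lecR; apply: le_trans (norm_le_ReIm _ _) _.
by rewrite lecR lerD// ?hM ?hM'.
Qed.

(** A chart with the center and the radius of a ball in its image. *)
Definition cell : Type := (chart X * 'rV[R]_n * R)%type.

Definition good_cell (b : cell) := 0 < b.2 /\
  forall y, `|y - b.1.2| <= b.2 -> chart_img b.1.1 y.

(** The open ball is used for the norms, because limits of derivatives are
    computed on open sets; the closed ball in [good_cell] provides compactness. *)
Definition in_cell (b : cell) : set 'rV[R]_n := [set y | `|y - b.1.2| < b.2].

Lemma in_cell_center b : good_cell b -> in_cell b b.1.2.
Proof. by move=> [b0 _]; rewrite /in_cell /= subrr normr0. Qed.

Lemma in_cell_chart b y : good_cell b -> in_cell b y -> chart_img b.1.1 y.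
Proof. by move=> [_ gb] /ltW; exact: gb. Qed.

Lemma open_cell b : good_cell b -> open (in_cell b).
Proof.
move=> [b0 _]; rewrite (_ : in_cell b = ball b.1.2 b.2); first exact: ball_open.
by apply/seteqP; split=> y; rewrite -ball_normE /in_cell /= distrC.
Qed.

Lemma finite_atlas : compact [set: X] -> exists L : seq cell,
  (forall b, b \in L -> good_cell b) /\
  forall x, exists b, [/\ b \in L, chart_dom b.1.1 x & in_cell b (chart_map b.1.1 x)].
Proof.
move=> cX.
have cell_at (x : X) : exists b : cell, [/\ good_cell b, chart_dom b.1.1 x &
    b.1.2 = chart_map b.1.1 x].
  have [i ix] := chart_dom_cover x.
  have /nbhs_ballP[r /= r0 hr] : nbhs (chart_map i x) (chart_img i).
    apply: open_nbhs_nbhs; split; first exact: open_chart_img.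
    exact: chart_img_coord.
  have r2 : 0 < r / 2 by rewrite divr_gt0.
  exists (i, chart_map i x, r / 2); split=> //.
  split=> //= y yr; apply: hr; rewrite -ball_normE /= distrC.
  by apply: le_lt_trans yr _; lra.
have [b hb] := choice cell_at.
pose A x := chart_dom (b x).1.1 `&` chart_map (b x).1.1 @^-1`
  ball (chart_map (b x).1.1 x) (b x).2.
have oA x : open_nbhs x (A x).
  by have [[b0 _] bx _] := hb x; exact: chart_near_open.
have := cX; rewrite compact_cover.
move=> /(_ X setT A (fun x _ => (oA x).1)) [|D' _ cov].
  by move=> x _; exists x => //; exact: (oA x).2.
exists [seq b x | x <- enum_fset D']; split.
  by move=> _ /mapP[x _ ->]; have [] := hb x.
move=> x; have /cov[z /= zD [zx]] : [set: X] x by [].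
rewrite -ball_normE /= distrC => zr.
exists (b z); split=> //; first exact: map_f.
by have [_ _ e] := hb z; rewrite /in_cell /= e.
Qed.

End jets.

(** The lists of length at most [m]; they occur repeatedly, which only changes
    the norms below by constants. *)
Fixpoint words (n m : nat) : seq (seq 'I_n) :=
  if m is m'.+1 then words n m' ++ [seq i :: s | i <- enum 'I_n, s <- words n m']
  else [:: [::]].

Lemma nil_words n m : [::] \in words n m.
Proof. by elim: m => //= m IH; rewrite mem_cat IH. Qed.

Lemma cons_words n m (i : 'I_n) s : s \in words n m -> i :: s \in words n m.+1.
Proof.
move=> sm; rewrite /= mem_cat; apply/orP; right.
by apply/allpairsP; exists (i, s); rewrite mem_enum.
Qed.

Lemma mem_words n (s : seq 'I_n) : exists m, s \in words n m.
Proof.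
by elim: s => [|i s [m IH]]; [exists 0%N|exists m.+1; exact: cons_words].
Qed.

Section smooth_norms.
Variables (R : realType) (n : nat) (X : oriented_manifold R n).
Variable L : seq (cell X).
Hypothesis good_L : forall b, b \in L -> good_cell b.
Hypothesis L_cover : forall x : X, exists b,
  [/\ b \in L, chart_dom b.1.1 x & in_cell b (chart_map b.1.1 x)].
Implicit Types (f g : smooth_fun X) (b : cell X) (s : seq 'I_n).

Definition cell_norm b s f := sup [set normc (jet b.1.1 s f y) | y in in_cell b].

Let cell_sup b s f : good_cell b ->
  has_sup [set normc (jet b.1.1 s f y) | y in in_cell b].
Proof.
move=> gb; split; first by exists (normc (jet b.1.1 s f b.1.2)), b.1.2 => //; exact: in_cell_center.
have [b0 bi] := gb.
have [|M hM] := @jet_bounded_compact _ _ X b.1.1 s f [set y | `|y - b.1.2| <= b.2].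
  by split; [exact: closed_ball_compact|exact: bi].
by exists M => _ [y yb <-]; apply: hM; exact: ltW.
Qed.

Lemma le_cell_norm b s f y : good_cell b -> in_cell b y ->
  normc (jet b.1.1 s f y) <= cell_norm b s f.
Proof. by move=> gb yb; apply: ub_le_sup; [case: (cell_sup s f gb)|exists y]. Qed.

Lemma cell_norm_le b s f M : good_cell b ->
  (forall y, in_cell b y -> normc (jet b.1.1 s f y) <= M) -> cell_norm b s f <= M.
Proof.
move=> gb h; apply: ge_sup; first by case: (cell_sup s f gb).
by move=> _ [y yb <-]; exact: h.
Qed.

Lemma cell_norm_ge0 b s f : good_cell b -> 0 <= cell_norm b s f.
Proof.
move=> gb; apply: le_trans (le_cell_norm s f gb (in_cell_center gb)).
exact: normc_ge0.
Qed.

Lemma cell_normD b s f g : good_cell b ->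
  cell_norm b s (f + g) <= cell_norm b s f + cell_norm b s g.
Proof.
move=> gb; apply: cell_norm_le => // y yb; rewrite jetD; last exact: in_cell_chart yb.
by apply: le_trans (ler_normcD _ _) _; rewrite lerD// le_cell_norm.
Qed.

Lemma cell_normZ b s c f : good_cell b -> cell_norm b s (c *: f) = normc c * cell_norm b s f.
Proof.
move=> gb; have le c' g : cell_norm b s (c' *: g) <= normc c' * cell_norm b s g.
  apply: cell_norm_le => // y yb; rewrite jetZ; last exact: in_cell_chart yb.
  by rewrite normcM ler_wpM2l ?normc_ge0// le_cell_norm.
apply/le_anti; rewrite le /=.
have [->|c0] := eqVneq c 0; first by rewrite normc0 mul0r cell_norm_ge0.
have n0 : normc c != 0 by apply: contra c0 => /eqP /eq0_normc ->.
have := le c^-1 (c *: f); rewrite scalerA mulVf// scale1r normcV.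
by rewrite ler_pdivlMl// lt_neqAle normc_ge0 andbT eq_sym.
Qed.

Definition smooth_norm m f := \sum_(b <- L) \sum_(s <- words n m) cell_norm b s f.

Lemma seminorm_smooth_norm m : seminorm (smooth_norm m).
Proof.
split=> [f g|c f].
  rewrite /smooth_norm -big_split /= big_seq [leRHS]big_seq; apply: ler_sum => b bL.
  by rewrite -big_split /=; apply: ler_sum => s _; exact/cell_normD/good_L.
rewrite /smooth_norm mulr_sumr big_seq [RHS]big_seq; apply: eq_bigr => b bL.
by rewrite mulr_sumr; apply: eq_bigr => s _; exact/cell_normZ/good_L.
Qed.

Lemma smooth_norm_le m m' f : (m <= m')%N -> smooth_norm m f <= smooth_norm m' f.
Proof.
move=> /subnKC <-; elim: (m' - m)%N => [|d IH]; first by rewrite addn0.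
apply: le_trans IH _; rewrite addnS /smooth_norm big_seq [leRHS]big_seq.
apply: ler_sum => b bL; rewrite /= big_cat /= lerDl sumr_ge0// => s _.
exact/cell_norm_ge0/good_L.
Qed.

Lemma cell_norm_le_smooth_norm m b s f : b \in L -> s \in words n m ->
  cell_norm b s f <= smooth_norm m f.
Proof.
move=> bL sm; rewrite /smooth_norm.
apply: le_trans (_ : \sum_(t <- words n m) cell_norm b t f <= _).
  by apply: (@sum_mem_le _ _ _ (fun t => cell_norm b t f)) => // t _; exact/cell_norm_ge0/good_L.
apply: (@sum_mem_le _ _ L (fun b => \sum_(t <- words n m) cell_norm b t f)) => // b' b'L.
by rewrite sumr_ge0// => t _; exact/cell_norm_ge0/good_L.
Qed.

Lemma jet_le_smooth_norm m b s f y : b \in L -> s \in words n m -> in_cell b y ->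
  normc (jet b.1.1 s f y) <= smooth_norm m f.
Proof.
move=> bL sm yb; apply: le_trans (cell_norm_le_smooth_norm f bL sm).
by apply: le_cell_norm => //; exact: good_L.
Qed.

Lemma value_le_smooth_norm m f x : normc (f x) <= smooth_norm m f.
Proof.
have [b [bL bx xb]] := L_cover x.
have := jet_le_smooth_norm f bL (nil_words n m) xb.
by rewrite /jet /cpderiv /= chart_mapK//; case: (f x).
Qed.

Lemma smooth_norm_le_const m f M :
  (forall b s, b \in L -> s \in words n m -> cell_norm b s f <= M) ->
  smooth_norm m f <= (size L)%:R * ((size (words n m))%:R * M).
Proof.
move=> h; apply: sum_le_size => b bL; apply: sum_le_size => s sm; exact: h.
Qed.

(** In an arbitrary chart [j], the function is locally its expression in a cell
    composed with the change of charts, which is smooth. *)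
Lemma is_smooth_cells (h : X -> R[i]) :
  (forall b, b \in L ->
    smooth_on (in_cell b) (fun y => complex.Re (h (chart_inv b.1.1 y))) /\
    smooth_on (in_cell b) (fun y => complex.Im (h (chart_inv b.1.1 y)))) ->
  is_smooth h.
Proof.
move=> hb j.
suff H (p : R[i] -> R) : (forall b, b \in L ->
      smooth_on (in_cell b) (fun y => p (h (chart_inv b.1.1 y)))) ->
    smooth_on (chart_img j) (fun y => p (h (chart_inv j y))).
  by split; apply: H => b /hb[].
move=> {}hb s _ [x jx <-].
have [b [bL bx xb]] := L_cover x; set i := b.1.1 in bx xb.
pose T y := chart_map i (chart_inv j y).
pose U0 := chart_map j @` (chart_dom j `&` chart_dom i).
have U0E : U0 = [set y | chart_img j y /\ chart_dom i (chart_inv j y)].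
  apply/seteqP; split=> [_ [z [jz iz] <-]|y [[z jz <-]]] /=.
    by split; [exact: chart_img_coord|rewrite chart_mapK].
  by rewrite chart_mapK// => iz; exists z.
have invc y : chart_img j y -> {for y, continuous (@chart_inv _ _ X j)}.
  move=> jy; have := @chart_inv_continuous _ _ X j.
  by rewrite continuous_open_subspace; [apply; rewrite inE|exact: open_chart_img].
have oU0 : open U0.
  rewrite U0E openE => y [jy iy]; apply: filterI.
    by apply: open_nbhs_nbhs; split=> //; exact: open_chart_img.
  by apply: (invc y jy); apply: open_nbhs_nbhs; split=> //; exact: chart_dom_open.
have sT0 : forall l, smooth_on U0 (fun y => T y ord0 l).
  by move=> l; exact: transition_smooth.
pose U := U0 `&` T @^-1` in_cell b.
have cT y : U0 y -> {for y, continuous T}.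
  rewrite U0E => -[jy iy]; apply: continuous_comp; first exact: invc.
  exact: coord_continuous_at.
have oU : open U.
  rewrite openE => y [U0y Ty]; apply: filterI.
    by apply: open_nbhs_nbhs; split.
  by apply: (cT y U0y); apply: open_nbhs_nbhs; split=> //; apply: open_cell; exact: good_L.
have sT l : smooth_on U (fun y => T y ord0 l) by move=> t y [Uy _]; exact: sT0.
have TV y : U y -> in_cell b (T y) by move=> [].
have sc := smooth_on_comp oU (open_cell (good_L bL)) sT TV (hb b bL).
have Ux : U (chart_map j x).
  split; first by exists x.
  by rewrite /T /= chart_mapK.
apply: (smooth_on_eq oU _ sc) Ux => y; rewrite /U U0E => -[[jy iy] _] /=.
by rewrite /T chart_mapK.
Qed.

(** A Cauchy sequence converges pointwise, and in each cell all its derivatives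
    converge uniformly, so its limit is smooth in the cells. *)
Lemma smooth_norm_complete (u : nat -> smooth_fun X) :
  (forall m e, 0 < e -> exists K, forall i j, (K <= i)%N -> (K <= j)%N ->
     smooth_norm m (u i - u j) <= e) ->
  exists f, converges smooth_norm u f.
Proof.
move=> hu.
have lim x : exists l, forall e, 0 < e -> exists K, forall i, (K <= i)%N ->
    normc (u i x - l) <= e.
  apply: complex_complete => e e0.
  have [K hK] := hu 0%N e e0; exists K => i j Ki Kj.
  apply: le_trans (hK i j Ki Kj).
  exact: (value_le_smooth_norm 0 (u i - u j) x).
have [h hh] := choice lim.
have jet_cauchy b s : b \in L -> forall e, 0 < e -> exists K, forall i j,
    (K <= i)%N -> (K <= j)%N -> forall y, in_cell b y ->
    normc (jet b.1.1 s (u i) y - jet b.1.1 s (u j) y) <= e.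
  move=> bL e e0; have [m sm] := mem_words s.
  have [K hK] := hu m e e0; exists K => i j Ki Kj y yb.
  rewrite -jetB; last exact: in_cell_chart (good_L bL) yb.
  by apply: le_trans (hK i j Ki Kj); exact: jet_le_smooth_norm.
have main (p : R[i] -> R) b : (forall z w, `|p z - p w| <= normc (z - w)) ->
    (forall s (F : X -> R[i]) y, p (jet b.1.1 s F y) = pderiv s (fun z => p (F (chart_inv b.1.1 z))) y) ->
    (forall i, smooth_on (in_cell b) (fun y => p (u i (chart_inv b.1.1 y)))) -> b \in L ->
    smooth_on (in_cell b) (fun y => p (h (chart_inv b.1.1 y))) /\
    forall s y, in_cell b y -> tends_to (fun i => p (jet b.1.1 s (u i) y))
      (p (jet b.1.1 s h y)).
  move=> pl pj su bL.
  have [||sh cvgj] := smooth_limit (open_cell (good_L bL)) su (g := fun y => p (h (chart_inv b.1.1 y))).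
  - move=> y yb e e0; have [K hK] := hh (chart_inv b.1.1 y) e e0.
    by exists K => i /hK; apply: le_trans; exact: pl.
  - move=> s x xb; have /nbhs_ballP[r /= r0 hr] : nbhs x (in_cell b).
      by apply: open_nbhs_nbhs; split=> //; exact: open_cell (good_L bL).
    exists r => // e e0; have [K hK] := jet_cauchy b s bL e e0.
    exists K => i j Ki Kj y yx; rewrite -!pj.
    apply: le_trans (pl _ _) (hK i j Ki Kj y _).
    by apply: hr; rewrite -ball_normE /= distrC.
  split=> // s y yb; rewrite pj.
  by under eq_fun do rewrite pj; exact: cvgj.
have su b i : b \in L ->
    smooth_on (in_cell b) (fun y => complex.Re (u i (chart_inv b.1.1 y))) /\
    smooth_on (in_cell b) (fun y => complex.Im (u i (chart_inv b.1.1 y))).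
  move=> bL; have [fr fi] := smooth_funP (u i) b.1.1.
  by split=> s y /(in_cell_chart (good_L bL)); [exact: fr|exact: fi].
have Re_lip (z w : R[i]) : `|complex.Re z - complex.Re w| <= normc (z - w).
  by apply: le_trans (Re_le_normc (z - w)); case: z w => [? ?] [? ?].
have Im_lip (z w : R[i]) : `|complex.Im z - complex.Im w| <= normc (z - w).
  by apply: le_trans (Im_le_normc (z - w)); case: z w => [? ?] [? ?].
have hRe b (bL : b \in L) := main (@complex.Re R) b Re_lip
  (fun s F y => erefl) (fun i => (su b i bL).1) bL.
have hIm b (bL : b \in L) := main (@complex.Im R) b Im_lip
  (fun s F y => erefl) (fun i => (su b i bL).2) bL.
have sh : is_smooth h.
  by apply: is_smooth_cells => b bL; split; [exact: (hRe b bL).1|exact: (hIm b bL).1].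
exists (SmoothFun (asboolT sh : h \in @smooth_pred R n X)) => m e e0.
pose c : R := (size L)%:R * (size (words n m))%:R.
have c0 : 0 <= c by rewrite mulr_ge0.
pose M := e / (c + 1).
have M0 : 0 < M by rewrite divr_gt0// ltr_wpDl.
have [K hK] := hu m M M0; exists K => i Ki.
apply: le_trans (_ : c * M <= _); last first.
  rewrite /M mulrA ler_pdivrMr ?ltr_wpDl//.
  by rewrite mulrC ler_wpM2l ?(ltW e0)// lerDl.
rewrite /c -mulrA; apply: smooth_norm_le_const => b s bL sm.
apply: cell_norm_le; first exact: good_L.
move=> y yb; rewrite jetB; last exact: in_cell_chart (good_L bL) yb.
apply/ler_addgt0Pr => r r0; have r2 : 0 < r / 2 by rewrite divr_gt0.
have [K1 h1] := (hRe b bL).2 s y yb _ r2; have [K2 h2] := (hIm b bL).2 s y yb _ r2.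
pose j := maxn K (maxn K1 K2).
have {}h1 := h1 j (leq_trans (leq_maxl _ _) (leq_maxr _ _)).
have {}h2 := h2 j (leq_trans (leq_maxr _ _) (leq_maxr _ _)).
have h3 : normc (jet b.1.1 s (u i) y - jet b.1.1 s (u j) y) <= M.
  rewrite -jetB; last exact: in_cell_chart (good_L bL) yb.
  by apply: le_trans (hK i j Ki (leq_maxl _ _)); exact: jet_le_smooth_norm.
have h4 : normc (jet b.1.1 s (u j) y - jet b.1.1 s h y) <= r.
  rewrite -lecR; move: h1 h2.
  case: (jet _ _ _ _) (jet _ _ h _) => [a a'] [d d'] /= h1 h2.
  by apply: le_trans (norm_le_ReIm (a - d) (a' - d')) _; rewrite lecR; lra.
rewrite -(subrK (jet b.1.1 s (u j) y) (jet b.1.1 s (u i) y)) -addrA.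
by apply: le_trans (ler_normcD _ _) _; exact: lerD.
Qed.

Lemma frechet_smooth : frechet smooth_norm.
Proof.
split; [exact: seminorm_smooth_norm|exact: smooth_norm_le|exact: smooth_norm_complete].
Qed.

End smooth_norms.

(** * The topology of smooth functions and the strong dual *)

Section smooth_topology.
Variables (R : realType) (n : nat) (X : oriented_manifold R n).
Variable L : seq (cell X).
Hypothesis good_L : forall b, b \in L -> good_cell b.
Hypothesis L_cover : forall x : X, exists b,
  [/\ b \in L, chart_dom b.1.1 x & in_cell b (chart_map b.1.1 x)].
Implicit Types (b : cell X) (s : seq 'I_n) (i : chart X).

Local Notation N := (smooth_norm L).
Let FN : frechet N := frechet_smooth good_L L_cover.
Let sN m : seminorm (N m) := frechet_seminorm FN m.
Let N0 m f : 0 <= N m f := seminorm_ge0 (sN m) f.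

Lemma near_all_mem (T : eqType) (r : seq T) (f : smooth_fun X) (P : T -> set (smooth_fun X)) :
  (forall t, t \in r -> nbhs f (P t)) ->
  nbhs f [set g | forall t, t \in r -> P t g].
Proof.
have Ff : Filter (nbhs f) := nbhs_filter f.
elim: r => [|t r IH] h; first by apply: filterS filterT => g _ t.
have h1 := h t (mem_head _ _).
have h2 : nbhs f [set g | forall t, t \in r -> P t g].
  by apply: IH => t' t'r; apply: h; rewrite inE t'r orbT.
by apply: filterS (filterI h1 h2) => g [Pg Pr] t'; rewrite inE => /predU1P[->|/Pr].
Qed.

Lemma nbhs_norm_ball (f : smooth_fun X) m (e : R) : 0 < e ->
  nbhs f [set g : smooth_fun X | N m (g - f) <= e].
Proof.
move=> e0; have Ff : Filter (nbhs f) := nbhs_filter f.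
pose c : R := (size L)%:R * (size (words n m))%:R.
have c0 : 0 <= c by rewrite mulr_ge0.
pose d := e / (c + 1).
have d0 : 0 < d by rewrite divr_gt0// ltr_wpDl.
have H : nbhs f [set g : smooth_fun X | forall bs, bs \in [seq (b, s) | b <- L, s <- words n m] ->
    forall y, in_cell bs.1 y -> normc (jet bs.1.1.1 bs.2 f y - jet bs.1.1.1 bs.2 g y) <= d].
  apply: near_all_mem => bs /allpairsP[[b s] [/= bL sm ->]] /=.
  have [b0 bi] := good_L bL.
  have cK : chart_compact b.1.1 [set y | `|y - b.1.2| <= b.2].
    by split; [exact: closed_ball_compact|exact: bi].
  have d0C : 0 < d%:C :> R[i] by rewrite ltcR.
  have Eb : entourage [set ab : R[i] * R[i] | ball ab.1 d%:C ab.2].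
    exact: (entourage_ball _ (PosNum d0C)).
  have Nf := @jet_continuous _ _ X (b.1.1, s) f _ (fam_nbhs _ Eb cK).
  apply: (@filterS _ (nbhs f) (nbhs_filter f) _ _ _ Nf) => g hg y yb.
  have := hg y (ltW yb); rewrite /= -ball_normE /= normc_normr ltcR.
  exact: ltW.
apply: filterS H => g hg /=.
apply: le_trans (_ : c * d <= _); last first.
  by rewrite /d mulrA ler_pdivrMr ?ltr_wpDl// mulrC ler_wpM2l ?(ltW e0)// lerDl.
rewrite /c -mulrA; apply: smooth_norm_le_const => b s bL sm.
apply: cell_norm_le; first exact: good_L.
move=> y yb; rewrite jetB; last exact: in_cell_chart (good_L bL) yb.
rewrite normc_distC; apply: (hg (b, s)) => //.
by apply/allpairsP; exists (b, s).
Qed.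

Lemma bounded_functional_distribution (w : smooth_fun X -> R[i]) :
  bounded_functional N w -> is_distribution w.
Proof.
move=> bw; have [lw [m [c [c0 hc]]]] := bounded_functionalP FN bw.
split=> [a f g|f]; first exact: lw.
have Ff : Filter (nbhs f) := nbhs_filter f.
apply/cvgrPdist_le => -[e e'] /=; rewrite ltcE/= => /andP[/eqP ei e0]; subst e'.
have ec : 0 < e / c by rewrite divr_gt0.
apply: filterS (nbhs_norm_ball f m ec) => g /= hg.
rewrite normc_normr -[e +i* 0]/(e%:C) lecR -functionalB//; apply: le_trans (hc _) _.
by rewrite seminorm_distC// mulrC -ler_pdivlMr.
Qed.

Lemma jet_functional i s y : chart_img i y ->
  functional (fun f : smooth_fun X => jet i s f y).
Proof. by move=> iy c f g; exact: jet_linear. Qed.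

Lemma bounded_functional_quotient (w w' : smooth_fun X -> R[i]) a :
  bounded_functional N w -> bounded_functional N w' ->
  bounded_functional N (fun f => a * (w f - w' f)).
Proof.
move=> bw bw'; have [lw [m [c [c0 hc]]]] := bounded_functionalP FN bw.
have [lw' [m' [c' [c'0 hc']]]] := bounded_functionalP FN bw'.
split=> [d f g|]; first by rewrite lw lw'; ring.
exists (maxn m m'), (normc a * (c + c')) => f; rewrite normcM -mulrA.
rewrite ler_wpM2l ?normc_ge0// mulrDl; apply: le_trans (ler_normcB _ _) _.
apply: lerD; [apply: le_trans (hc f) _|apply: le_trans (hc' f) _].
  by rewrite ler_wpM2l ?(ltW c0)//; apply: (frechet_le FN); exact: leq_maxl.
by rewrite ler_wpM2l ?(ltW c'0)//; apply: (frechet_le FN); exact: leq_maxr.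
Qed.

(** The chart [i] is arbitrary, while the norms come from the chosen cells. A
    derivative is a pointwise limit of difference quotients, so the
    Banach-Steinhaus theorem bounds it by one of the norms; no formula for
    higher derivatives under changes of charts is involved. *)
Lemma jet_bounded_functional i s y : chart_img i y ->
  bounded_functional N (fun f => jet i s f y).
Proof.
elim: s y => [|k s IH] y iy.
  split; first exact: jet_functional.
  exists 0%N, 1 => f; rewrite mul1r.
  apply: le_trans (value_le_smooth_norm good_L L_cover 0 f (chart_inv i y)).
  by rewrite /jet /cpderiv /=; case: (f _).
have /nbhs_ballP[r /= r0 hr] : nbhs y (chart_img i).
  by apply: open_nbhs_nbhs; split=> //; exact: open_chart_img.
pose t (v : nat) : R := r / 2 / v.+1%:R.
have t0 v : 0 < t v by rewrite !divr_gt0.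
have ty v : chart_img i (y + t v *: evec R k).
  apply: hr; rewrite -ball_normE /= opprD addrA subrr sub0r normrN.
  apply: (@le_lt_trans _ _ (r / 2)); last by lra.
  apply: row_norm_le => [|l]; first by rewrite divr_ge0// ltW.
  rewrite !mxE eqxx /= normrM (ger0_norm (ltW (t0 v))).
  have r2 : 0 <= r / 2 by rewrite divr_ge0// ltW.
  have h : t v <= r / 2 by rewrite /t ler_pdivrMr// ler_peMr// ler1n.
  by case: eqVneq => _; rewrite ?normr1 ?normr0 ?mulr1 ?mulr0.
pose w v (f : smooth_fun X) := (t v)^-1%:C * (jet i s f (y + t v *: evec R k) - jet i s f y).
have bw v : bounded_functional N (w v).
  by apply: bounded_functional_quotient; apply: IH.
have wlim f e : 0 < e -> exists K, forall v, (K <= v)%N ->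
    normc (w v f - jet i (k :: s) f y) <= e.
  move=> e0; have e2 : 0 < e / 2 by rewrite divr_gt0.
  have [fr fi] := smooth_funP f i.
  have [_ /(_ k) dr] := fr s y iy; have [_ /(_ k) di] := fi s y iy.
  have [d1 d10 h1] := derivable_eps dr e2; have [d2 d20 h2] := derivable_eps di e2.
  have d0 : 0 < Num.min d1 d2 / 2 by rewrite divr_gt0// lt_min d10.
  have [K hK] := inverse_nat_small (r / 2) d0; exists K => v Kv.
  have tv : `|t v| < Num.min d1 d2.
    rewrite (ger0_norm (ltW (t0 v))); apply: le_lt_trans (hK v Kv) _.
    by rewrite ltr_pdivrMr// ltr_pMr// ?ltr1n// lt_min d10.
  have tv1 : `|t v| < d1 by apply: lt_le_trans tv _; rewrite ge_min lexx.
  have tv2 : `|t v| < d2 by apply: lt_le_trans tv _; rewrite ge_min lexx orbT.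
  have {}h1 := h1 _ tv1; have {}h2 := h2 _ tv2.
  rewrite /w /jet /cpderiv ![pderiv (k :: s) _ _]/=; move: h1 h2.
  set a := pderiv _ _ _; set b := pderiv _ _ _; set c := 'D_ _ _ _.
  set a' := pderiv _ _ _; set b' := pderiv _ _ _; set c' := 'D_ _ _ _ => h1 h2.
  have tn : 0 < `|t v| by rewrite normr_gt0 gt_eqF.
  have q (x z u : R) : `|x - z - t v * u| <= e / 2 * `|t v| ->
      `|(t v)^-1 * (x - z) - u| <= e / 2.
    move=> h; rewrite -(ler_pM2r tn) -normrM; apply: le_trans h.
    rewrite (_ : (_ - u) * t v = x - z - t v * u)//.
    by field; rewrite gt_eqF.
  rewrite -lecR.
  rewrite (_ : _ - _ = ((t v)^-1 * (a - b) - c) +i* ((t v)^-1 * (a' - b') - c')); last first.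
    by apply/eqP; rewrite eq_complex /=; apply/andP; split; apply/eqP; ring.
  apply: le_trans (norm_le_ReIm _ _) _; rewrite lecR [leRHS]splitr.
  by rewrite lerD// q.
split; first exact: jet_functional.
have [|||||f _|m [c H]] := @uniform_boundedness _ _ N FN (fun=> True) nat w => //.
  have [K hK] := wlim f 1 ltr01.
  apply: (@eventually_bounded _ _ K (normc (jet i (k :: s) f y) + 1)) => v /hK h.
  have := ler_normcD (w v f - jet i (k :: s) f y) (jet i (k :: s) f y).
  by rewrite subrK; lra.
exists m, c => f; apply/ler_addgt0Pr => e e0.
have [K hK] := wlim f e e0.
have := ler_normcB (w K f) (w K f - jet i (k :: s) f y); rewrite subKr.
by have := hK K (leqnn K); have := H K f I; lra.
Qed.

(** On a compact set the derivatives of each function are bounded, hence the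
    Banach-Steinhaus theorem makes the bound uniform. *)
Lemma jet_bounded_uniform i s (K : set 'rV[R]_n) : chart_compact i K ->
  exists m c, forall (f : smooth_fun X) y, K y -> normc (jet i s f y) <= c * N m f.
Proof.
move=> cK; have [_ Ki] := cK.
have [|||||f _|m [c H]] := @uniform_boundedness _ _ N FN (fun=> True) {y | K y}
  (fun y f => jet i s f (sval y)) => //.
- by move=> [y Ky] /=; apply: jet_bounded_functional; exact: Ki.
- have [M hM] := jet_bounded_compact s f cK; exists M => -[y Ky] /=; exact: hM.
by exists m, c => f y Ky; exact: (H (exist K y Ky)).
Qed.

(** Uniform convergence of all derivatives on all compact sets of all charts is
    not finer than convergence in the norms. *)
Lemma nbhs_smooth (f : smooth_fun X) (V : set (smooth_fun X)) : nbhs f V ->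
  exists m (e : R), 0 < e /\ forall g : smooth_fun X, N m (g - f) <= e -> V g.
Proof.
pose F := filter_from [set me : nat * R | 0 < me.2]
  (fun me => [set g : smooth_fun X | N me.1 (g - f) <= me.2]).
have FF : Filter F.
  apply: filter_from_filter; first by exists (0%N, 1) => /=.
  move=> [m e] [m' e'] /= e0 e'0; exists (maxn m m', Num.min e e') => /=.
    by rewrite lt_min e0.
  move=> g /=; rewrite le_min => /andP[h1 h2]; split.
    by apply: le_trans h1; apply: (frechet_le FN); exact: leq_maxl.
  by apply: le_trans h2; apply: (frechet_le FN); exact: leq_maxr.
suff H : F V -> nbhs f V -> exists m (e : R), 0 < e /\
    forall g : smooth_fun X, N m (g - f) <= e -> V g.
  move=> fV; apply: H => //; move: fV.
  suff cj : (@jets R n X) @ F --> jets f.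
    move=> [_ [[W oW <-] Wf] sub]; apply: (filterS sub).
    by apply: cj; exact: open_nbhs_nbhs.
  apply/cvg_sup => -[i s].
  move=> A [_ [[W oW <-] Wf] sub]; apply: (filterS sub).
  have fc : {family chart_compact i, (fun g : smooth_fun X => jet i s g) @ F --> jet i s f}.
    apply/fam_cvgP => K cK Q /uniform_nbhs[Z [entZ ZQ]]; apply: (filterS ZQ).
    have [m [c H]] := jet_bounded_uniform s cK.
    move: entZ; rewrite -entourage_ballE => -[[e e']] /=.
    rewrite ltcE /= => /andP[/eqP ei e0] heW; subst e'.
    pose d := e / 2 / (`|c| + 1).
    have c1 : 0 < `|c| + 1 by rewrite ltr_wpDl.
    exists (m, d); first by rewrite /= !divr_gt0.
    move=> g /= gd y Ky; apply: heW; rewrite /= -ball_normE /=.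
    rewrite normc_normr -[e +i* 0]/(e%:C) ltcR normc_distC -jetB; last by case: cK => _; apply.
    apply: le_lt_trans (H _ _ Ky) _.
    apply: (@le_lt_trans _ _ (`|c| * d)).
      apply: (@le_trans _ _ (`|c| * N m (g - f))); first by rewrite ler_wpM2r// ler_norm.
      by rewrite ler_wpM2l.
    apply: le_lt_trans (_ : (`|c| + 1) * d < _).
      by rewrite ler_wpM2r ?divr_ge0 ?(ltW e0) ?(ltW c1)// ?lerDl// divr_ge0// ltW.
    by rewrite /d mulrC divfK ?gt_eqF//; lra.
  by apply: fc; exact: open_nbhs_nbhs.
by move=> [[m e] /= e0 h] _; exists m, e; split.
Qed.

Lemma smooth_bounded_norms (B : set (smooth_fun X)) : smooth_bounded B ->
  bounded_set N B.
Proof.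
move=> bB k; have [r r0 hr] := bB _ (nbhs_norm_ball 0 k ltr01).
have rC : r%:C <= `|r%:C| :> R[i] by rewrite normc_normr lecR normc_real ler_norm.
exists r => f Bf; have [g hg <-] := hr r%:C rC f Bf.
rewrite seminormZ// normc_ge0_real ?(ltW r0)// ler_piMr ?(ltW r0)//.
by move: hg; rewrite /= subr0.
Qed.

Lemma norms_smooth_bounded (B : set (smooth_fun X)) : bounded_set N B ->
  smooth_bounded B.
Proof.
move=> bB V /nbhs_smooth[m [e [e0 hV]]]; have [M hM] := bB m.
have r0 : 0 < (`|M| + 1) / e by rewrite divr_gt0// ltr_wpDl.
exists ((`|M| + 1) / e) => // c rc f Bf.
have cr : (`|M| + 1) / e <= normc c by move: rc; rewrite normc_normr lecR.
have c0 : 0 < normc c by apply: lt_le_trans cr.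
have cn : c != 0 by apply: contraTneq c0 => ->; rewrite normc0 ltxx.
exists (c^-1 *: f); last by rewrite scalerA divff// scale1r.
apply: hV; rewrite subr0 seminormZ// normcV ler_pdivrMl//.
apply: le_trans (hM f Bf) _; apply: le_trans (_ : `|M| + 1 <= _).
  by apply: le_trans (ler_norm M) _; rewrite lerDl.
by rewrite -ler_pdivrMr.
Qed.

Lemma distribution_bounded_functional (u : schwartz_dist X) : bounded_functional N u.
Proof.
have /asboolP[lu cu] := schwartz_dist_valP u.
have fu : functional u by move=> c f g; exact: lu.
split=> //.
have u0 : u 0 = 0 := functional0 fu.
have : nbhs (0 : smooth_fun X) [set f | normc (u f) < 1].
  have F0 : Filter (nbhs (0 : smooth_fun X)) := nbhs_filter (0 : smooth_fun X).
  have /cvgrPdist_lt/(_ 1 ltr01) := cu 0.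
  rewrite u0; apply: filterS => f /=.
  by rewrite sub0r normrN normc_normr -[1 : R[i]]/(1%:C) ltcR.
move=> /nbhs_smooth[m [e [e0 he]]]; exists m, e^-1 => f.
apply/ler_addgt0Pr => d d0.
have ed : 0 < e * d by rewrite mulr_gt0.
pose r := (N m f + e * d) / e.
have r0 : 0 < r by rewrite divr_gt0// ltr_wpDl.
have /he /= : N m (r^-1%:C *: f - 0) <= e.
  rewrite subr0 seminormZ// normc_ge0_real ?invr_ge0 ?(ltW r0)// ler_pdivrMl//.
  by rewrite /r divfK ?gt_eqF// lerDl ltW.
rewrite functionalZ// normcM normc_ge0_real ?invr_ge0 ?(ltW r0)// ltr_pdivrMl// mulr1 => /ltW.
by rewrite /r mulrDl [e * d]mulrC mulfK ?gt_eqF// [N m f * _]mulrC.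
Qed.

End smooth_topology.

Section smooth_duality.
Variables (R : realType) (n : nat) (X : oriented_manifold R n).
Variable L : seq (cell X).
Hypothesis good_L : forall b, b \in L -> good_cell b.
Hypothesis L_cover : forall x : X, exists b,
  [/\ b \in L, chart_dom b.1.1 x & in_cell b (chart_map b.1.1 x)].
Implicit Types (b : cell X) (s : seq 'I_n) (i : chart X).

Local Notation N := (smooth_norm L).
Let FN : frechet N := frechet_smooth good_L L_cover.
Let sN m : seminorm (N m) := frechet_seminorm FN m.
Let N0 m f : 0 <= N m f := seminorm_ge0 (sN m) f.

Lemma distribution_of_functional (w : smooth_fun X -> R[i]) :
  bounded_functional N w -> exists u : schwartz_dist X, u =1 w.
Proof.
move=> bw; have dw := bounded_functional_distribution good_L L_cover bw.
by exists (SchwartzDist (asboolT dw : w \in @schwartz_dist_pred R n X)).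
Qed.

Lemma jet_lipschitz m b s (f : smooth_fun X) y z : b \in L -> s \in words n m ->
  in_cell b y -> in_cell b z ->
  normc (jet b.1.1 s f z - jet b.1.1 s f y) <= 2 * n%:R * N m.+1 f * `|z - y|.
Proof.
move=> bL sm yb zb; have gb := good_L bL.
have [fr fi] := smooth_funP f b.1.1.
pose r := Num.max `|y - b.1.2| `|z - b.1.2|.
have inr x : `|x - b.1.2| <= r -> in_cell b x.
  by move=> /le_lt_trans; apply; rewrite /r gt_max; apply/andP.
have yr : `|y - b.1.2| <= r by rewrite le_max lexx.
have zr : `|z - b.1.2| <= r by rewrite le_max lexx orbT.
have jb x l : `|x - b.1.2| <= r -> normc (jet b.1.1 (l :: s) f x) <= N m.+1 f.
  by move=> xr; apply: jet_le_smooth_norm => //; [exact: cons_words|exact: inr].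
have h1 : `|complex.Re (jet b.1.1 s f z) - complex.Re (jet b.1.1 s f y)| <=
    n%:R * N m.+1 f * `|z - y|.
  apply: (lipschitz_ball (c := b.1.2) (r := r)) => // x xr l.
    by have [_] := fr s x (in_cell_chart gb (inr x xr)).
  by apply: le_trans (jb x l xr); exact: (Re_le_normc (jet b.1.1 (l :: s) f x)).
have h2 : `|complex.Im (jet b.1.1 s f z) - complex.Im (jet b.1.1 s f y)| <=
    n%:R * N m.+1 f * `|z - y|.
  apply: (lipschitz_ball (c := b.1.2) (r := r)) => // x xr l.
    by have [_] := fi s x (in_cell_chart gb (inr x xr)).
  by apply: le_trans (jb x l xr); exact: (Im_le_normc (jet b.1.1 (l :: s) f x)).
rewrite -lecR; move: h1 h2; case: (jet _ _ _ z) (jet _ _ _ y) => [a a'] [d d'] /= h1 h2.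
apply: le_trans (norm_le_ReIm (a - d) (a' - d')) _; rewrite lecR; lra.
Qed.

(** The functionals are the values of the derivative at a finite net of the
    cell; a bound for derivatives of higher order controls it between them. *)
Lemma cell_compact_inclusion m b s (e : R) : b \in L -> s \in words n m -> 0 < e ->
  exists2 us : seq (schwartz_dist X),
    forall u, u \in us -> forall f, normc (u f) <= N m f &
    forall f, cell_norm b s f <= e * N m.+1 f + \sum_(u <- us) normc (u f).
Proof.
move=> bL sm e0; have gb := good_L bL; have [b0 _] := gb.
pose d := e / (2 * n%:R + 1).
have n1 : 0 < 2 * n%:R + 1 :> R by rewrite ltr_wpDl// mulr_ge0.
have d0 : 0 < d by rewrite divr_gt0.
have d2 : 0 < d / 2 by rewrite divr_gt0.
have [ys [_ hys]] := finite_net b.1.2 b0 d2.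
(* The net approximates the closed ball; its points are moved into the cell. *)
have near_pt y : exists y', (exists z, in_cell b z /\ `|z - y| < d / 2) ->
    in_cell b y' /\ `|y' - y| < d / 2.
  have [[z hz]|h] := pselect (exists z, in_cell b z /\ `|z - y| < d / 2).
    by exists z.
  by exists 0.
have [p hp] := choice near_pt.
have udelta y : exists u : schwartz_dist X, in_cell b y -> forall f, u f = jet b.1.1 s f y.
  have [yb|nyb] := pselect (in_cell b y); last by exists 0.
  have [|u hu] := @distribution_of_functional (fun f => jet b.1.1 s f y).
    by apply: (jet_bounded_functional good_L L_cover); exact: in_cell_chart yb.
  by exists u.
have [u hu] := choice udelta.
pose Y := [seq y <- map p ys | `[< in_cell b y >]].
exists (map u Y).
  move=> v /mapP[y]; rewrite mem_filter => /andP[/asboolP yb _] -> f.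
  by rewrite hu//; exact: jet_le_smooth_norm.
move=> f; apply: cell_norm_le => // x xb.
have [y yys xy] := hys x (ltW xb).
have [|pyb pyy] := hp y; first by exists x.
have pyY : p y \in Y by rewrite mem_filter map_f// andbT; exact/asboolP.
have xpy : `|x - p y| <= d.
  have := ler_normD (x - y) (y - p y); rewrite addrA subrK => h.
  by rewrite distrC in pyy; lra.
have h1 : normc (jet b.1.1 s f x - jet b.1.1 s f (p y)) <= e * N m.+1 f.
  apply: le_trans (jet_lipschitz f bL sm pyb xb) _.
  apply: le_trans (_ : 2 * n%:R * N m.+1 f * d <= _).
    by rewrite ler_wpM2l// !mulr_ge0.
  rewrite mulrAC ler_wpM2r// /d mulrA ler_pdivrMr// mulrC ler_wpM2l ?(ltW e0)//.
  by rewrite lerDl.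
have h2 : normc (jet b.1.1 s f (p y)) <= \sum_(v <- map u Y) normc (v f).
  rewrite -hu//; apply: (@sum_mem_le _ _ _ (fun v : schwartz_dist X => normc (v f))).
    by move=> v _; exact: normc_ge0.
  exact: map_f.
have := ler_normcD (jet b.1.1 s f x - jet b.1.1 s f (p y)) (jet b.1.1 s f (p y)).
by rewrite subrK; lra.
Qed.

Lemma smooth_schwartz_duality :
  schwartz_duality N (fun (u : schwartz_dist X) f => u f).
Proof.
split=> //.
- exact: (distribution_bounded_functional good_L L_cover).
- exact: distribution_of_functional.
- by move=> u v uv; apply: val_inj; apply/funext.
move=> m; exists m.+1 => e e0.
pose c : R := (size L)%:R * (size (words n m))%:R.
have c1 : 0 < c + 1 by rewrite ltr_wpDl// mulr_ge0.
have d0 : 0 < e / (c + 1) by rewrite divr_gt0.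
have H (bs : cell X * seq 'I_n) : exists us : seq (schwartz_dist X),
    bs.1 \in L -> bs.2 \in words n m ->
    (forall u, u \in us -> forall f, normc (u f) <= N m f) /\
    forall f, cell_norm bs.1 bs.2 f <=
      e / (c + 1) * N m.+1 f + \sum_(u <- us) normc (u f).
  have [[bL sm]|h] := pselect (bs.1 \in L /\ bs.2 \in words n m).
    by have [us h1 h2] := cell_compact_inclusion bL sm d0; exists us.
  by exists [::] => bL sm; case: h.
have [us hus] := choice H.
exists (flatten [seq us (b, s) | b <- L, s <- words n m]).
  move=> u /flattenP[_ /allpairsP[[b s] [/= bL sm ->]]] uus.
  by have [/(_ u uus)] := hus (b, s) bL sm.
move=> f.
have -> : \sum_(u <- flatten [seq us (b, s) | b <- L, s <- words n m]) normc (u f) =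
    \sum_(b <- L) \sum_(s <- words n m) \sum_(u <- us (b, s)) normc (u f).
  by rewrite big_flatten big_allpairs_dep.
apply: le_trans (_ : \sum_(b <- L) \sum_(s <- words n m)
    (e / (c + 1) * N m.+1 f + \sum_(u <- us (b, s)) normc (u f)) <= _).
  rewrite [leLHS]/smooth_norm big_seq [leRHS]big_seq; apply: ler_sum => b bL.
  rewrite big_seq [leRHS]big_seq; apply: ler_sum => s sm.
  by have [_] := hus (b, s) bL sm; apply.
under eq_bigr do rewrite big_split /=.
rewrite big_split /= lerD2r.
apply: le_trans (_ : (size L)%:R * ((size (words n m))%:R * (e / (c + 1) * N m.+1 f)) <= _).
  by apply: sum_le_size => b _; exact: sum_le_size.
rewrite !mulrA -/c ler_wpM2r// ler_pdivrMr// mulrC ler_wpM2l ?(ltW e0)//.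
by rewrite lerDl.
Qed.

Lemma nbhs_strong_dual (V : set (schwartz_dist X)) : nbhs (0 : schwartz_dist X) V ->
  exists (B : set (smooth_fun X)) (e : R), [/\ smooth_bounded B, 0 < e &
    forall u : schwartz_dist X, (forall f, B f -> normc (u f) <= e) -> V u].
Proof.
pose F := filter_from [set Be : set (smooth_fun X) * R | smooth_bounded Be.1 /\ 0 < Be.2]
  (fun Be => [set u : schwartz_dist X | forall f, Be.1 f -> normc (u f) <= Be.2]).
have FF : Filter F.
  apply: filter_from_filter.
    exists (set0, 1); split=> //= W _; exists 1 => // c _ f [].
  move=> [B e] [B' e'] /= [bB e0] [bB' e'0]; exists (B `|` B', Num.min e e').
    split=> /=; last by rewrite lt_min e0.
    apply: (norms_smooth_bounded good_L L_cover) => k.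
    have [M hM] := smooth_bounded_norms good_L L_cover bB k.
    have [M' hM'] := smooth_bounded_norms good_L L_cover bB' k.
    exists (Num.max M M') => f [/hM|/hM'] h; apply: le_trans h _; rewrite le_max lexx ?orbT//.
  move=> u /= hu; split=> f Bf.
    by have := hu f (or_introl Bf); rewrite le_min => /andP[].
  by have := hu f (or_intror Bf); rewrite le_min => /andP[].
suff cj : (@to_strong R n X) @ F --> to_strong 0.
  move=> [_ [[W oW <-] Wf] sub].
  have : F V by apply: (filterS sub); apply: cj; exact: open_nbhs_nbhs.
  by move=> [[B e] [/= bB e0] h]; exists B, e; split.
apply/fam_cvgP => B bB Q /uniform_nbhs[Z [entZ ZQ]]; apply: (filterS ZQ).
move: entZ; rewrite -entourage_ballE => -[[e e']] /=.
rewrite ltcE /= => /andP[/eqP ei e0] heZ; subst e'.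
exists (B, e / 2); first by split=> //=; rewrite divr_gt0.
move=> u /= hu f Bf; apply: heZ; rewrite /= -ball_normE /=.
rewrite normc_normr -[e +i* 0]/(e%:C) ltcR.
rewrite (_ : _ - _ = 0 - u f :> R[i])// sub0r normc_opp.
by apply: le_lt_trans (hu f Bf) _; lra.
Qed.

Lemma nbhs_evaluation (u : schwartz_dist X) (f : smooth_fun X) (e : R) : 0 < e ->
  nbhs u [set v : schwartz_dist X | normc (u f - v f) < e].
Proof.
move=> e0.
have bf : smooth_bounded [set f].
  by apply: (norms_smooth_bounded good_L L_cover) => k; exists (N k f) => _ ->.
have e0C : 0 < e%:C :> R[i] by rewrite ltcR.
have Eb : entourage [set ab : R[i] * R[i] | ball ab.1 e%:C ab.2].
  exact: (entourage_ball _ (PosNum e0C)).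
have cs : {for u, continuous (@to_strong R n X)} by exact: initial_continuous.
have Nf := cs _ (@fam_nbhs _ _ _ _ _ (to_strong u) Eb bf).
apply: (@filterS _ (nbhs u) (nbhs_filter u) _ _ _ Nf) => v hv.
by have := hv f erefl; rewrite /= -ball_normE /= normc_normr ltcR.
Qed.

End smooth_duality.

(** * The pairing of smooth functions is nondegenerate *)

(** The determinant does not vanish on the segment from [A] to the identity,
    whose points are positive definite, and it is 1 at the identity. *)
Lemma posdef_det_gt0 (R : realType) (n : nat) (A : 'M[R]_n) :
  (forall v : 'rV[R]_n, v != 0 -> 0 < (v *m A *m v^T) ord0 ord0) -> 0 < \det A.
Proof.
move=> Apos; rewrite ltNge; apply/negP => detA.
pose B (t : R) : 'M[R]_n := t *: 1%:M + (1 - t) *: A.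
have cB : continuous (fun t => \det (B t)).
  move=> t; apply: det_continuous_at => k l.
  rewrite (_ : (fun z => _) = fun z : R => z * (1%:M : 'M[R]_n) k l + (1 - z) * A k l); last first.
    by apply/funext => z; rewrite !mxE.
  rewrite /prop_for /continuous_at; apply: cvgD; apply: cvgM => //; try exact: cvg_cst.
  by apply: cvgB => //; exact: cvg_cst.
have [||c] := @IVT R (fun t => \det (B t)) 0 1 0 ler01.
- exact: continuous_subspaceT.
- rewrite /B scale0r add0r subr0 scale1r subrr scale0r addr0 scale1r det1.
  by rewrite ge_min detA /= le_max ler01 orbT.
rewrite in_itv /= => /andP[c0 c1] /eqP /det0P[v v0 vB].
have : (v *m B c *m v^T) ord0 ord0 = 0 by rewrite vB mul0mx mxE.
rewrite /B mulmxDr mulmxDl mxE -!scalemxAr mulmx1 -!scalemxAl !mxE => h.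
have v2 : 0 < (v *m v^T) ord0 ord0.
  rewrite lt_neqAle; apply/andP; split; last first.
    by rewrite mxE sumr_ge0// => k _; rewrite mxE -expr2 sqr_ge0.
  apply: contra v0 => /eqP /esym; rewrite mxE => /eqP.
  rewrite psumr_eq0 => [/allP hk|k _]; last by rewrite mxE -expr2 sqr_ge0.
  apply/eqP/rowP => k; have := hk k (mem_index_enum k).
  by rewrite mxE mulf_eq0 orbb => /eqP ->; rewrite mxE.
have := Apos v v0; rewrite !mxE in h v2 *.
set a := \sum_j _ in h v2; set b := \sum_j _ in h *.
move=> b0; have ca : 0 <= c * a by rewrite mulr_ge0// ltW.
have cb : 0 <= (1 - c) * b by rewrite mulr_ge0 ?subr_ge0// ltW.
have [c12|c12] := leP (1 / 2) c.
  have : 0 < c * a by rewrite mulr_gt0//; lra.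
  by lra.
have : 0 < (1 - c) * b by rewrite mulr_gt0//; lra.
by lra.
Qed.

Lemma integral_rV_box_gt0 (R : realType) n (p : 'rV[R]_n) (r C : R) : 0 < r -> 0 < C ->
  (0 < integral_rV (fun y => if `[< forall k, (`|y ord0 k - p ord0 k| <= r)%R >]
    then C%:E else 0))%E.
Proof.
move=> r0 C0; elim: n p => [|n IH] p /=.
  rewrite asboolT; first by rewrite lte_fin. by case.
pose q : 'rV[R]_n := rsubmx (p : 'M[R]_(1, 1 + n)).
pose V := integral_rV (fun y : 'rV[R]_n =>
  if `[< forall k, `|y ord0 k - q ord0 k| <= r >]
  then C%:E else 0%E).
have V0 : (0 < V)%E by exact: IH.
have Vfin : V \is a fin_num.
  by rewrite ge0_fin_numE ?(ltW V0)//; exact: integral_rV_box (ltW C0).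
pose a := p ord0 ord0.
apply: (@lt_le_trans _ _ (\int[@lebesgue_measure R]_(t in `[(a - r)%R, (a + r)%R]) V)%E).
  rewrite -(fineK Vfin) integral_cst//.
  have /= -> := lebesgue_measure_itv `[a - r, a + r].
  rewrite lte_fin ifT; last by lra.
  rewrite -EFinB -EFinM lte_fin mulr_gt0//; last by lra.
  by rewrite fine_gt0// V0/= -ge0_fin_numE ?(ltW V0).
rewrite [leLHS]integral_mkcond; apply: nnintegral_le => t.
  by rewrite patchE; case: ifP => // _; exact: ltW.
rewrite patchE; case: ifPn => [|_]; last by apply: integral_rV_ge0 => y; case: ifP => // _; rewrite lee_fin ltW.
rewrite inE /= in_itv /= => at_.
apply: integral_rV_le => y; first by case: ifP => // _; rewrite lee_fin ltW.
case: asboolP => [h|_]; last by case: ifP => // _; rewrite lee_fin ltW.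
rewrite asboolT// => k.
case: (split_ordP (k : 'I_(1 + n))) => l ->.
  rewrite (ord1 l) (@row_mxEl _ 1 1 n t%:M y ord0 ord0) mxE eqxx mulr1n.
  rewrite (_ : @lshift 1 n ord0 = ord0 :> 'I_(1 + n)) -/a; last exact: val_inj.
  by rewrite ler_norml; lra.
rewrite (@row_mxEr _ 1 1 n t%:M y ord0 l).
by have := h l; rewrite /q mxE.
Qed.

Section pairing_theory.
Variables (R : realType) (n : nat) (X : compact_riemannian R n).
Implicit Types f g : smooth_fun X.

(** In a chart, the density of the volume is continuous and positive, hence it
    is bounded below by a positive constant on a small box. *)
Lemma vol_open_gt0 (x : X) (A : set X) : open_nbhs x A -> (0 < vol X A)%E.
Proof.
move=> [oA Ax]; have [i ix] := @chart_dom_cover _ _ X x.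
set p := chart_map i x; have ip : chart_img i p := chart_img_coord ix.
pose h y := Num.sqrt (\det (cr_metric X i y)).
have hp : 0 < h p.
  by rewrite sqrtr_gt0; apply: posdef_det_gt0 => v v0; exact: metric_pos.
have ch : {for p, continuous h}.
  apply: (@continuous_comp _ _ _ (fun y => \det (cr_metric X i y)) Num.sqrt).
    apply: det_continuous_at => k l.
    by have [] := @metric_smooth _ _ _ (cr_metric X) i k l [::] p ip.
  exact: sqrt_continuous.
have cinv : {for p, continuous (@chart_inv _ _ X i)}.
  have := @chart_inv_continuous _ _ X i.
  by rewrite continuous_open_subspace; [apply; rewrite inE|exact: open_chart_img].
have : nbhs p [set y | [/\ chart_img i y, A (chart_inv i y) & h p / 2 < h y]].
  have n1 : nbhs p (chart_img i) by apply: open_nbhs_nbhs; split=> //; exact: open_chart_img.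
  have n2 : nbhs p [set y | A (chart_inv i y)].
    by apply: cinv; apply: open_nbhs_nbhs; split=> //; rewrite chart_mapK.
  have n3 : nbhs p [set y | h p / 2 < h y].
    have Fp : Filter (nbhs p) := nbhs_filter p.
    by apply: (@cvgr_gt _ _ (nbhs p) Fp h (h p)); [exact: ch|lra].
  by apply: filterS (filterI n1 (filterI n2 n3)) => y [? []].
move=> /nbhs_ballP[r /= r0 rp].
pose A' := A `&` chart_dom i.
have oA' : open A' by apply: openI => //; exact: chart_dom_open.
apply: (@lt_le_trans _ _ (vol X A')); last first.
  by apply: le_measure; rewrite ?inE; try exact: open_measurable_borel; exact: subIsetl.
rewrite (@vol_riemannian _ _ X i); [|exact: open_measurable_borel|exact: subIsetr].
have r2 : 0 < r / 2 by rewrite divr_gt0.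
have hp2 : 0 < h p / 2 by rewrite divr_gt0.
apply: lt_le_trans (integral_rV_box_gt0 p r2 hp2) _.
apply: integral_rV_le => y; first by case: ifP => // _; rewrite lee_fin ltW.
case: asboolP => [hy|_]; last by case: ifP => // _; rewrite lee_fin sqrtr_ge0.
have /rp[[z iz zy] Ay hhy] : ball p r y.
  rewrite -ball_normE /= distrC; apply: (@le_lt_trans _ _ (r / 2)); last by lra.
  by apply: row_norm_le => [|k]; [exact: ltW|rewrite !mxE; exact: hy].
rewrite ifT; first by rewrite lee_fin ltW.
rewrite inE; exists z => //; split=> //.
by move: Ay; rewrite -zy chart_mapK.
Qed.

Lemma conj_smooth f : exists g : smooth_fun X, forall x, g x = (f x)^*%C.
Proof.
have sc : is_smooth (fun x : X => (f x)^*%C).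
  move=> i; have [fr fi] := smooth_funP f i; have oi := @open_chart_img _ _ X i.
  split.
    move: fr; congr smooth_on; apply/funext => y; by case: (f _).
  have := smooth_on_lincomb oi (-1) 0 fi fi; congr smooth_on.
  by apply/funext => y; case: (f _) => a b /=; rewrite mulN1r mul0r addr0.
by exists (SmoothFun (asboolT sc : _ \in @smooth_pred R n X)).
Qed.

Lemma pairingC f g : pairing f g = pairing g f.
Proof. by rewrite /pairing; congr cintegral; apply/funext => x; rewrite mulrC. Qed.

(** Pairing [f] with its conjugate integrates the square of its modulus. *)
Lemma pairing_eq0 f : (forall g, pairing f g = 0) -> f = 0.
Proof.
move=> hf; have [g hg] := conj_smooth f.
pose h x := complex.Re (f x * g x).
have hE x : h x = complex.Re (f x) ^+ 2 + complex.Im (f x) ^+ 2.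
  by rewrite /h hg; case: (f x) => a b /=; ring.
have h0 x : 0 <= h x by rewrite hE addr_ge0// sqr_ge0.
have ch : continuous h := @smooth_mul_Re_continuous _ _ X f g.
have Ih := continuous_vol_integrable ch.
have int0 : (\int[vol X]_x (h x)%:E = 0)%E.
  have := congr1 (@complex.Re R) (hf g); rewrite /pairing /cintegral /= -/h => h1.
  have fin : (\int[vol X]_x (h x)%:E)%E \is a fin_num by exact: integrable_fin_num.
  by rewrite -(fineK fin) -[X in (X%:E)%E]/(\int[vol X]_x h x) h1.
have {}h0x x : h x = 0.
  apply/eqP; rewrite eq_le h0 andbT leNgt; apply/negP => hx.
  pose c := h x / 2; have c0 : 0 < c by rewrite divr_gt0.
  pose A := [set y | c < h y].
  have oA : open_nbhs x A.
    split; last by rewrite /A /= /c; lra.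
    exact: (open_comp (fun y _ => ch y) (@open_gt R c)).
  have mA : measurable (A : set (borel_type X)) by apply: open_measurable_borel; case: oA.
  have vA := vol_open_gt0 oA.
  have : (0 < c%:E * vol X A)%E by rewrite mule_gt0.
  rewrite -(integral_cst (vol X) mA) => /lt_le_trans h1.
  have : (\int[vol X]_(y in A) cst c%:E y <= \int[vol X]_(y in A) (h y)%:E)%E.
    apply: ge0_le_integral => //.
    - by move=> y _; rewrite lee_fin ltW.
    - have mh := measurable_int _ Ih.
      by apply: (measurable_funS _ _ mh); [exact: measurableT|exact: subsetT].
    - by move=> y Ay; rewrite lee_fin ltW.
  move=> /h1 h2; have : (0 < \int[vol X]_y (h y)%:E)%E.
    apply: lt_le_trans h2 _; apply: ge0_subset_integral => //.
    - exact: measurable_int Ih.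
    - by move=> y _; rewrite lee_fin.
  by rewrite int0 ltxx.
apply: val_inj; apply/funext => x; have := h0x x; rewrite hE.
move=> /eqP; rewrite paddr_eq0 ?sqr_ge0// !sqrf_eq0 => /andP[/eqP re /eqP im].
by rewrite -[RHS]/(0 : R[i]) -[LHS]/(f x) (complexE (f x)) re im mulr0 addr0.
Qed.

Lemma pairing_bound f : exists c, forall g M, (forall x, normc (g x) <= M) ->
  normc (pairing f g) <= c * M.
Proof.
have [Mr Mr0 hr] := continuous_norm_bounded (@smooth_Re_continuous _ _ X f).
have [Mi Mi0 hi] := continuous_norm_bounded (@smooth_Im_continuous _ _ X f).
pose V := fine (vol X [set: X]).
have fM x : normc (f x) <= Mr + Mi.
  have := hr x; have := hi x; case: (f x) => a b /= h1 h2.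
  by rewrite -lecR; apply: le_trans (norm_le_ReIm _ _) _; rewrite lecR; lra.
exists (2 * (Mr + Mi) * V) => g M gM.
have M0 x : normc (f x * g x) <= (Mr + Mi) * M.
  by rewrite normcM ler_pM// ?normc_ge0.
have h1 : `|\int[vol X]_x complex.Re (f x * g x)| <= (Mr + Mi) * M * V.
  apply: normr_Rintegral_bound; first exact: smooth_mul_Re_continuous.
  by move=> x; apply: le_trans (M0 x); exact: Re_le_normc.
have h2 : `|\int[vol X]_x complex.Im (f x * g x)| <= (Mr + Mi) * M * V.
  apply: normr_Rintegral_bound; first exact: smooth_mul_Im_continuous.
  by move=> x; apply: le_trans (M0 x); exact: Im_le_normc.
rewrite -lecR; apply: le_trans (norm_le_ReIm _ _) _; rewrite lecR; lra.
Qed.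

End pairing_theory.

(** * Operators on distributions *)

Section operator.
Variables (R : realType) (n : nat) (X : compact_riemannian R n).
Implicit Types (f g : smooth_fun X) (u : schwartz_dist X).

Lemma dist_ofC f g : dist_of f g = dist_of g f.
Proof. exact: pairingC. Qed.

Lemma dist_of_nondegenerate f : (forall g, dist_of f g = 0) -> f = 0.
Proof. exact: pairing_eq0. Qed.

Lemma dist_of_eq0 f : dist_of f = 0 -> f = 0.
Proof.
by move=> f0; apply: dist_of_nondegenerate => g; rewrite f0.
Qed.

Lemma dist_of_inj : injective (@dist_of R n X).
Proof.
move=> f g fg; apply/eqP; rewrite -subr_eq0; apply/eqP/pairing_eq0 => h.
have e : pairing h f = pairing h g.
  by rewrite !(pairingC h) -[pairing f h]/(dist_of f h) fg.
by rewrite pairingC -scaleN1r addrC pairing_linear -[_ *: _]/(-1 * _) mulN1r e addNr.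
Qed.

Lemma dist_ext (u v : schwartz_dist X) : u =1 v -> u = v.
Proof. by move=> uv; apply: val_inj; exact/funext. Qed.

Variable P : {linear schwartz_dist X -> schwartz_dist X}.
Hypothesis P_smooth : preserves_smooth P.

Lemma smooth_restrE f : P (dist_of f) = dist_of (smooth_restr P f).
Proof. exact: (xgetPex 0 (P_smooth f)). Qed.

Variable L : seq (cell X).
Hypothesis good_L : forall b, b \in L -> good_cell b.
Hypothesis L_cover : forall x : X, exists b,
  [/\ b \in L, chart_dom b.1.1 x & in_cell b (chart_map b.1.1 x)].

Let DE := smooth_schwartz_duality good_L L_cover.
Let FN := frechet_smooth good_L L_cover.
Let sN m : seminorm (smooth_norm L m) := frechet_seminorm FN m.

Lemma dist_of_bound f : exists c, forall g,
  normc (dist_of f g) <= c * smooth_norm L 0 g.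
Proof.
have [c hc] := pairing_bound f; exists c => g; apply: hc => x.
exact: value_le_smooth_norm.
Qed.

(** The functional [u |-> P u g] is continuous for the strong topology, so it is
    the evaluation at a smooth function by reflexivity. *)
Lemma exists_smooth_transpose : continuous P -> exists q : smooth_fun X -> smooth_fun X,
  forall u g, P u g = u (q g).
Proof.
move=> P_cont.
suff H g : exists h, forall u, P u g = u h.
  by have [q hq] := choice H; exists q => u g.
have P0 : P 0 = 0 by exact: linear0.
have V0 : nbhs (0 : schwartz_dist X)
    (P @^-1` [set v : schwartz_dist X | normc ((0 : schwartz_dist X) g - v g) < 1]).
  by apply: P_cont; rewrite P0; exact: (nbhs_evaluation good_L L_cover).
have [B [e [bB e0 hB]]] := nbhs_strong_dual good_L L_cover V0.
have eC : e%:C != 0.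
  by apply/eqP => /(congr1 (@complex.Re R)) /= e1; move: e0; rewrite e1 ltxx.
pose B' := [set f : smooth_fun X | B (e%:C *: f)].
have bB' : bounded_set (smooth_norm L) B'.
  move=> k; have [M hM] := smooth_bounded_norms good_L L_cover bB k.
  exists (e^-1 * M) => f /hM; rewrite seminormZ// normc_ge0_real ?(ltW e0)//.
  by rewrite ler_pdivlMl.
have lphi : functional (fun u => P u g) by move=> c u v; rewrite linearP.
apply: (reflexivity DE lphi bB') => u hu.
have lu : functional u := (ev_bounded DE u).1.
have : normc ((0 : schwartz_dist X) g - P u g) < 1.
  apply: hB => f Bf; have := hu (e%:C^-1 *: f).
  rewrite /B' /= scalerA divff// scale1r => /(_ Bf).
  rewrite functionalZ// normcM normcV normc_ge0_real ?(ltW e0)//.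
  by rewrite ler_pdivrMl// mulr1.
by rewrite -[(0 : schwartz_dist X) g]/(0 : R[i]) sub0r normc_opp => /ltW.
Qed.

Variable q : smooth_fun X -> smooth_fun X.
Hypothesis Pq : forall u g, P u g = u (q g).

Lemma smooth_transpose f g : dist_of (smooth_restr P f) g = dist_of f (q g).
Proof. by rewrite -smooth_restrE Pq. Qed.

Lemma transposeE u f : transpose P u f = u (smooth_restr P f).
Proof.
have bu := transpose_bounded DE dist_ofC dist_of_nondegenerate smooth_transpose u.
have [v hv] := distribution_of_functional good_L L_cover bu.
apply: (@xgetPex _ 0 [set v : schwartz_dist X | forall f, v f = u (smooth_restr P f)]).
by exists v.
Qed.

Lemma transpose_dist_of g : transpose P (dist_of g) = dist_of (q g).
Proof.
by apply: dist_ext => f; rewrite transposeE dist_ofC smooth_transpose dist_ofC.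
Qed.

Lemma smooth_restr_transpose g : smooth_restr (transpose P) g = q g.
Proof.
apply: dist_of_inj; rewrite -transpose_dist_of; apply/esym.
apply: (@xgetPex _ 0 [set h | transpose P (dist_of g) = dist_of h]).
by exists (q g); exact: transpose_dist_of.
Qed.

(** On smooth functions [transpose P] is [q], and [P] is the composition with
    [q]. *)
Lemma transposeK u : transpose (transpose P) u = P u.
Proof.
apply: dist_ext => f; rewrite Pq -smooth_restr_transpose.
apply: (@xgetPex _ 0 [set v : schwartz_dist X | forall f, v f = u (smooth_restr (transpose P) f)]).
by exists (P u) => g; rewrite smooth_restr_transpose Pq.
Qed.

Lemma transpose_eq0 u : transpose P u = 0 <-> forall f, u (smooth_restr P f) = 0.
Proof.
split=> [u0 f|u0]; first by rewrite -transposeE u0.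
by apply: dist_ext => f; rewrite transposeE u0.
Qed.

Local Notation ev := (fun (u : schwartz_dist X) f => u f).

Lemma smooth_solvableP : smooth_solvable P <-> solvable ev (smooth_restr P).
Proof.
split=> h f hf.
  have [|x] := h f; first by move=> v /transpose_eq0; exact: hf.
  by rewrite smooth_restrE => /dist_of_inj; exists x.
have [|x <-] := h f; first by move=> u /transpose_eq0; exact: hf.
by exists x; exact: smooth_restrE.
Qed.

Lemma dist_solvableP : dist_solvable (transpose P) <-> dual_solvable ev (smooth_restr P).
Proof.
split=> h u hu.
  have [|w <-] := h u; last by exists w => x; exact: transposeE.
  move=> v; rewrite transposeK smooth_restrE => /dist_of_eq0; exact: hu.
have [|w hw] := h u; last first.
  by exists w; apply: dist_ext => f; rewrite transposeE hw.
move=> x px; apply: hu; rewrite transposeK smooth_restrE px.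
by apply: dist_ext => g; rewrite dist_ofC (functional0 (ev_bounded DE (dist_of g)).1).
Qed.

Lemma hypoellipticP : almost_globally_hypoelliptic P <-> hypoelliptic ev (@dist_of R n X) (smooth_restr P) q.
Proof.
split=> h.
  move=> u f uf; have Pu : P u = dist_of f by apply: dist_ext => g; rewrite Pq uf.
  have [|v] := h u; first by exists f.
  by rewrite smooth_restrE Pu => /dist_of_inj; exists v.
move=> u [f Pu]; have [|v pv] := h u f; first by move=> g; rewrite -Pq Pu.
by exists v; rewrite smooth_restrE pv Pu.
Qed.

(** Evaluations are strongly continuous, so strong density implies weak
    density. *)
Lemma dense_smooth_kernel :
  [set u : schwartz_dist X | transpose P u = 0] `<=`
    closure [set dist_of v | v in
               [set v : smooth_fun X | transpose P (dist_of v) = 0]] ->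
  forall u, (forall x, u (smooth_restr P x) = 0) -> forall f e, 0 < e ->
  exists2 v, q v = 0 & normc (u f - dist_of v f) <= e.
Proof.
move=> dense u /transpose_eq0 /dense cl f e e0.
have [_ [[v /= v0 <-] /= hv]] := cl _ (nbhs_evaluation good_L L_cover u f e0).
exists v; last exact: ltW.
by apply: dist_of_eq0; rewrite -transpose_dist_of.
Qed.

End operator.

Theorem corollary3p8 (R : realType) (n : nat) (X : compact_riemannian R n)
    (P : {linear schwartz_dist X -> schwartz_dist X})
    (P_continuous : continuous P)
    (P_smooth : preserves_smooth P)
    (P_dense : [set u : schwartz_dist X | transpose P u = 0] `<=`
       closure [set dist_of v | v in
                 [set v : smooth_fun X | transpose P (dist_of v) = 0]]) :
  [<-> smooth_solvable P;
       dist_solvable (transpose P);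
       almost_globally_hypoelliptic P].
Proof.
have [L [good_L L_cover]] := finite_atlas (@cr_compact _ _ X).
have [q Pq] := exists_smooth_transpose good_L L_cover P_continuous.
have DE := smooth_schwartz_duality good_L L_cover.
have dense := dense_smooth_kernel P_smooth good_L L_cover Pq P_dense.
have pq := smooth_transpose P_smooth Pq.
have S := smooth_solvableP P_smooth good_L L_cover Pq.
have D := dist_solvableP P_smooth good_L L_cover Pq.
have H := hypoellipticP P_smooth Pq.
have sd := solvable_dual_solvable DE (@dist_ofC R n X) (@dist_of_nondegenerate R n X) pq.
have ds := dual_solvable_solvable DE (@dist_ofC R n X) (@dist_of_nondegenerate R n X) pq.
have sh := solvable_hypoelliptic DE (@dist_ofC R n X) dense.
have hs := hypoelliptic_solvable DE (@dist_ofC R n X) (@dist_of_nondegenerate R n X)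
  (dist_of_bound good_L L_cover) pq.
tfae.
- by move=> /S /sd /D.
- by move=> /D /ds /sh /H.
- by move=> /H /hs /S.
Qed.
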